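(* The map $\widehat P:G(X)\to G_c[[r]]$, $\widehat P([a])=P(a)$, is a surjective homomorphism of topological groups. The kernel $\widehat{\mathcal{C}}\subset G(X)$ of $\widehat P$ is the image of the center set $\mathcal{C}\subset X$ in $G(X)$. Moreover, $\widehat{\mathcal{C}}$ is a non-trivial, normal, closed, contractible to a point, arcwise connected, locally simply and arcwise connected subgroup of $G(X)$.
   Context: Functions on the circle $S^1$ are identified with $2\pi$-periodic functions on $\mathbb{R}$. $X$ is the complex vector space of sequences $a=(a_1,a_2,\dots)$ with $a_i\in L^\infty(S^1)$ (complex-valued) for which there is $l>0$ (depending on $a$) with $\sup_{x\in S^1}|a_i(x)|\le l^i$ for all $i\ge1$ (sup understood as the $L^\infty$-norm). For $a,b\in X$: $a*b=(a_1*b_1,a_2*b_2,\dots)\in X$ and $a^{-1}=(a_1^{-1},a_2^{-1},\dots)\in X$, where $(a_i*b_i)(t)=2a_i(2t)$ for $0<t\le\pi$, $(a_i*b_i)(t)=2b_i(2t-2\pi)$ for $\pi<t\le2\pi$, and $a_i^{-1}(t)=-a_i(2\pi-t)$ for $0<t\le2\pi$ (extended $2\pi$-periodically). Basic iterated integrals on $X$: $I_{i_1,\dots,i_k}(a)=\int\cdots\int_{0\le s_1\le\cdots\le s_k\le2\pi}a_{i_k}(s_k)\cdots a_{i_1}(s_1)\,ds_k\cdots ds_1$. $\mathcal{U}\subset X$ is the set of $a$ at which all $I_{i_1,\dots,i_k}$ with $k\ge1$ vanish. The relation $a\sim b$ iff $a*b^{-1}\in\mathcal{U}$ is an equivalence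 relation; $G(X)$ is the set of classes $[a]$, a group under $[a]\cdot[b]=[a*b]$ with unit $[0]$. Each $I_{i_1,\dots,i_k}$ is constant on classes and gives a function $\widehat I_{i_1,\dots,i_k}$ on $G(X)$; $\tau$ is the weakest topology on $G(X)$ making all of these continuous. For $a\in X$ and sufficiently small $r$ let $v(x;r;a)$, $x\in[0,2\pi]$, be the unique Lipschitz function satisfying $\frac{dv}{dx}=\sum_{i\ge1}a_i(x)v^{i+1}$ almost everywhere and $v(0;r;a)=r$. The first return map is $P(a)(r):=v(2\pi;r;a)$. The center set $\mathcal{C}\subset X$ is the set of $a$ with $v(2\pi;r;a)=r$ for all sufficiently small $r$. $P(a)$ depends only on the class $[a]$. $G_c[[r]]$ is the set of complex power series $f(r)=r+\sum_{k\ge1}d_k(f)r^{k+1}$, each convergent near $0\in\mathbb{C}$, a group under composition, with the product written in the order $f\cdot g:=g\circ f$; its topology $\tau'$ is the weakest in which all $d_k$ are continuous. A homomorphism of topological groups is a continuous group homomorphism. ''Locally simply and arcwise connected'' means locally simply connected and locally arcwise connected. *)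

(* Defs.v *)
From HB Require Import structures.
From mathcomp Require Import all_boot all_order all_algebra.
From mathcomp Require Import complex.
From mathcomp Require Import all_classical all_reals all_analysis.
From mathcomp Require Import measurable_realfun.
From mathcomp Require Import ring lra.
Set Implicit Arguments.
Unset Strict Implicit.
Unset Printing Implicit Defensive.
Import Order.TTheory GRing.Theory Num.Theory.
Import numFieldNormedType.Exports.
Local Open Scope classical_set_scope.
Local Open Scope ring_scope.
Local Open Scope complex_scope.

Section CircleCoefficients.
Variable R : realType.
Local Notation C := R[i].
Local Notation mu := (@lebesgue_measure R).

(* Elements of L^oo(S^1) are represented by 2 pi-periodic Borel functions; two
   representatives of one class have the same iterated integrals, so the
   quotient GX below identifies them. The component a i stands for a_(i+1). *)
Record in_X (a : nat -> R -> C) : Prop := InX {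
  in_X_Re : forall i, measurable_fun [set: R] (fun t => complex.Re (a i t));
  in_X_Im : forall i, measurable_fun [set: R] (fun t => complex.Im (a i t));
  in_X_periodic : forall i t, a i (t + 2 * pi) = a i t;
  in_X_growth : exists2 l : R, 0 < l &
    forall i, {ae mu, forall t, `|a i t| <= (l ^+ i.+1)%:C}
}.

Definition X := {a : nat -> R -> C | in_X a}.

Definition coeff (a : X) : nat -> R -> C := sval a.

(* The representative of t modulo 2 pi in ]0, 2 pi]. *)
Definition circ (t : R) : R := t - (Num.ceil (t / (2 * pi)) - 1)%:~R * (2 * pi).

Definition star (a b : nat -> R -> C) (i : nat) (t : R) : C :=
  let u := circ t in
  if u <= pi then 2 * a i (2 * u) else 2 * b i (2 * u - 2 * pi).

(* The formula for ]0, 2 pi] is already 2 pi-periodic when a i is. *)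
Definition rev (a : nat -> R -> C) (i : nat) (t : R) : C :=
  - a i (2 * pi - t).

Lemma periodicz (a : nat -> R -> C) (i : nat) : in_X a ->
  forall (m : int) t, a i (t + m%:~R * (2 * pi)) = a i t.
Proof.
move=> Xa; have pn n t : a i (t + n%:R * (2 * pi)) = a i t.
  elim: n => [|n IH]; first by rewrite mul0r addr0.
  by rewrite -natr1 mulrDl mul1r addrA in_X_periodic.
case=> n t; first exact: pn.
by rewrite NegzE -[LHS](pn n.+1) mulrNz mulNr addrNK.
Qed.

Lemma measurable_affine (c d : R) :
  measurable_fun [set: R] (fun t : R => c * t + d : R).
Proof. by apply: measurable_funD => //; exact: measurable_funM. Qed.

Lemma lebesgue_measure_dbl (A : set R) : measurable A ->
  (2%:E * mu ((fun t : R => 2 * t + 0)%R @^-1` A) = mu A)%E.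
Proof.
pose f : measurableTypeR R -> measurableTypeR R := fun t : R => 2 * t + 0.
have mf : measurable_fun [set: measurableTypeR R] f by exact: measurable_affine.
pose nu : {measure set (measurableTypeR R) -> \bar R} := pushforward mu f.
have two0 : 0 <= 2 :> R by [].
pose m : {measure set (measurableTypeR R) -> \bar R} :=
  mscale (NngNum two0) (nu mf).
move=> mA; apply/esym; rewrite -[LHS]/(mu A) -[RHS]/(m A).
apply: lebesgue_measure_unique => // _ [[a b]] _ <-.
have E : f @^-1` `]a, b] = `]a / 2, b / 2]%classic.
  by apply/seteqP; split => t /=; rewrite !in_itv/= /f addr0
    ltr_pdivrMr// ler_pdivlMr// mulrC.
rewrite -[RHS]/(2%:E * mu (f @^-1` `]a, b]))%E E.
rewrite !lebesgue_measure_itv/= !lte_fin ltr_pM2r//.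
by case: ifPn => _; rewrite ?mule0// -EFinB -EFinM -mulrBl mulrC divfK.
Qed.

Lemma lebesgue_measure_refl (d : R) (A : set R) : measurable A ->
  mu ((fun t : R => -1 * t + d)%R @^-1` A) = mu A.
Proof.
pose f : measurableTypeR R -> measurableTypeR R := fun t : R => -1 * t + d.
have mf : measurable_fun [set: measurableTypeR R] f by exact: measurable_affine.
pose nu : {measure set (measurableTypeR R) -> \bar R} := pushforward mu f.
move=> mA; apply/esym.
apply: (lebesgue_measure_unique (mu := nu mf)) => // _ [[a b]] _ <-.
have E : f @^-1` `]a, b] = `[d - b, d - a[%classic.
  apply/seteqP; split => t /=; rewrite !in_itv/= /f => /andP[h1 h2];
  apply/andP; split; lra.
rewrite -[RHS]/(mu (f @^-1` `]a, b])) E !lebesgue_measure_itv/= !lte_fin.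
have -> : (d - b < d - a) = (a < b) by apply/idP/idP; lra.
by case: ifPn => _ //; rewrite -!EFinB; congr EFin; lra.
Qed.

Lemma ae_dbl (P : R -> Prop) :
  {ae mu, forall t, P t} -> {ae mu, forall t, P (2 * t + 0)}.
Proof.
case=> B [mB B0 BP].
exists ((fun t : R => 2 * t + 0) @^-1` B); split.
- by rewrite -[X in measurable X]setTI; exact: measurable_affine.
- have := lebesgue_measure_dbl mB; rewrite B0 => /eqP.
  by rewrite mule_eq0 eqe pnatr_eq0/= => /eqP.
- by move=> t /= Pt; apply: BP.
Qed.

Lemma ae_refl (d : R) (P : R -> Prop) :
  {ae mu, forall t, P t} -> {ae mu, forall t, P (-1 * t + d)}.
Proof.
case=> B [mB B0 BP].
exists ((fun t : R => -1 * t + d) @^-1` B); split.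
- by rewrite -[X in measurable X]setTI; exact: measurable_affine.
- by rewrite -B0 lebesgue_measure_refl.
- by move=> t /= Pt; apply: BP.
Qed.

Lemma measurable_circ : measurable_fun [set: R] circ.
Proof.
apply: measurable_funB => //; apply: measurable_funM => //.
apply: nondecreasing_measurable => //= x y xy.
by rewrite ler_int lerB// le_ceil// ler_pM2r// invr_gt0 mulr_gt0// pi_gt0.
Qed.

Lemma starE a b i t : in_X a -> in_X b ->
  star a b i t = if circ t <= pi then 2 * a i (2 * t + 0)
                 else 2 * b i (2 * t + 0).
Proof.
move=> Xa Xb; rewrite /star; set m := (Num.ceil (t / (2 * pi)) - 1).
case: ifPn => _; congr (2 * _).
  rewrite -[RHS](periodicz i Xa (- (2 * m))%R) /circ -/m.
  congr (a i _); ring.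
rewrite -[RHS](periodicz i Xb (- (2 * m + 1))%R) /circ -/m.
by congr (b i _); ring.
Qed.

Lemma circ_periodic t : circ (t + 2 * pi) = circ t.
Proof.
rewrite /circ.
have p0 : 2 * pi != 0 :> R by rewrite mulf_neq0 ?lt0r_neq0 ?pi_gt0.
rewrite (mulrDl t) divff// ceilDrz ?rpred1// ceil1 -addrA rmorphB rmorphD /=.
by ring.
Qed.

Lemma in_X_star a b : in_X a -> in_X b -> in_X (star a b).
Proof.
move=> Xa Xb.
have mcirc : measurable_fun [set: R] (fun t => circ t <= pi).
  by apply: measurable_fun_ler => //; exact: measurable_circ.
have maff : measurable_fun [set: R] (fun t : R => 2 * t + 0 : R).
  exact: measurable_affine.
have Re2 z : complex.Re (2 * z : C) = 2 * complex.Re z.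
  by case: z => x y /=; simpc; ring.
have Im2 z : complex.Im (2 * z : C) = 2 * complex.Im z.
  by case: z => x y /=; simpc; ring.
split.
- move=> i; under eq_fun do rewrite starE// (fun_if (@complex.Re R)) !Re2.
  apply: measurable_fun_ifT => //; apply: measurable_funM => //.
    exact: (measurableT_comp (in_X_Re Xa i)).
  exact: (measurableT_comp (in_X_Re Xb i)).
- move=> i; under eq_fun do rewrite starE// (fun_if (@complex.Im R)) !Im2.
  apply: measurable_fun_ifT => //; apply: measurable_funM => //.
    exact: (measurableT_comp (in_X_Im Xa i)).
  exact: (measurableT_comp (in_X_Im Xb i)).
- by move=> i t; rewrite /star circ_periodic.
- case: (in_X_growth Xa) => l l0 al; case: (in_X_growth Xb) => m m0 bm.
  exists (2 * (l + m)); first by rewrite mulr_gt0// addr_gt0.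
  move=> i; have := ae_dbl (al i); have := ae_dbl (bm i).
  have FF := ae_filter_ringOfSetsType mu.
  apply: filterS2 => t h1 h2; rewrite starE// exprMn rmorphM/=.
  have e2 : (2 : C) <= (2 ^+ i.+1)%:C.
    rewrite rmorphXn/= rmorph_nat -[leLHS]expr1; apply: ler_weXn2l => //.
    by rewrite ler1n.
  case: ifPn => _; rewrite normrM ger0_norm//; apply: ler_pM => //.
    apply: le_trans h2 _; rewrite lecR; apply: lerXn2r;
      rewrite ?nnegrE ?ltW ?addr_gt0//; lra.
  apply: le_trans h1 _; rewrite lecR; apply: lerXn2r;
    rewrite ?nnegrE ?ltW ?addr_gt0//; lra.
Qed.

Lemma in_X_rev a : in_X a -> in_X (rev a).
Proof.
move=> Xa; have e t : 2 * pi - t = -1 * t + 2 * pi :> R by ring.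
split.
- move=> i; rewrite /rev; under eq_fun do rewrite raddfN/= e.
  apply: measurable_funN.
  by apply: (measurableT_comp (in_X_Re Xa i)); exact: measurable_affine.
- move=> i; rewrite /rev; under eq_fun do rewrite raddfN/= e.
  apply: measurable_funN.
  by apply: (measurableT_comp (in_X_Im Xa i)); exact: measurable_affine.
- by move=> i t; rewrite /rev -(in_X_periodic Xa); congr (- a i _); ring.
- case: (in_X_growth Xa) => l l0 al; exists l => // i.
  have FF := ae_filter_ringOfSetsType mu.
  apply: filterS (ae_refl (2 * pi) (al i)) => t.
  by rewrite /rev normrN -e.
Qed.

Lemma in_X0 : in_X (fun _ _ => 0).
Proof.
split=> //; exists 1 => // i.
have FF := ae_filter_ringOfSetsType mu; apply/nearW => t.
by rewrite normr0 expr1n lecR ler01.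
Qed.

Definition starX (a b : X) : X := exist _ _ (in_X_star (svalP a) (svalP b)).
Definition revX (a : X) : X := exist _ _ (in_X_rev (svalP a)).
Definition zeroX : X := exist _ _ in_X0.

End CircleCoefficients.

Section GroupOfClasses.
Variable R : realType.
Local Notation C := R[i].
Local Notation mu := (@lebesgue_measure R).

Definition Cintegral (D : set R) (f : R -> C) : C :=
  (\int[mu]_(t in D) complex.Re (f t))%R +i*
  (\int[mu]_(t in D) complex.Im (f t))%R.

(* For w = [:: i_1; ...; i_k], the integral of
   a_(i_k)(s_k) ... a_(i_1)(s_1) ds_k ... ds_1
   over s <= s_1 <= ... <= s_k <= 2 pi; as in in_X, the letter i refers to the component of index i + 1. *)
Fixpoint iter_int (a : X R) (w : seq nat) (s : R) : C :=
  if w is i :: w' then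
    Cintegral `[s, 2 * pi]%classic (fun t => coeff a i t * iter_int a w' t)
  else 1.

Definition basic_int (w : seq nat) (a : X R) : C := iter_int a w 0.

Definition universal_set : set (X R) :=
  [set a | forall w : seq nat, w != [::] -> basic_int w a = 0].

Definition simX (a b : X R) : Prop := universal_set (starX a (revX b)).

Definition coset (a : X R) : set (X R) := [set b | simX a b].

Definition GX := {A : set (X R) | exists a, A = coset a}.

Definition class_of (a : X R) : GX := exist _ (coset a) (ex_intro _ a erefl).

Definition rep (g : GX) : X R := sval (cid (svalP g)).

Lemma repK g : class_of (rep g) = g.
Proof.
rewrite /rep; case: cid => a /= ga; case: g ga => A ex /= ga.
by apply: eq_exist; rewrite ga.
Qed.

(* simX is a congruence for starX and revX, and basic_int is constant on its
   classes, so none of mulG, invG and hat_int depends on the choice of rep. *)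
Definition mulG (g h : GX) : GX := class_of (starX (rep g) (rep h)).
Definition oneG : GX := class_of (zeroX R).
Definition invG (g : GX) : GX := class_of (revX (rep g)).

Definition hat_int (w : seq nat) (g : GX) : C := basic_int w (rep g).

HB.instance Definition _ := gen_eqMixin GX.
HB.instance Definition _ := gen_choiceMixin GX.
HB.instance Definition _ := hasMul.Build GX mulG.
HB.instance Definition _ := hasOne.Build GX oneG.
HB.instance Definition _ := hasInv.Build GX invG.
HB.instance Definition _ := Topological.copy GX
  (sup_topology (fun w : seq nat => Topological.on
     (initial_topology (hat_int w : GX -> C^o)))).

End GroupOfClasses.

Section FirstReturn.
Variable R : realType.
Local Notation C := R[i].
Local Notation mu := (@lebesgue_measure R).

Definition is_solution (a : X R) (r : C) (v : R -> C) : Prop :=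
  [/\ v 0 = r,
      exists k : R, forall x y, x \in `[0, 2 * pi] -> y \in `[0, 2 * pi] ->
        `|v x - v y| <= (k * `|x - y|)%:C
    & {ae mu, forall x, x \in `]0, 2 * pi[ -> exists2 L : C^o,
        series (fun i => coeff a i x * v x ^+ i.+2 : C^o) @ \oo --> L
      & ((v (x + h) - v x) / h%:C : C^o) @[h --> (0 : R)^'] --> L}].

(* z is the value at 2 pi of the unique solution starting at r. *)
Definition first_return (a : X R) (r z : C) : Prop :=
  (exists v, is_solution a r v) /\
  (forall v, is_solution a r v -> v (2 * pi) = z).

Definition center_set : set (X R) :=
  [set a | \forall r \near (0 : C^o), first_return a r r].

End FirstReturn.

Section ConvergentSeries.
Variable R : realType.
Local Notation C := R[i].

Definition pseries_at (c : nat -> C) (z : C) : nat -> C^o :=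
  series (fun n => c n * z ^+ n : C^o).

(* c lists all coefficients: c n is the coefficient of r^n. *)
Record in_Gc (c : nat -> C) : Prop := InGc {
  in_Gc0 : c 0%N = 0;
  in_Gc1 : c 1%N = 1;
  in_Gc_cvg : \forall z \near (0 : C^o), cvgn (pseries_at c z)
}.

Definition trunc (n : nat) (c : nat -> C) : {poly C} := \poly_(i < n.+1) c i.

(* f has no constant term, so the coefficient of order n of g(f(r)) only
   involves the coefficients of f and g up to order n. *)
Definition formal_comp (g f : nat -> C) (n : nat) : C :=
  (trunc n g \Po trunc n f)`_n.

Definition X_coef (n : nat) : C := (n == 1)%:R.

Lemma cvg_dominated (u : nat -> C^o) (v : nat -> R) :
  (forall n, `|u n| <= (v n)%:C) -> cvgn (series v) -> cvgn (series u).
Proof.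
move=> uv cv.
have uRe n : `|complex.Re (u n)| <= v n.
  rewrite -lecR; apply: le_trans (uv n).
  case: (u n) => x y /=; rewrite normc_def /= lecR.
  by rewrite -sqrtr_sqr ler_wsqrtr// lerDl sqr_ge0.
have uIm n : `|complex.Im (u n)| <= v n.
  rewrite -lecR; apply: le_trans (uv n).
  case: (u n) => x y /=; rewrite normc_def /= lecR.
  by rewrite -sqrtr_sqr ler_wsqrtr// lerDr sqr_ge0.
have cRe : cvgn (series (fun n => complex.Re (u n))).
  apply: normed_cvg; apply: (series_le_cvg _ _ uRe cv) => // n.
  exact: le_trans (uRe n).
have cIm : cvgn (series (fun n => complex.Im (u n))).
  apply: normed_cvg; apply: (series_le_cvg _ _ uIm cv) => // n.
  exact: le_trans (uIm n).
move: cRe cIm => /cvg_ex[/= x cx] /cvg_ex[/= y cy].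
apply/cvg_ex; exists (x +i* y).
have -> : series u = fun n => (series (fun n => complex.Re (u n)) n) +i*
    (series (fun n => complex.Im (u n)) n).
  apply/funext => n; rewrite /series/=; elim: n => [|n IH].
    by rewrite !big_nil.
  by rewrite !big_nat_recr//= IH; case: (u n) => ? ?; simpc.
apply/cvgrPdist_le => -[e e'] /=; rewrite ltcE/= => /andP[/eqP -> e0].
near=> n.
have hx : `|x - series (fun n => complex.Re (u n)) n| <= e / 2.
  by near: n; move/cvgrPdist_le : cx; apply; exact: divr_gt0.
have hy : `|y - series (fun n => complex.Im (u n)) n| <= e / 2.
  by near: n; move/cvgrPdist_le : cy; apply; exact: divr_gt0.
set p := x - _ in hx; set q := y - _ in hy.
simpc; rewrite -/p -/q /=.
rewrite -[leRHS](ger0_norm (ltW e0)) -sqrtr_sqr ler_wsqrtr//.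
rewrite -[p ^+ 2]real_normK ?num_real// -[q ^+ 2]real_normK ?num_real//.
have := normr_ge0 p; have := normr_ge0 q; nra.
Unshelve. all: by end_near. Qed.

Lemma pseries_bound (c : nat -> C) (z : C) :
  cvgn (pseries_at c z) ->
  exists2 K : R, 1 <= K & forall n, `|c n * z ^+ n| <= K%:C.
Proof.
move=> /cvg_series_cvg_0 c0.
have /cvg_seq_bounded : cvgn (fun n => c n * z ^+ n : C^o).
  by apply/cvg_ex; exists 0.
case=> -[M M'] [/= Mr H].
have M'0 : M' = 0 by move: Mr; rewrite complex_real => /eqP.
exists (Num.max 1 (M + 1)); first by rewrite le_max lexx.
move=> n; apply: H => //; rewrite ltcE/= M'0 eqxx/=.
by rewrite lt_max ltrDl ltr01 orbT.
Qed.

Lemma in_Gc_growth (c : nat -> C) : in_Gc c ->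
  exists2 M : R, 1 <= M & forall n, `|c n| <= (M ^+ n)%:C.
Proof.
case=> c0 _ /nbhs_normP[-[e e'] /=]; rewrite ltcE/= => /andP[/eqP -> e0] H.
pose z := Num.min (e / 2) 1.
have z0 : 0 < z by rewrite lt_min divr_gt0// ltr01.
have z1 : z <= 1 by rewrite ge_min lexx orbT.
have /pseries_bound[K K1 HK] : cvgn (pseries_at c z%:C).
  apply: H; rewrite /= sub0r normrN ger0_norm ?ler0c ?(ltW z0)// ltcR.
  by rewrite gt_min; apply/orP; left; lra.
have K0 : 0 < K by exact: lt_le_trans K1.
exists (K / z); first by rewrite ler_pdivlMr// mul1r (le_trans z1).
case=> [|n]; first by rewrite c0 normr0 ler0c.
have := HK n.+1; rewrite normrM normrX (@ger0_norm _ z%:C) ?ler0c ?(ltW z0)//.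
have -> : z%:C ^+ n.+1 = (z ^+ n.+1)%:C by rewrite rmorphXn.
rewrite -ler_pdivlMr ?ltcR ?exprn_gt0// => h.
apply: le_trans h _; rewrite -fmorphV -rmorphM lecR expr_div_n.
by rewrite ler_pM2r ?invr_gt0 ?exprn_gt0// ler_eXnr.
Qed.

Lemma growth_cvg (c : nat -> C) (M : R) : 1 <= M ->
  (forall n, `|c n| <= (M ^+ n)%:C) ->
  \forall z \near (0 : C^o), cvgn (pseries_at c z).
Proof.
move=> M1 cM; have M0 : 0 < M by exact: lt_le_trans M1.
apply/nbhs_normP; exists ((2 * M)^-1)%:C => /=.
  by rewrite ltcR invr_gt0 mulr_gt0.
move=> z /=; rewrite sub0r normrN => /ltW zM.
apply: (@cvg_dominated _ (geometric 1 2^-1)); last first.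
  apply: is_cvg_geometric_series.
  by rewrite ger0_norm ?invr_ge0// invf_lt1// ltr1n.
move=> n; rewrite normrM normrX /geometric/= mul1r.
have -> : 2^-1 = M * (2 * M)^-1 :> R.
  by rewrite invfM mulrCA divff ?mulr1// gt_eqF.
by rewrite exprMn rmorphM; apply: ler_pM => //;
  rewrite ?exprn_ge0// rmorphXn lerXn2r// nnegrE ler0c invr_ge0 mulr_ge0// ltW.
Qed.

Definition majorized (p : {poly C}) (P : {poly R}) :=
  forall i, `|p`_i| <= (P`_i)%:C.

Lemma majorized_ge0 p P i : majorized p P -> 0 <= P`_i.
Proof. by move=> h; rewrite -ler0c (le_trans _ (h i)). Qed.

Lemma majorizedM p P q Q :
  majorized p P -> majorized q Q -> majorized (p * q) (P * Q).
Proof.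
move=> hp hq i; rewrite !coefM rmorph_sum.
apply: le_trans (ler_norm_sum _ _ _) _.
by apply: ler_sum => j _; rewrite normrM rmorphM ler_pM.
Qed.

Lemma majorizedX p P k : majorized p P -> majorized (p ^+ k) (P ^+ k).
Proof.
move=> hp; elim: k => [|k IH]; last by rewrite !exprS; exact: majorizedM.
by move=> i; rewrite !expr0 !coef1; case: eqP; rewrite ?normr1 ?normr0.
Qed.

Lemma majorized_comp p P q Q :
  majorized p P -> majorized q Q -> majorized (p \Po q) (P \Po Q).
Proof.
move=> hp hq i; rewrite !coef_comp_poly.
pose N := maxn (size p) (size P).
have cut (F : nzRingType) (u v : {poly F}) m : (size u <= m)%N ->
    \sum_(j < size u) u`_j * (v ^+ j)`_i = \sum_(j < m) u`_j * (v ^+ j)`_i.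
  move=> um; rewrite -!(big_mkord xpredT (fun j => u`_j * (v ^+ j)`_i)).
  rewrite [RHS](big_cat_nat (leq0n _) um)/=.
  rewrite [X in _ + X]big_nat_cond [X in _ + X]big1 ?addr0//.
  by move=> j /andP[/andP[uj _] _]; rewrite nth_default ?mul0r.
rewrite (cut _ _ _ N) ?leq_maxl// (cut _ _ _ N) ?leq_maxr// rmorph_sum.
apply: le_trans (ler_norm_sum _ _ _) _; apply: ler_sum => j _.
by rewrite normrM rmorphM ler_pM//; exact: majorizedX.
Qed.

Lemma in_Gc_comp (g f : nat -> C) : in_Gc g -> in_Gc f ->
  in_Gc (formal_comp g f).
Proof.
move=> Gg Gf.
have comp0 : formal_comp g f 0 = 0.
  rewrite /formal_comp /trunc coef_comp_poly big1// => -[j jn] _ /=.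
  rewrite !poly_def !big_ord1 !expr0 (in_Gc0 Gg) scale0r.
  by rewrite coef0 mul0r.
split=> //.
  rewrite /formal_comp /trunc !poly_def !big_ord_recl !big_ord0 /=.
  rewrite (in_Gc0 Gg) (in_Gc0 Gf) /= /bump /= (in_Gc1 Gg) (in_Gc1 Gf).
  by rewrite !scale0r !add0r !scale1r !addr0 !expr1 comp_polyX coefX.
have [M1 M1_1 gM1] := in_Gc_growth Gg; have [M2 M2_1 fM2] := in_Gc_growth Gf.
pose M := Num.max M1 M2.
have M_1 : 1 <= M by rewrite le_max M1_1.
have M0 : 0 < M by exact: lt_le_trans M_1.
have gM n : `|g n| <= (M ^+ n)%:C.
  apply: le_trans (gM1 n) _; rewrite lecR lerXn2r ?nnegrE ?(ltW M0)//.
    by rewrite (le_trans ler01).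
  by rewrite le_max lexx.
have fM n : `|f n| <= (M ^+ n)%:C.
  apply: le_trans (fM2 n) _; rewrite lecR lerXn2r ?nnegrE ?(ltW M0)//.
    by rewrite (le_trans ler01).
  by rewrite le_max lexx orbT.
have geo (x : R) n : 0 <= x <= 1 / 2 -> \sum_(i < n) x ^+ i <= 2 - 2 * x ^+ n.
  move=> /andP[x0 x2]; elim: n => [|n IH]; first by rewrite big_ord0 expr0; lra.
  rewrite big_ord_recr/= exprS; have := exprn_ge0 n x0; nra.
pose rho : R := (4 * M ^+ 2)^-1.
have rho0 : 0 < rho by rewrite invr_gt0 mulr_gt0// exprn_gt0.
apply: (@growth_cvg _ (2 * rho^-1)).
  by rewrite /rho invrK; have := @exprn_ege1 _ 2 _ M_1; lra.
case=> [|n]; first by rewrite comp0 normr0 ler0c.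
set N := n.+1.
pose G : {poly R} := \poly_(i < N.+1) M ^+ i.
pose F : {poly R} := \poly_(i < N.+1) (if i == 0%N then 0 else M ^+ i).
have hG : majorized (trunc N g) G.
  by move=> i; rewrite !coef_poly; case: ifP; rewrite ?normr0.
have hF : majorized (trunc N f) F.
  move=> i; rewrite !coef_poly; case: ifP => _; rewrite ?normr0//.
  by case: eqP => [->|//]; rewrite (in_Gc0 Gf) normr0.
have hGF := majorized_comp hG hF.
apply: le_trans (hGF N) _; rewrite lecR.
have F_rho : 0 <= F.[rho] <= (2 * M)^-1.
  rewrite horner_poly big_ord_recl/= mul0r add0r; apply/andP; split.
    by apply: sumr_ge0 => i _; rewrite mulr_ge0// exprn_ge0// ltW.
  have -> : \sum_(i < N) (M ^+ bump 0 i * rho ^+ bump 0 i) =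
      (4 * M)^-1 * \sum_(i < N) ((4 * M)^-1) ^+ i.
    rewrite mulr_sumr; apply: eq_bigr => i _; rewrite /bump/= add1n -exprMn.
    by rewrite -exprS; congr (_ ^+ _); rewrite /rho; field; rewrite gt_eqF.
  have q0 : 0 < (4 * M)^-1 by rewrite invr_gt0 mulr_gt0.
  have q1 : (4 * M)^-1 <= 1 / 2.
    by rewrite div1r lef_pV2 ?posrE ?mulr_gt0//; lra.
  have /geo : 0 <= (4 * M)^-1 <= 1 / 2 by rewrite ltW.
  move=> /(_ N) h; have := exprn_ge0 N (ltW q0).
  have -> : (2 * M)^-1 = (4 * M)^-1 * 2 by field; rewrite gt_eqF.
  by rewrite ler_pM2l//; lra.
have GF_rho : (G \Po F).[rho] <= 2.
  rewrite horner_comp horner_poly; move: F_rho => /andP[y0 y1].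
  under eq_bigr do rewrite -exprMn.
  have h : 0 <= M * F.[rho] <= 1 / 2.
    rewrite mulr_ge0 ?(ltW M0)//=.
    have : M * F.[rho] <= M * (2 * M)^-1 by rewrite ler_pM2l.
    by rewrite invfM mulrCA divff ?gt_eqF// mulr1 div1r.
  have := geo _ N.+1 h; case/andP: h => h _; have := exprn_ge0 N.+1 h; lra.
have : (G \Po F)`_N * rho ^+ N <= 2.
  apply: le_trans GF_rho; rewrite horner_coef.
  have [sN|Ns] := leqP (size (G \Po F)) N.
    rewrite nth_default// mul0r; apply: sumr_ge0 => i _.
    by rewrite mulr_ge0 ?exprn_ge0 ?(ltW rho0)// (majorized_ge0 _ hGF).
  rewrite (bigD1 (Ordinal Ns))//= lerDl; apply: sumr_ge0 => i _.
  by rewrite mulr_ge0 ?exprn_ge0 ?(ltW rho0)// (majorized_ge0 _ hGF).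
rewrite -ler_pdivlMr ?exprn_gt0// => /le_trans; apply.
have -> : (2 * rho^-1) ^+ N = 2 ^+ N / rho ^+ N by rewrite exprMn exprVn.
rewrite ler_pM2r ?invr_gt0 ?exprn_gt0//.
by rewrite -[leLHS]expr1 ler_weXn2l// ler1n.
Qed.

Lemma in_Gc_X : in_Gc X_coef.
Proof.
split=> //; apply: (@growth_cvg _ 1) => // n.
by rewrite expr1n /X_coef; case: eqP; rewrite ?normr1 ?normr0.
Qed.

Definition Gc := {c : nat -> C | in_Gc c}.

Definition series_coef (f : Gc) : nat -> C := sval f.

Definition d_ (k : nat) (f : Gc) : C^o := series_coef f k.+1.

(* The product f . g is g o f. *)
Definition mulGc (f g : Gc) : Gc :=
  exist _ _ (in_Gc_comp (svalP g) (svalP f)).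
Definition oneGc : Gc := exist _ _ in_Gc_X.

HB.instance Definition _ := gen_eqMixin Gc.
HB.instance Definition _ := gen_choiceMixin Gc.
HB.instance Definition _ := hasMul.Build Gc mulGc.
HB.instance Definition _ := hasOne.Build Gc oneGc.
HB.instance Definition _ := Topological.copy Gc
  (sup_topology (fun k : nat => Topological.on (initial_topology (d_ k.+1)))).

End ConvergentSeries.

(* P(a) is the germ at 0 of r |-> v(2 pi; r; a); it is identified with its
   power series. *)
Definition is_first_return_map (R : realType) (a : X R) (f : Gc R) : Prop :=
  \forall r \near (0 : R[i]^o), exists2 z : R[i]^o,
    first_return a r z & pseries_at (series_coef f) r @ \oo --> z.

Section Subgroups.
Variable G : baseGroupType.
Implicit Types K : set G.

Definition is_subgroup K : Prop :=
  [/\ K 1%g, forall g h, K g -> K h -> K (g * h)%g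
    & forall g, K g -> K (g^-1)%g].

Definition is_normal K : Prop :=
  forall g h, K h -> K (g * h * g^-1)%g.

Definition hom_kernel (H : baseUMagmaType) (f : G -> H) : set G :=
  [set g | f g = 1%g].

End Subgroups.

Section SubsetTopology.
Variables (R : realType) (T : topologicalType).
Implicit Types A : set T.
Local Notation I := (`[0 : R, 1 : R]%classic).

Definition path_in A (c : R -> T) : Prop :=
  {within I, continuous c} /\ (forall t, I t -> A (c t)).

Definition arcwise_connected A : Prop :=
  forall x y, A x -> A y -> exists c, [/\ path_in A c, c 0 = x & c 1 = y].

Definition contractible A : Prop :=
  exists2 p, A p & exists H : R * T -> T,
    [/\ {within I `*` A, continuous H},
        forall t x, I t -> A x -> A (H (t, x)),
        forall x, A x -> H (0, x) = x
      & forall x, A x -> H (1, x) = p].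

Definition simply_connected A : Prop :=
  arcwise_connected A /\
  forall c, path_in A c -> c 0 = c 1 -> exists H : R * R -> T,
    [/\ {within I `*` I, continuous H},
        forall s t, I s -> I t -> A (H (s, t)),
        forall s, I s -> H (s, 0) = c s /\ H (s, 1) = c 0
      & forall t, I t -> H (0, t) = c 0 /\ H (1, t) = c 0].

(* Every point of A has arbitrarily small relatively open neighbourhoods in A
   with property P. *)
Definition locally (P : set T -> Prop) A : Prop :=
  forall x U, A x -> open U -> U x ->
  exists V, [/\ open V, V x, A `&` V `<=` U & P (A `&` V)].

End SubsetTopology.

Arguments class_of {R} a.
Arguments center_set : clear implicits.
Arguments arcwise_connected R {T} A.
Arguments contractible R {T} A.
Arguments simply_connected R {T} A.

(* Main.v *)
Require Import Defs.
From mathcomp Require Import all_boot all_order all_algebra.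
From mathcomp Require Import complex.
From mathcomp Require Import all_classical all_reals all_analysis.
From mathcomp Require Import measurable_realfun.
From mathcomp Require Import ring lra zify.
Set Implicit Arguments.
Unset Strict Implicit.
Unset Printing Implicit Defensive.
Import Order.TTheory GRing.Theory Num.Theory.
Import numFieldNormedType.Exports.
Local Open Scope classical_set_scope.
Local Open Scope ring_scope.
Local Open Scope complex_scope.

(** Write the equation as v' = A(x, v), where A(x, z) is the sum of the
    a_i(x) z^(i+1), and let F_s be the germ at 0 of the map that carries v(s)
    to v(2 pi) along solutions. F_s(v(s)) does not depend on s, hence
      d/ds F_s = - A(s, z) d/dz F_s,   F_(2 pi)(z) = z.
    Solved coefficient by coefficient, this transport equation gives the
    coefficient of z^(n+1) in F_s as a combination with integer weights, over
    the finitely many words w of degree n, of the iterated integrals of w over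
    [s, 2 pi]. For s = 0 it is the coefficient of r^(n+1) in the first return
    map. So P(a) depends on the iterated integrals only, each coefficient
    through finitely many of them, which makes the map on classes well defined
    and continuous. That this formal solution is the true return map is
    [first_return_Phat]: the coefficients grow geometrically
    ([flow_at_bound]), and the truncation of F_s to degree N, evaluated along
    a solution, has a derivative that is geometrically small in N
    ([return_series]); solutions exist by Picard iteration
    ([picard_solution]).

    All identities between integrals are obtained in one way. A Lipschitz
    function is determined by its derivative almost everywhere and by one
    value ([prim_unique], from [deriv_compare]); integrals are Lipschitz and
    Lebesgue's differentiation theorem computes their derivatives
    ([prim_integral]). Changes of variables and integrations by parts thus
    become differentiations of both sides.

    Homomorphism. Iterated integrals of a concatenation are the sums over the
    ways to cut the word ([basic_int_star]); the integrals of a followed by its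
    reverse vanish by symmetry ([basic_int_star_rev]). Hence classes are
    exactly the families of values of all iterated integrals, and they form a
    group. The transport equation with final value z^m has the m-th power of F
    as its solution, since z^(i+1) d/dz is a derivation ([flow_at_mul]); with
    the cutting formula this turns concatenation into composition
    ([Phat_morph]).

    Surjectivity. For a convergent f, the segment from the identity to f,
    F_s(z) = z + (1 - s/2 pi)(f(z) - z), is prescribed, and the transport
    equation is read as an equation for A: a division of power series, which
    keeps geometric growth ([lift_coef_bound], [Phat_surjective]).

    Kernel. Replacing a_i by t^i a_i multiplies the integral of a word of
    degree n by t^n and conjugates the return map by a homothety. For t going
    from 1 to 0 this contracts the kernel to 1, and it contracts into
    themselves the intersections of the kernel with the basic neighbourhoods
    of 1, which bound finitely many iterated integrals. Left translations are
    homeomorphisms and carry these neighbourhoods to every point of the kernel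
    ([kernel_local]); a set that can be contracted within itself is arcwise
    and simply connected. The kernel is not trivial because v' = v^2 and the
    equation that the surjectivity argument attaches to its return map have
    different iterated integrals ([lift_riccati_neq]). *)

(** * Real-valued modulus of complex numbers *)

Section Cabs.
Variable R : realType.
Local Notation C := R[i].

(** The modulus in [R] rather than in the partially ordered field [R[i]],
    so that estimates are real inequalities. *)
Definition cabs (z : C) : R := Normc.normc z.

Lemma cabsE (z : C) : `|z| = (cabs z)%:C. Proof. by []. Qed.
Lemma cabs_le (z : C) (x : R) : (`|z| <= x%:C) = (cabs z <= x).
Proof. by rewrite cabsE lecR. Qed.
Lemma cabs_ge0 (z : C) : 0 <= cabs z.
Proof. by rewrite -ler0c -cabsE. Qed.
Lemma cabs0 : cabs 0 = 0. Proof. exact: Normc.normc0. Qed.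
Lemma cabs0_eq0 z : cabs z <= 0 -> z = 0.
Proof.
move=> h; apply: Normc.eq0_normc.
by apply/eqP; rewrite eq_le h cabs_ge0.
Qed.
Lemma cabs1 : cabs 1 = 1. Proof. exact: Normc.normc1. Qed.
Lemma cabsM x y : cabs (x * y) = cabs x * cabs y. Proof. exact: Normc.normcM. Qed.
Lemma cabsX x n : cabs (x ^+ n) = cabs x ^+ n.
Proof. by elim: n => [|n IH]; rewrite ?expr0 ?cabs1// !exprS cabsM IH. Qed.
Lemma cabsN x : cabs (- x) = cabs x. Proof. exact: normcN. Qed.
Lemma cabsD x y : cabs (x + y) <= cabs x + cabs y. Proof. exact: le_normcD. Qed.
Lemma cabsB x y : cabs (x - y) <= cabs x + cabs y.
Proof. by rewrite -(cabsN y) cabsD. Qed.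
Lemma cabs_distC x y : cabs (x - y) = cabs (y - x).
Proof. by rewrite -cabsN opprB. Qed.
Lemma cabs_distD z x y : cabs (x - y) <= cabs (x - z) + cabs (z - y).
Proof. by rewrite -[x - y](subrKA z); exact: cabsD. Qed.
Lemma cabs_real (x : R) : cabs x%:C = `|x|.
Proof. by rewrite /cabs /= expr0n /= addr0 sqrtr_sqr. Qed.
Lemma cabs_nat n : cabs n%:R = n%:R.
Proof. by rewrite -(rmorph_nat (real_complex R)) cabs_real ger0_norm. Qed.
Lemma cabs_sum (I : Type) (r : seq I) (P : pred I) (F : I -> C) :
  cabs (\sum_(i <- r | P i) F i) <= \sum_(i <- r | P i) cabs (F i).
Proof.
elim/big_rec2: _ => [|i y z _ h]; first by rewrite cabs0.
by apply: le_trans (cabsD _ _) _; rewrite lerD2l.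
Qed.
Lemma cabs_Re z : `|complex.Re z| <= cabs z.
Proof. by rewrite -lecR -cabsE normc_ge_Re. Qed.
Lemma cabs_Im z : `|complex.Im z| <= cabs z.
Proof.
have := cabs_Re (z * 'i); rewrite ReiNIm normrN cabsM.
by rewrite [cabs 'i](_ : _ = 1) ?mulr1// /cabs /= expr0n/= expr1n add0r sqrtr1.
Qed.
Lemma cabs_ReIm z : cabs z <= `|complex.Re z| + `|complex.Im z|.
Proof.
rewrite [z in cabs z]complexE; apply: le_trans (cabsD _ _) _.
rewrite cabsM !cabs_real lerD2l.
by rewrite [cabs 'i](_ : _ = 1) ?mul1r// /cabs /= expr0n/= expr1n add0r sqrtr1.
Qed.

Lemma cvg_cabsP (T : Type) (F : set_system T) (FF : Filter F) (f : T -> C) (L : C) :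
  (f : T -> C^o) @ F --> (L : C^o) <->
  (forall e : R, 0 < e -> \forall x \near F, cabs (f x - L) <= e).
Proof.
split=> [/cvgrPdist_le h e e0|h].
  have e0' : 0 < e%:C :> C by rewrite ltcR.
  apply: filterS (h _ e0') => x /=.
  by rewrite distrC cabs_le.
apply/cvgrPdist_le => -[e e'] /=; rewrite ltcE/= => /andP[/eqP -> e0].
by apply: filterS (h _ e0) => x; rewrite /= -/(e%:C) cabs_le cabs_distC.
Qed.

Lemma lim_cabs_le (T : Type) (F : set_system T) (FF : ProperFilter F)
  (f : T -> C) (L : C) (M : R) :
  (f : T -> C^o) @ F --> (L : C^o) ->
  (\forall x \near F, cabs (f x) <= M) -> cabs L <= M.
Proof.
move=> /(proj1 (cvg_cabsP _ f L)) h fM; apply/ler_addgt0Pr => e e0.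
have [x [h1 h2]] : exists x, cabs (f x - L) <= e /\ cabs (f x) <= M.
  by apply: (@filter_ex _ F); exact: filterI (h _ e0) fM.
rewrite -[L]subr0; apply: le_trans (cabs_distD (f x) _ _) _.
by rewrite subr0 addrC lerD// cabs_distC.
Qed.

End Cabs.

(** * Lipschitz functions and their derivatives almost everywhere *)

Section RealInduction.
Variable R : realType.

(** Continuous induction: the supremum of the points up to which [P] holds is
    the right end of the interval. *)
Lemma real_induction (a b : R) (P : R -> Prop) : P a ->
  (forall x, a <= x < b -> (forall y, a <= y <= x -> P y) ->
     exists2 d, 0 < d & forall y, x < y < x + d -> y <= b -> P y) ->
  (forall x, a < x <= b -> (forall y, a <= y < x -> P y) -> P x) ->
  forall x, a <= x <= b -> P x.
Proof.
move=> Pa right left x /andP[ax xb].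
have ab : a <= b by exact: le_trans xb.
pose S := [set x | a <= x <= b /\ forall y, a <= y <= x -> P y].
have Sa : S a.
  split; first by rewrite lexx.
  by move=> y /andP[h1 h2]; have -> : y = a by apply/eqP; rewrite eq_le h1 h2.
have hsS : has_sup S by split; [exists a|exists b => z [/andP[]]].
set s := sup S.
have as_ : a <= s by apply: ub_le_sup => //; exact: hsS.2.
have sb : s <= b by apply: ge_sup; [exists a|move=> z [/andP[]]].
have below y : a <= y < s -> P y.
  move=> /andP[ay ys].
  have [z [[_ Sz] yz]] := sup_gt (ex_intro _ a Sa) ys.
  by apply: Sz; rewrite ay ltW.
have Ps : P s.
  move: as_; rewrite le_eqVlt => /orP[/eqP <-//|as_].
  by apply: left => //; rewrite as_.
have Ps' y : a <= y <= s -> P y.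
  move=> /andP[ay]; rewrite le_eqVlt => /orP[/eqP ->//|ys].
  by apply: below; rewrite ay.
have [sb'|bs] := ltP s b; last by apply: Ps'; rewrite ax (le_trans xb).
have [|d d0 hd] := right s _ Ps'; first by rewrite as_.
pose s' := Num.min (s + d / 2) b.
have ss' : s < s' by rewrite lt_min sb' andbT ltrDl divr_gt0.
suff : S s' by move=> /(ub_le_sup hsS.2); rewrite leNgt ss'.
split; first by rewrite (le_trans as_ (ltW ss'))/= ge_min lexx orbT.
move=> y /andP[ay ys'].
have [ys|sy] := leP y s; first by apply: Ps'; rewrite ay.
apply: hd; last by apply: le_trans ys' _; rewrite ge_min lexx orbT.
rewrite sy/=; apply: le_lt_trans ys' _; rewrite gt_min ltrD2l; apply/orP; left.
by rewrite ltr_pdivrMr// mulr_natr mulr2n ltrDl.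
Qed.

End RealInduction.

Section Deriv.
Variable R : realType.
Local Notation C := R[i].
Local Notation mu := (@lebesgue_measure R).

(** Derivative of a complex function of a real variable, in the form in which
    it occurs in the definition of a solution. *)
Definition has_deriv (v : R -> C) (x : R) (L : C) : Prop :=
  ((v (x + h) - v x) / h%:C : C^o) @[h --> (0 : R)^'] --> (L : C^o).

Lemma has_derivP v x L : has_deriv v x L <->
  forall e : R, 0 < e -> exists2 d : R, 0 < d &
    forall h, `|h| < d -> cabs (v (x + h) - v x - L * h%:C) <= e * `|h|.
Proof.
split=> [/cvg_cabsP hd e e0|hd].
  have [d /= d0 H] := hd _ e0.
  exists d => // h hd'; have [->|h0] := eqVneq h 0.
    by rewrite addr0 subrr rmorph0 mulr0 subrr cabs0 normr0 mulr0.
  have {}H := H h; move: H; rewrite /ball_/= sub0r normrN => /(_ hd' h0).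
  move=> H; rewrite -cabs_real.
  rewrite (_ : _ - _ = ((v (x + h) - v x) / h%:C - L) * h%:C); last first.
    by rewrite mulrBl divfK// fmorph_eq0.
  by rewrite cabsM ler_wpM2r// cabs_ge0.
apply/cvg_cabsP => e e0; have [d d0 H] := hd _ e0.
exists d => // h; rewrite /= sub0r normrN => hd' h0.
have h0' : 0 < cabs h%:C by rewrite cabs_real normr_gt0.
rewrite -(ler_pM2r h0') -cabsM mulrBl divfK ?fmorph_eq0//.
by rewrite [cabs h%:C]cabs_real; exact: H.
Qed.

(** Mean value inequality with an exceptional null set. The null set is
    covered by an open set [U] of measure less than [e]; the inequality is
    propagated from the left with an additional term [kk * m x], where [m x]
    measures the part of [U] left of [x]. On [U] the Lipschitz bound is paid
    for by this term, and elsewhere the derivatives can be compared. *)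
Lemma deriv_compare (a b k : R) (g : R -> C) (phi : R -> R) : a <= b ->
  (forall x y, a <= x <= b -> a <= y <= b -> cabs (g x - g y) <= k * `|x - y|) ->
  (forall x y, a <= x -> x <= y -> y <= b -> phi x <= phi y) ->
  {ae mu, forall x, a < x < b -> exists L p,
    [/\ has_deriv g x L, has_deriv (fun t => (phi t)%:C) x p%:C & cabs L <= p]} ->
  cabs (g b - g a) <= phi b - phi a.
Proof.
move=> ab glip phi_nd [B [mB B0 HB]].
pose kk := `|k|.
have kk0 : 0 <= kk by exact: normr_ge0.
have glip' x y : a <= x <= b -> a <= y <= b -> cabs (g x - g y) <= kk * `|x - y|.
  by move=> h1 h2; apply: le_trans (glip _ _ h1 h2) _; rewrite ler_wpM2r// ler_norm.
suff H (e : R) : 0 < e -> cabs (g b - g a) <= phi b - phi a + e * (b - a) + kk * e.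
  apply/ler_addgt0Pr => e e0.
  have K0 : 0 < b - a + kk + 1 by rewrite ltr_wpDl// addr_ge0// subr_ge0.
  have e'0 : 0 < e / (b - a + kk + 1) by rewrite divr_gt0.
  apply: le_trans (H _ e'0) _; rewrite -addrA lerD2l mulrC -mulrDl.
  rewrite mulrA ler_pdivrMr//.
  by rewrite mulrC ler_pM2l// lerDl.
move=> e0.
have mD : measurable (B `|` [set a] : set R) by apply: measurableU.
have D0 : mu (B `|` [set a]) = 0%E.
  by rewrite measureU0 ?B0//; exact: lebesgue_measure_set1.
have Dfin : (mu (B `|` [set a]) < +oo)%E by rewrite D0.
have [U [oU DU muU]] := lebesgue_regularity_outer mD Dfin e0.
have mU : measurable U by exact: open_measurable.
have muU' : (mu U <= e%:E)%E.
  rewrite -(setDUK DU) (le_trans (measureU2 _ _ _))//; first exact: measurableD.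
  apply: (@le_trans _ _ (0%E + mu (U `\` (B `|` [set a])))%E).
    by apply: leeD => //; rewrite le_eqVlt; apply/orP; left; apply/eqP; exact: D0.
  by rewrite add0e ltW.
(* The part of the error budget that has been spent left of x. *)
pose m x := fine (mu (U `&` `[a, x])).
have mfin x : mu (U `&` `[a, x]) \is a fin_num.
  rewrite ge0_fin_numE//; apply: le_lt_trans (ltry e).
  apply: le_trans muU'; apply: le_measure; rewrite ?inE//.
  exact: measurableI.
have m_le x : m x <= e.
  rewrite -lee_fin fineK//.
  by apply: le_trans muU'; apply: le_measure; rewrite ?inE//; exact: measurableI.
have m_nd x y : x <= y -> m x <= m y.
  move=> xy; rewrite -lee_fin !fineK//.
  apply: le_measure; rewrite ?inE; [exact: measurableI|exact: measurableI|].
  by apply: setIS => z /=; rewrite !in_itv/= => /andP[-> /le_trans ->].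
have m_ge0 x : 0 <= m x by exact: fine_ge0.
have m_step x y : a <= x -> x <= y -> `]x, y] `<=` U -> y - x <= m y - m x.
  move=> ax xy xyU; rewrite lerBrDr -lee_fin EFinD !fineK// EFinB.
  rewrite (_ : (y%:E - x%:E)%E = mu `]x, y]); last first.
    rewrite lebesgue_measure_itv/= lte_fin -EFinB.
    by case: ltgtP xy => // -> _; rewrite subrr.
  rewrite -measureU//; [|exact: measurableI|]; last first.
    apply/seteqP; split => // z /= []; rewrite !in_itv/= => /andP[xz _] [_ /andP[_ zx]].
    by move: xz; rewrite ltNge zx.
  apply: le_measure; rewrite ?inE; [|exact: measurableI|].
    by apply: measurableU => //; exact: measurableI.
  move=> z /= [h|[Uz]].
    split; first exact: xyU.
    move: h; rewrite /= !in_itv/= => /andP[h1 ->].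
    by rewrite (le_trans ax (ltW h1)).
  by rewrite !in_itv/= => /andP[-> h2]; rewrite (le_trans h2).
pose P x := cabs (g x - g a) <= phi x - phi a + e * (x - a) + kk * m x.
suff : P b.
  move=> h; apply: le_trans h _; rewrite lerD2l.
  by rewrite ler_wpM2l.
apply: (@real_induction _ a b P) => //; rewrite ?lexx ?ab//.
- by rewrite /P !subrr cabs0 mulr0 addr0 add0r mulr_ge0.
- move=> x /andP[ax xb] IH.
  have Px : P x by apply: IH; rewrite ax lexx.
  have [Ux|nUx] := pselect (U x).
    have [d /= d0 dU] : nbhs x U by exact: open_nbhs_nbhs.
    exists d => // y /andP[xy yd] yb.
    have st : y - x <= m y - m x.
      apply: m_step (ltW xy) _ => // z /=; rewrite in_itv/= => /andP[xz zy].
      apply: dU; rewrite /ball_/= distrC gtr0_norm ?subr_gt0// ltrBlDl.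
      exact: le_lt_trans yd.
    rewrite /P; apply: le_trans (cabs_distD (g x) _ _) _.
    have h1 : cabs (g y - g x) <= kk * (m y - m x).
      apply: le_trans (glip' _ _ _ _) _; rewrite ?ax ?yb ?(ltW xb)//.
        by rewrite (le_trans ax)// ltW.
      by rewrite gtr0_norm ?subr_gt0// ler_wpM2l.
    have h2 : phi x <= phi y by apply: phi_nd => //; exact: ltW.
    have h3 : e * (x - a) <= e * (y - a) by rewrite ler_pM2l// lerD2r ltW.
    move: Px; rewrite /P; lra.
  (* The left end a, where nothing is known about derivatives, lies in U. *)
  have xna : x != a by apply: contra_notN nUx => /eqP ->; apply: DU; right.
  have ax' : a < x by rewrite lt_neqAle eq_sym xna.
  have nBx : ~ B x by move=> Bx; apply: nUx; apply: DU; left.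
  have [L [p [/has_derivP gL /has_derivP pp Lp]]] :
      exists L p, [/\ has_deriv g x L, has_deriv (fun t => (phi t)%:C) x p%:C & cabs L <= p].
    by apply: contra_notP nBx => h; apply: HB => /= h'; apply: h; apply: h'; rewrite ax'.
  have e20 : 0 < e / 2 by rewrite divr_gt0.
  have [d1 d10 H1] := gL _ e20; have [d2 d20 H2] := pp _ e20.
  exists (Num.min d1 d2); first by rewrite lt_min d10.
  move=> y /andP[xy]; rewrite -ltrBlDl lt_min => /andP[yd1 yd2] yb.
  have yx0 : 0 < y - x by rewrite subr_gt0.
  have := H1 (y - x); have := H2 (y - x); rewrite gtr0_norm// subrKC.
  move=> /(_ yd2) h2 /(_ yd1) h1.
  have {}h2 : `|phi y - phi x - p * (y - x)| <= e / 2 * (y - x).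
    by apply: le_trans h2; rewrite -cabs_real !(rmorphB, rmorphM).
  have h3 : cabs (g y - g x) <= e / 2 * (y - x) + p * (y - x).
    rewrite -[g y - g x](subrK (L * (y - x)%:C)).
    apply: le_trans (cabsD _ _) _; apply: lerD => //.
    by rewrite cabsM cabs_real gtr0_norm// ler_pM2r.
  rewrite /P; apply: le_trans (cabs_distD (g x) _ _) _.
  have h4 : kk * m x <= kk * m y by rewrite ler_wpM2l// m_nd// ltW.
  move: Px; rewrite /P; move: h2; rewrite ler_norml => /andP[h2 _]; lra.
- move=> x /andP[ax xb] IH; rewrite /P.
  apply/ler_addgt0Pr => d d0.
  pose y := Num.max a (x - d / (kk + 1)).
  have k10 : 0 < kk + 1 by rewrite ltr_wpDl.
  have yx : y < x by rewrite gt_max ax/= ltrBlDr ltrDl divr_gt0.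
  have ay : a <= y by rewrite le_max lexx.
  have := IH y; rewrite ay yx => /(_ isT); rewrite /P => h.
  apply: le_trans (cabs_distD (g y) _ _) _.
  have h1 : cabs (g x - g y) <= d.
    apply: le_trans (glip' _ _ _ _) _; rewrite ?xb ?(ltW ax) ?ay ?(le_trans (ltW yx))//.
    rewrite gtr0_norm ?subr_gt0//.
    have h2 : x - y <= d / (kk + 1) by rewrite lerBlDr addrC -lerBlDr le_max lexx orbT.
    apply: le_trans (ler_wpM2l kk0 h2) _.
    by rewrite mulrA ler_pdivrMr// mulrC ler_pM2l// lerDl.
  have h2 : phi y <= phi x by apply: phi_nd => //; exact: ltW.
  have h3 : e * (y - a) <= e * (x - a) by rewrite ler_pM2l// lerD2r ltW.
  have h4 : kk * m y <= kk * m x by rewrite ler_wpM2l// m_nd// ltW.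
  lra.
Qed.

End Deriv.

(** * Primitives of essentially bounded functions *)

Section RealPrimitive.
Variable R : realType.
Local Notation mu := (@lebesgue_measure R).
Local Notation p2 := (2 * pi : R).
Local Notation D := (`[0, 2 * pi : R]%classic).

Lemma p2_gt0 : 0 < p2. Proof. by rewrite mulr_gt0// pi_gt0. Qed.
Lemma p2_ge0 : 0 <= p2. Proof. exact: ltW p2_gt0. Qed.

Variables (f : R -> R) (M : R).
Hypothesis mf : measurable_fun D f.
Hypothesis fM : {ae mu, forall t, D t -> `|f t| <= M}.

Lemma ess_bound_ge0 : 0 <= M.
Proof.
rewrite leNgt; apply/negP => M0.
have [B [mB B0 HB]] := fM.
suff : (p2%:E <= mu B)%E by rewrite B0 lee_fin leNgt p2_gt0.
have -> : p2%:E = mu D.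
  by rewrite lebesgue_measure_itv/= lte_fin p2_gt0 oppr0 adde0.
apply: le_measure; rewrite ?inE// => t Dt; apply: HB => /= /(_ Dt).
by apply/negP; rewrite -ltNge; exact: lt_le_trans M0 _.
Qed.

Lemma ess_bounded_integral (A : set R) : measurable A -> A `<=` D ->
  (\int[mu]_(x in A) `|(f x)%:E| <= M%:E * mu A)%E.
Proof.
move=> mA AD; apply: integral_le_bound => //.
- by apply/measurable_EFinP; exact: measurable_funS mf.
- by rewrite lee_fin ess_bound_ge0.
- have FF := ae_filter_ringOfSetsType mu.
  by apply: filterS fM => x h Ax; rewrite /= lee_fin; apply: h; exact: AD.
Qed.

Lemma ess_bounded_integrable (A : set R) : measurable A -> A `<=` D ->
  mu.-integrable A (EFin \o f).
Proof.
move=> mA AD; apply/integrableP; split.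
  by apply/measurable_EFinP; exact: measurable_funS mf.
apply: le_lt_trans (ess_bounded_integral mA AD) _.
apply: (@le_lt_trans _ _ (M%:E * mu D)%E).
  apply: lee_wpmul2l; first by rewrite lee_fin ess_bound_ge0.
  by apply: le_measure; rewrite ?inE.
by rewrite lebesgue_measure_itv/= lte_fin p2_gt0 oppr0 adde0 -EFinM ltry.
Qed.

Let F s := (\int[mu]_(t in `[s, p2]) f t)%R.

Lemma Rprimitive_lip x y : 0 <= x <= p2 -> 0 <= y <= p2 ->
  `|F x - F y| <= M * `|x - y|.
Proof.
wlog xy : x y / x <= y.
  move=> H hx hy; have [|/ltW] := leP x y; first by move=> h; exact: H.
  by move=> h; rewrite distrC [in leRHS]distrC; exact: H.
move=> /andP[x0 xp] /andP[y0 yp].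
have sub : `[x, p2] `<=` D by apply: subset_itvr; rewrite bnd_simp.
have ix := ess_bounded_integrable (@measurable_itv R `[x, p2]) sub.
have -> : F x - F y = (\int[mu]_(t in `[x, y]) f t)%R.
  have ixy : mu.-integrable `[x, y] (EFin \o f).
    by apply: integrableS ix => //; apply: subset_itvl; rewrite bnd_simp.
  have h1 : (BLeft x <= BRight y)%O by rewrite bnd_simp.
  have h2 : (BRight y <= BRight p2)%O by rewrite bnd_simp.
  have := Rintegral_itvB ix h1 h2; rewrite Rintegral_itv_obnd_cbnd => [|].
    by rewrite -/(F x) -/(F y) => <-; rewrite opprB addrC subrK.
  by apply: integrableS ix => //; apply: subset_itvr; rewrite bnd_simp.
have sub2 : `[x, y] `<=` D.
  by move=> z /=; rewrite !in_itv/= => /andP[h1 h2]; rewrite (le_trans x0)// (le_trans h2).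
have ixy := ess_bounded_integrable (@measurable_itv R `[x, y]) sub2.
apply: le_trans (le_normr_Rintegral _ ixy) _ => //.
have e : mu `[x, y] = (`|x - y|)%:E.
  rewrite lebesgue_measure_itv/= lte_fin distrC ger0_norm ?subr_ge0//.
  by case: ltgtP xy => // -> _; rewrite subrr.
have := ess_bounded_integral (@measurable_itv R `[x, y]) sub2.
rewrite e => h; rewrite -lee_fin fineK//.
rewrite ge0_fin_numE; last by apply: integral_ge0 => ? _; rewrite lee_fin.
by apply: le_lt_trans h _; rewrite -EFinM ltry.
Qed.

(** Lebesgue differentiation of the integral over [[s, 2 pi]] with respect to
    its lower end. The primitive from [0] of [f], cut off outside the interval,
    is differentiated, and the two differ by a constant and a sign. *)
Lemma Rprimitive_deriv : {ae mu, forall x, 0 < x < p2 ->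
  ((F (x + h) - F x) / h) @[h --> (0 : R)^'] --> - f x}.
Proof.
have intD : mu.-integrable D (EFin \o f) by exact: ess_bounded_integrable.
have intT : mu.-integrable [set: R] (EFin \o (f \_ D)).
  by move: intD; rewrite integrable_mkcond// restrict_EFin.
have loc := integrable_locally (@measurable_itv R `[0, p2]) intD.
have int y : mu.-integrable [set` Interval (BLeft 0) (BRight y)] (EFin \o (f \_ D)).
  by apply: integrableS intT.
have FF := ae_filter_ringOfSetsType mu.
have H := FTC1 int loc; apply: filterS H => x H /andP[x0 xp].
have [] := H; first by rewrite lte_fin.
set G := (G in derivable G _ _) => dG eG.
have cG : ((G (x + h) - G x) / h) @[h --> (0 : R)^'] --> f x.
  have : derive1 G x = f x by rewrite [LHS]eG patchE mem_set//= in_itv/= !ltW.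
  move=> <-; rewrite derive1E; move: dG => /cvg_ex[/= l cl].
  have -> : 'D_1 G x = l by apply/cvg_lim.
  move: cl; apply: cvg_trans; apply: near_eq_cvg; near=> h.
  have e : h *: (1 : R) + x = x + h by rewrite addrC; congr (_ + _); exact: mulr1.
  by rewrite /= e [RHS]mulrC.
have cN : (- ((G (x + h) - G x) / h)) @[h --> (0 : R)^'] --> - f x by exact: cvgN.
move: cN; apply: cvg_trans; apply: near_eq_cvg; near=> h.
rewrite /= -mulNr; congr (_ / _).
have FG y : 0 <= y <= p2 -> F y = (\int[mu]_(t in D) f t)%R - G y.
  move=> /andP[y0 yp].
  have -> : G y = (\int[mu]_(t in `[0, y]) f t)%R.
    apply: eq_Rintegral => t; rewrite inE/= in_itv/= => /andP[t0 ty].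
    by rewrite patchE mem_set//= in_itv/= t0 (le_trans ty).
  rewrite Rintegral_itvB// ?bnd_simp//; rewrite Rintegral_itv_obnd_cbnd//.
  apply: integrableS intD => //; apply: subset_itvr.
  by rewrite bnd_simp.
have hx : 0 <= x <= p2 by rewrite !ltW.
have hxh : 0 <= x + h <= p2.
  near: h; apply: cvg_within.
  exists (Num.min x (p2 - x)); first by rewrite /= lt_min x0 subr_gt0.
  move=> h /=; rewrite sub0r normrN lt_min => /andP[h1 h2].
  move: (ltW h1) (ltW h2); rewrite !ler_norml => /andP[h3 h4] /andP[h5 h6].
  by apply/andP; split; lra.
by rewrite (FG _ hx) (FG _ hxh); ring.
Unshelve. all: by end_near. Qed.

End RealPrimitive.

(** * Calculus of Lipschitz primitives *)

Section ComplexCalculus.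
Variable R : realType.
Local Notation C := R[i].
Local Notation mu := (@lebesgue_measure R).
Local Notation p2 := (2 * pi : R).
Local Notation D := (`[0, 2 * pi : R]%classic).

Implicit Types (F G f g : R -> C) (x a b c d : R).

Lemma ae_imp (P Q : R -> Prop) : (forall x, P x -> Q x) ->
  {ae mu, forall x, P x} -> {ae mu, forall x, Q x}.
Proof. by have FF := ae_filter_ringOfSetsType mu; move=> PQ; apply: filterS. Qed.

Lemma ae_and (P Q : R -> Prop) :
  {ae mu, forall x, P x} -> {ae mu, forall x, Q x} ->
  {ae mu, forall x, P x /\ Q x}.
Proof. by have FF := ae_filter_ringOfSetsType mu; apply: filterI. Qed.

Lemma ae_true (P : R -> Prop) : (forall x, P x) -> {ae mu, forall x, P x}.
Proof. by have FF := ae_filter_ringOfSetsType mu; apply: nearW. Qed.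

Lemma ae_all (P : nat -> R -> Prop) :
  (forall n, {ae mu, forall x, P n x}) -> {ae mu, forall x n, P n x}.
Proof.
move=> h; have /choice[B HB] : forall n, exists B : set R,
    [/\ measurable B, mu B = 0%E & ~` (fun x => P n x) `<=` B].
  by move=> n; have [B] := h n; exists B.
exists (\bigcup_n B n); split.
- by apply: bigcup_measurable => n _; have [] := HB n.
- apply/eqP; rewrite eq_le measure_ge0 andbT.
  apply: le_trans (measure_sigma_subadditive _ _ _ _) _; last 2 first.
  + exact: subset_refl.
  + by rewrite eseries0// => n _ _; have [] := HB n.
  + by move=> n; have [] := HB n.
  + by apply: bigcup_measurable => n _; have [] := HB n.
- move=> x /= /existsNP[n nP]; exists n => //.
  by have [_ _] := HB n; apply.
Qed.

Lemma has_deriv_eq (e : R) (F G : R -> C) x L : 0 < e ->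
  (forall y, `|y - x| < e -> F y = G y) -> has_deriv F x L -> has_deriv G x L.
Proof.
move=> e0 FG /has_derivP h; apply/has_derivP => d d0.
have [c c0 H] := h _ d0; exists (Num.min c e); first by rewrite lt_min c0.
move=> t; rewrite lt_min => /andP[tc te].
rewrite -!FG ?subrr ?normr0//; first exact: H.
by rewrite addrC addKr.
Qed.

Lemma has_deriv_cst (c : C) x : has_deriv (fun=> c) x 0.
Proof.
apply/has_derivP => e e0; exists 1 => // h _.
by rewrite subrr mul0r subr0 cabs0 mulr_ge0// ltW.
Qed.

Lemma has_derivD F G x L M : has_deriv F x L -> has_deriv G x M ->
  has_deriv (fun t => F t + G t) x (L + M).
Proof.
move=> /has_derivP hF /has_derivP hG; apply/has_derivP => e e0.
have e20 : 0 < e / 2 by rewrite divr_gt0.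
have [c c0 HF] := hF _ e20; have [d d0 HG] := hG _ e20.
exists (Num.min c d); first by rewrite lt_min c0.
move=> t; rewrite lt_min => /andP[/HF h1 /HG h2].
have -> : F (x + t) + G (x + t) - (F x + G x) - (L + M) * t%:C =
  (F (x + t) - F x - L * t%:C) + (G (x + t) - G x - M * t%:C) by ring.
apply: le_trans (cabsD _ _) _; lra.
Qed.

Lemma has_deriv_cvg F x L : has_deriv F x L ->
  (F (x + h) : C^o) @[h --> (0 : R)^'] --> (F x : C^o).
Proof.
move=> /has_derivP hF; apply/cvg_cabsP => e e0.
have [c c0 H] := hF _ ltr01.
have K0 : 0 < 1 + cabs L by rewrite ltr_pwDl// cabs_ge0.
exists (Num.min c (e / (1 + cabs L))); first by rewrite /= lt_min c0 divr_gt0.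
move=> t /=; rewrite sub0r normrN lt_min => /andP[/H h1 h2] _.
rewrite -[F (x + t) - F x](subrK (L * t%:C)).
apply: le_trans (cabsD _ _) _; rewrite cabsM cabs_real.
move: h2; rewrite ltr_pdivlMr// mulrDr mulr1 => h2.
rewrite mul1r in h1; rewrite [cabs L * _]mulrC; lra.
Qed.

Lemma has_derivM F G x L M : has_deriv F x L -> has_deriv G x M ->
  has_deriv (fun t => F t * G t) x (L * G x + F x * M).
Proof.
move=> hF hG; have cF := has_deriv_cvg hF.
have h1 : (fun h : R => (F (x + h) - F x) / h%:C * G x + F (x + h) * ((G (x + h) - G x) / h%:C) : C^o)
    @ (0 : R)^' --> (L * G x + F x * M : C^o).
  apply: cvgD.
    by apply: cvgM; [exact: hF|exact: cvg_cst].
  by apply: cvgM; [exact: cF|exact: hG].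
rewrite /has_deriv; suff -> : (fun h : R => (F (x + h) * G (x + h) - F x * G x) / h%:C) =
   (fun h : R => (F (x + h) - F x) / h%:C * G x + F (x + h) * ((G (x + h) - G x) / h%:C)).
  exact: h1.
by apply/funext => h; ring.
Qed.

Lemma has_deriv_affine F (c d x : R) L : has_deriv F (c * x + d) L ->
  has_deriv (fun t => F (c * t + d)) x (c%:C * L).
Proof.
have [->|c0] := eqVneq c 0.
  move=> _; rewrite rmorph0 mul0r; under eq_fun do rewrite mul0r add0r.
  exact: has_deriv_cst.
move=> /has_derivP hF; apply/has_derivP => e e0.
have nc0 : 0 < `|c| by rewrite normr_gt0.
have [r r0 H] := hF (e / `|c|) (divr_gt0 e0 nc0).
exists (r / `|c|); first exact: divr_gt0.
move=> h; rewrite ltr_pdivlMr// mulrC -normrM => /H.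
have -> : c * (x + h) + d = c * x + d + c * h by ring.
rewrite normrM mulrA divfK ?gt_eqF// => h1.
have -> // : c%:C * L * h%:C = L * (c * h)%:C by rewrite rmorphM/=; ring.
Qed.

Lemma has_deriv_linear (c : C) x : has_deriv (fun t => c * t%:C) x c.
Proof.
apply/has_derivP => e e0; exists 1 => // h _.
have -> : c * (x + h)%:C - c * x%:C - c * h%:C = 0 by rewrite rmorphD/=; ring.
by rewrite cabs0 mulr_ge0// ltW.
Qed.

Definition lipschitz_itv (a b : R) (F : R -> C) := exists k : R, forall x y,
  a <= x <= b -> a <= y <= b -> cabs (F x - F y) <= k * `|x - y|.

(** Lipschitz primitives: for bounded [f] this is the property of being an
    indefinite integral of [f], in a form that is stable under products and
    affine changes of variable without any computation with integrals. *)
Definition is_primitive (a b : R) (F f : R -> C) : Prop := lipschitz_itv a b F /\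
  {ae mu, forall x, a < x < b -> has_deriv F x (f x)}.

Lemma lipschitz_bounded a b F : lipschitz_itv a b F ->
  exists2 M, 0 <= M & forall x, a <= x <= b -> cabs (F x) <= M.
Proof.
move=> [k H]; have [ab|ba] := leP a b; last first.
  by exists 0 => // x /andP[h1 h2]; move: (le_trans h1 h2); rewrite leNgt ba.
exists (cabs (F a) + `|k| * (b - a)).
  by rewrite addr_ge0 ?cabs_ge0// mulr_ge0// subr_ge0.
move=> x /andP[ax xb]; have := H x a; rewrite ax xb lexx ab => /(_ isT isT) h.
rewrite -[F x](subrK (F a)); apply: le_trans (cabsD _ _) _.
rewrite addrC lerD2l; apply: le_trans h _; rewrite ger0_norm ?subr_ge0//.
apply: le_trans (_ : `|k| * (x - a) <= _); first by rewrite ler_wpM2r ?ler_norm// subr_ge0.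
by rewrite ler_wpM2l// lerD2r.
Qed.

Lemma prim_restrict a b c d F f : a <= c -> d <= b -> is_primitive a b F f -> is_primitive c d F f.
Proof.
move=> ac db [[k H] hd]; split.
  exists k => x y /andP[h1 h2] /andP[h3 h4]; apply: H.
    by rewrite (le_trans ac h1) (le_trans h2 db).
  by rewrite (le_trans ac h3) (le_trans h4 db).
apply: ae_imp hd => x h /andP[h1 h2]; apply: h.
by rewrite (le_lt_trans ac h1) (lt_le_trans h2 db).
Qed.

Lemma prim_cst a b (c : C) : is_primitive a b (fun=> c) (fun=> 0).
Proof.
split; last by apply: ae_true => x _; exact: has_deriv_cst.
by exists 0 => x y _ _; rewrite subrr cabs0 mul0r.
Qed.

Lemma prim_linear a b (c : C) : is_primitive a b (fun t => c * t%:C) (fun=> c).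
Proof.
split; last by apply: ae_true => x _; exact: has_deriv_linear.
by exists (cabs c) => x y _ _; rewrite -mulrBr cabsM -rmorphB cabs_real.
Qed.

Lemma primD a b F G f g : is_primitive a b F f -> is_primitive a b G g ->
  is_primitive a b (fun t => F t + G t) (fun t => f t + g t).
Proof.
move=> [[k Hk] hF] [[l Hl] hG]; split.
  exists (k + l) => x y hx hy; rewrite opprD addrACA mulrDl.
  by apply: le_trans (cabsD _ _) _; apply: lerD; [exact: Hk|exact: Hl].
by apply: ae_imp (ae_and hF hG) => x [h1 h2] hx; apply: has_derivD; [exact: h1|exact: h2].
Qed.

Lemma primM a b F G f g : is_primitive a b F f -> is_primitive a b G g ->
  is_primitive a b (fun t => F t * G t) (fun t => f t * G t + F t * g t).
Proof.
move=> [lF hF] [lG hG]; split; last first.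
  by apply: ae_imp (ae_and hF hG) => x [h1 h2] hx; apply: has_derivM; [exact: h1|exact: h2].
have [M M0 HM] := lipschitz_bounded lF; have [N N0 HN] := lipschitz_bounded lG.
move: lF lG => [k Hk] [l Hl].
exists (`|k| * N + M * `|l|) => x y hx hy.
have -> : F x * G x - F y * G y = (F x - F y) * G x + F y * (G x - G y) by ring.
apply: le_trans (cabsD _ _) _; rewrite !cabsM mulrDl; apply: lerD.
  rewrite mulrAC; apply: ler_pM; rewrite ?cabs_ge0 ?HN//.
  by apply: le_trans (Hk _ _ hx hy) _; rewrite ler_wpM2r ?ler_norm.
rewrite -mulrA; apply: ler_pM; rewrite ?cabs_ge0 ?HM//.
by apply: le_trans (Hl _ _ hx hy) _; rewrite ler_wpM2r ?ler_norm.
Qed.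

Lemma prim_ext a b F G f g : (forall x, a <= x <= b -> F x = G x) ->
  {ae mu, forall x, a < x < b -> f x = g x} -> is_primitive a b F f -> is_primitive a b G g.
Proof.
move=> FG fg [[k Hk] hF]; split.
  by exists k => x y hx hy; rewrite -!FG//; exact: Hk.
apply: ae_imp (ae_and fg hF) => x [h1 h2] hx; rewrite -h1//.
have /andP[ax xb] := hx.
apply: (@has_deriv_eq (Num.min (x - a) (b - x)) _ _ _ _ _ _ (h2 hx)).
  by rewrite lt_min !subr_gt0.
move=> y; rewrite lt_min => /andP[/ltW + /ltW]; rewrite !ler_norml.
move=> /andP[h3 h4] /andP[h5 h6]; apply: FG; apply/andP; split; lra.
Qed.

Lemma primZ a b (c : C) F f : is_primitive a b F f ->
  is_primitive a b (fun t => c * F t) (fun t => c * f t).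
Proof.
move=> hF; apply: prim_ext (primM (prim_cst a b c) hF) => //.
by apply: ae_true => x _; rewrite mul0r add0r.
Qed.

Lemma primN a b F f : is_primitive a b F f -> is_primitive a b (fun t => - F t) (fun t => - f t).
Proof.
move=> hF; apply: prim_ext (primZ (-1) hF) => [x _|]; first by rewrite mulN1r.
by apply: ae_true => x _; rewrite mulN1r.
Qed.

Lemma primB a b F G f g : is_primitive a b F f -> is_primitive a b G g ->
  is_primitive a b (fun t => F t - G t) (fun t => f t - g t).
Proof. by move=> hF hG; exact (primD hF (primN hG)). Qed.

Lemma prim_sum a b (I : eqType) (r : seq I) (F f : I -> R -> C) :
  (forall i, i \in r -> is_primitive a b (F i) (f i)) ->
  is_primitive a b (fun t => \sum_(i <- r) F i t) (fun t => \sum_(i <- r) f i t).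
Proof.
elim: r => [|i r IH] H.
  apply: prim_ext (prim_cst a b 0) => [x _|]; first by rewrite big_nil.
  by apply: ae_true => x _; rewrite big_nil.
have H1 := H i (mem_head _ _).
have H2 : is_primitive a b (fun t => \sum_(i <- r) F i t) (fun t => \sum_(i <- r) f i t).
  by apply: IH => j jr; apply: H; rewrite inE jr orbT.
apply: prim_ext (primD H1 H2) => [x _|]; first by rewrite big_cons.
by apply: ae_true => x _; rewrite big_cons.
Qed.

Lemma prim_sum_ord a b n (F f : 'I_n -> R -> C) :
  (forall i, is_primitive a b (F i) (f i)) ->
  is_primitive a b (fun t => \sum_(i < n) F i t) (fun t => \sum_(i < n) f i t).
Proof.
move=> H; have := @prim_sum a b _ (index_enum 'I_n) F f; apply => i _; exact: H.
Qed.

Lemma primX a b n F f : is_primitive a b F f ->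
  is_primitive a b (fun t => F t ^+ n.+1) (fun t => n.+1%:R * F t ^+ n * f t).
Proof.
move=> hF; elim: n => [|n IH].
  by apply: prim_ext hF => //; apply: ae_true => x _; rewrite expr0 !mul1r.
apply: prim_ext (primM IH hF) => [x _|]; first by rewrite -exprSr.
apply: ae_true => x _; rewrite [n.+2%:R]mulrSr !exprS; ring.
Qed.

(** The mean value inequality for primitives; [phi] is a majorant whose
    derivative bounds that of [F]. *)
Lemma prim_compare a b F f (phi psi : R -> R) : a <= b -> is_primitive a b F f ->
  (forall x y, a <= x -> x <= y -> y <= b -> phi x <= phi y) ->
  (forall x, a < x < b -> has_deriv (fun t => (phi t)%:C) x (psi x)%:C) ->
  {ae mu, forall x, a < x < b -> cabs (f x) <= psi x} ->
  cabs (F b - F a) <= phi b - phi a.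
Proof.
move=> ab [[k Hk] hF] nd hphi bnd; apply: (deriv_compare ab Hk nd).
apply: ae_imp (ae_and hF bnd) => x [h1 h2] hx; exists (f x), (psi x).
by split; [exact: h1|exact: hphi|exact: h2].
Qed.

Lemma prim_bound a b F f (M : R) : a <= b -> is_primitive a b F f -> 0 <= M ->
  {ae mu, forall x, a < x < b -> cabs (f x) <= M} ->
  cabs (F b - F a) <= M * (b - a).
Proof.
move=> ab hF M0 bnd; rewrite mulrBr.
apply: (@prim_compare a b F f (fun t => M * t) (fun=> M)) => //.
  by move=> x y _ xy _; rewrite ler_wpM2l.
move=> x _; have := @has_deriv_linear M%:C x.
by under eq_fun do rewrite -rmorphM.
Qed.

(** The principle behind all identities between iterated integrals. *)
Lemma prim_unique a b F G f g : is_primitive a b F f -> is_primitive a b G g ->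
  {ae mu, forall x, a < x < b -> f x = g x} -> F b = G b ->
  forall x, a <= x <= b -> F x = G x.
Proof.
move=> hF hG fg FGb x /andP[ax xb].
have h := prim_restrict ax (lexx b) (primB hF hG).
have : cabs ((F b - G b) - (F x - G x)) <= 0 * (b - x).
  apply: (@prim_bound _ _ (fun t => F t - G t) _ 0 xb h) => //.
  apply: ae_imp fg => y h' /andP[h1 h2]; rewrite h' ?subrr ?cabs0//.
  by rewrite (le_lt_trans ax h1).
by rewrite mul0r FGb subrr sub0r => /cabs0_eq0/eqP; rewrite oppr_eq0 subr_eq0 => /eqP.
Qed.

Lemma ae_double (d : R) (P : R -> Prop) :
  {ae mu, forall t, P t} -> {ae mu, forall t, P (2 * t + d)}.
Proof.
move=> h; have h1 := ae_refl 0 (ae_refl d h).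
apply: ae_imp (ae_dbl h1) => t.
by rewrite (_ : -1 * _ + d = 2 * t + d)//; ring.
Qed.

Lemma prim_double a b d F f : is_primitive (2 * a + d) (2 * b + d) F f ->
  is_primitive a b (fun t => F (2 * t + d)) (fun t => 2 * f (2 * t + d)).
Proof.
move=> [[k Hk] hF]; split.
  exists (k * 2) => x y /andP[h1 h2] /andP[h3 h4].
  apply: le_trans (Hk _ _ _ _) _; try by apply/andP; split; lra.
  have -> : 2 * x + d - (2 * y + d) = 2 * (x - y) by ring.
  by rewrite normrM ger0_norm// mulrA.
apply: ae_imp (ae_double d hF) => x h /andP[h1 h2].
have -> : 2 * f (2 * x + d) = 2%:C * f (2 * x + d) by rewrite rmorph_nat.
by apply: has_deriv_affine; apply: h; apply/andP; split; lra.
Qed.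

Lemma prim_reflect a b F f c : is_primitive (c - b) (c - a) F f ->
  is_primitive a b (fun t => F (c - t)) (fun t => - f (c - t)).
Proof.
move=> [[k Hk] hF]; split.
  exists k => x y /andP[h1 h2] /andP[h3 h4].
  apply: le_trans (Hk _ _ _ _) _; try by apply/andP; split; lra.
  have -> : c - x - (c - y) = y - x by ring.
  by rewrite distrC.
have e t : c - t = -1 * t + c by ring.
apply: ae_imp (ae_refl c hF) => x h /andP[h1 h2].
under eq_fun do rewrite e.
have -> : - f (c - x) = (-1)%:C * f (-1 * x + c) by rewrite -e rmorphN1 mulN1r.
by apply: has_deriv_affine; apply: h; apply/andP; split; lra.
Qed.

Definition cmeas (A : set R) (f : R -> C) : Prop :=
  measurable_fun A (fun t => complex.Re (f t)) /\
  measurable_fun A (fun t => complex.Im (f t)).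

Lemma cmeas_cst A (c : C) : cmeas A (fun=> c).
Proof. by split; exact: measurable_cst. Qed.

Lemma cmeasD A f g : cmeas A f -> cmeas A g -> cmeas A (fun t => f t + g t).
Proof.
move=> [f1 f2] [g1 g2]; split.
  rewrite (_ : (fun t => _) = (fun t => complex.Re (f t) + complex.Re (g t))).
    exact: measurable_funD.
  by apply/funext => t; case: (f t) (g t) => ? ? [].
rewrite (_ : (fun t => _) = (fun t => complex.Im (f t) + complex.Im (g t))).
  exact: measurable_funD.
by apply/funext => t; case: (f t) (g t) => ? ? [].
Qed.

Lemma cmeasM A f g : cmeas A f -> cmeas A g -> cmeas A (fun t => f t * g t).
Proof.
move=> [f1 f2] [g1 g2]; split.
  rewrite (_ : (fun t => _) = (fun t => complex.Re (f t) * complex.Re (g t) -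
     complex.Im (f t) * complex.Im (g t))).
    by apply: measurable_funB; apply: measurable_funM.
  by apply/funext => t; case: (f t) (g t) => ? ? [].
rewrite (_ : (fun t => _) = (fun t => complex.Re (f t) * complex.Im (g t) +
     complex.Im (f t) * complex.Re (g t))).
  by apply: measurable_funD; apply: measurable_funM.
by apply/funext => t; case: (f t) (g t) => ? ? [].
Qed.

Lemma cmeasX A f n : cmeas A f -> cmeas A (fun t => f t ^+ n).
Proof.
move=> hf; elim: n => [|n IH]; first by under eq_fun do rewrite expr0; exact: cmeas_cst.
by under eq_fun do rewrite exprS; exact: cmeasM.
Qed.

Lemma cmeas_sum A (I : Type) (r : seq I) (f : I -> R -> C) :
  (forall i, cmeas A (f i)) -> cmeas A (fun t => \sum_(i <- r) f i t).
Proof.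
move=> H; elim: r => [|i r IH].
  by under eq_fun do rewrite big_nil; exact: cmeas_cst.
by under eq_fun do rewrite big_cons; exact: cmeasD.
Qed.

Lemma cmeas_lim A (u : nat -> R -> C) (f : R -> C) :
  (forall n, cmeas A (u n)) ->
  (forall t, A t -> (u n t : C^o) @[n --> \oo] --> (f t : C^o)) -> cmeas A f.
Proof.
move=> mu_ cu; split.
  apply: (@measurable_fun_cvg _ _ _ A (fun n t => complex.Re (u n t))).
    by move=> n; have [] := mu_ n.
  move=> t At; apply/cvgrPdist_le => e e0.
  have /cvg_cabsP/(_ _ e0) := cu t At.
  apply: filterS => n; rewrite cabs_distC; apply: le_trans.
  by apply: le_trans (cabs_Re _); rewrite raddfB.
apply: (@measurable_fun_cvg _ _ _ A (fun n t => complex.Im (u n t))).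
  by move=> n; have [] := mu_ n.
move=> t At; apply/cvgrPdist_le => e e0.
have /cvg_cabsP/(_ _ e0) := cu t At.
apply: filterS => n; rewrite cabs_distC; apply: le_trans.
by apply: le_trans (cabs_Im _); rewrite raddfB.
Qed.

Lemma lipschitz_cmeas a b F : a <= b -> lipschitz_itv a b F -> cmeas `[a, b] F.
Proof.
move=> ab [k Hk].
pose cl x := Num.max a (Num.min x b).
have cl_in x : a <= cl x <= b.
  by rewrite le_max lexx/= ge_max ab ge_min lexx orbT.
have cl_id x : a <= x <= b -> cl x = x.
  by move=> /andP[ax xb]; rewrite /cl (min_idPl xb) (max_idPr ax).
have cl_lip x y : `|cl x - cl y| <= `|x - y|.
  rewrite /cl /Num.max /Num.min; do ![case: ifPn => //];
  rewrite -?leNgt => *; rewrite !ler_norml; apply/andP; split; rewrite ?subrr//;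
  move: (ler_norm (x - y)) (ler_norm (y - x)); rewrite (distrC y x); lra.
have cont (g : C -> R) : (forall z w, `|g z - g w| <= cabs (z - w)) ->
    measurable_fun `[a, b] (fun t => g (F t)).
  move=> gl; apply: (@eq_measurable_fun _ _ _ _ _ (fun t => g (F (cl t)))).
    by move=> x; rewrite inE/= in_itv/= => h; rewrite cl_id.
  apply: measurable_funTS; apply: continuous_measurable_fun => x.
  apply/cvgrPdist_le => e e0.
  have k0 : 0 < `|k| + 1 by rewrite ltr_wpDl.
  exists (e / (`|k| + 1)); first exact: divr_gt0.
  move=> y /=; rewrite ltr_pdivlMr// => h.
  apply: le_trans (gl _ _) _; apply: le_trans (Hk _ _ (cl_in _) (cl_in _)) _.
  apply: le_trans (_ : (`|k| + 1) * `|cl x - cl y| <= _).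
    by rewrite ler_wpM2r// (le_trans (ler_norm _))// lerDl.
  apply: le_trans (ltW h); rewrite mulrC ler_wpM2r// ltW//.
split; apply: cont => z w.
  by apply: le_trans (cabs_Re _); rewrite raddfB.
by apply: le_trans (cabs_Im _); rewrite raddfB.
Qed.

Lemma prim_integral (f : R -> C) (M : R) : cmeas D f ->
  {ae mu, forall t, D t -> cabs (f t) <= M} ->
  is_primitive 0 p2 (fun s => Cintegral `[s, p2] f) (fun t => - f t).
Proof.
move=> [m1 m2] fM.
have fM1 : {ae mu, forall t, D t -> `|complex.Re (f t)| <= M}.
  by apply: ae_imp fM => t h /h; exact: le_trans (cabs_Re _).
have fM2 : {ae mu, forall t, D t -> `|complex.Im (f t)| <= M}.
  by apply: ae_imp fM => t h /h; exact: le_trans (cabs_Im _).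
split.
  exists (M + M) => x y hx hy; apply: le_trans (cabs_ReIm _) _.
  rewrite [leRHS]mulrDl.
  have h1 := Rprimitive_lip m1 fM1 hx hy; have h2 := Rprimitive_lip m2 fM2 hx hy.
  exact: (lerD h1 h2).
apply: ae_imp (ae_and (Rprimitive_deriv m1 fM1) (Rprimitive_deriv m2 fM2)) => x [h1 h2] hx.
apply/cvg_cabsP => e e0; have e20 : 0 < e / 2 by rewrite divr_gt0.
have /cvgrPdist_le/(_ _ e20) k1 := h1 hx.
have /cvgrPdist_le/(_ _ e20) k2 := h2 hx.
apply: filterS2 k1 k2 => h /= H1 H2.
have E (z w v : C) (t : R) :
    (complex.Re ((z - w) / t%:C - - v) = (complex.Re z - complex.Re w) / t - - complex.Re v) *
    (complex.Im ((z - w) / t%:C - - v) = (complex.Im z - complex.Im w) / t - - complex.Im v).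
  by rewrite -fmorphV; case: z w v => [? ?] [? ?] [? ?]; split => /=; ring.
apply: le_trans (cabs_ReIm _) _.
by rewrite [leRHS]splitr !E; apply: lerD; rewrite distrC.
Qed.

End ComplexCalculus.

(** * Convolution of functions of words *)

Section Concatenation.
Variable A : comNzRingType.
Implicit Types f g h : seq nat -> A.

(** The sum of [f u * g v] over the ways of writing [w] as a concatenation of
    [u] and [v]; defined by recursion so that no position has to be computed. *)
Fixpoint word_conv f g (w : seq nat) : A :=
  if w is i :: w' then f [::] * g w + word_conv (fun u => f (i :: u)) g w'
  else f [::] * g [::].

Lemma word_conv_cons f g i w :
  word_conv f g (i :: w) = f [::] * g (i :: w) + word_conv (fun u => f (i :: u)) g w.
Proof. by []. Qed.

Lemma eq_word_conv f f' g g' w : f =1 f' -> g =1 g' -> word_conv f g w = word_conv f' g' w.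
Proof.
move=> ff gg; elim: w f f' ff => [|i w IH] f f' ff /=; first by rewrite ff gg.
by rewrite ff gg; congr (_ + _); apply: IH => u; exact: ff.
Qed.

Lemma word_convDl f f' g w : word_conv (fun u => f u + f' u) g w = word_conv f g w + word_conv f' g w.
Proof.
elim: w f f' => [|i w IH] f f' /=; first by rewrite mulrDl.
by rewrite IH mulrDl addrACA.
Qed.

Lemma word_convZl c f g w : word_conv (fun u => c * f u) g w = c * word_conv f g w.
Proof.
elim: w f => [|i w IH] f /=; first by rewrite mulrA.
by rewrite IH mulrDr mulrA.
Qed.

(** Associativity is the statement that both sides sum over the ways of
    cutting [w] into three. *)
Lemma word_convA f g h w : word_conv (word_conv f g) h w = word_conv f (word_conv g h) w.
Proof.
elim: w f => [|i w IH] f; first by rewrite /= mulrA.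
rewrite !word_conv_cons word_convDl word_convZl IH /=; ring.
Qed.

Lemma word_conv1r f g w : g [::] = 1 -> (forall u, u != [::] -> g u = 0) -> word_conv f g w = f w.
Proof.
move=> g1 g0; elim: w f => [|i w IH] f /=; first by rewrite g1 mulr1.
by rewrite g0// mulr0 add0r IH.
Qed.

Lemma word_conv1l f g w : f [::] = 1 -> (forall u, u != [::] -> f u = 0) -> word_conv f g w = g w.
Proof.
move=> f1 f0; case: w => [|i w] /=; first by rewrite f1 mul1r.
suff -> : word_conv (fun u => f (i :: u)) g w = 0 by rewrite f1 mul1r addr0.
have -> : word_conv (fun u => f (i :: u)) g w = word_conv (fun u => 0 * f u) g w.
  by apply: eq_word_conv => // u; rewrite mul0r f0.
by rewrite word_convZl mul0r.
Qed.

Lemma word_conv_last f g w : g [::] = 1 ->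
  word_conv f g w = \sum_(j < size w) f (take j w) * g (drop j w) + f w.
Proof.
move=> g1; elim: w f => [|i w IH] f /=; first by rewrite big_ord0 g1 add0r mulr1.
by rewrite IH big_ord_recl /= addrA.
Qed.

(** Convolution with [g] is unitriangular for the length of words when
    [g [::] = 1], and so injective. *)
Lemma word_conv_cancel f f' g : g [::] = 1 -> word_conv f g =1 word_conv f' g -> f =1 f'.
Proof.
move=> g1 h w; elim: {w}(size w).+1 {-2}w (ltnSn (size w)) => // n IH w sw.
have := h w; rewrite !word_conv_last//.
have -> : \sum_(j < size w) f (take j w) * g (drop j w) =
          \sum_(j < size w) f' (take j w) * g (drop j w).
  apply: eq_bigr => j _; rewrite IH//.
  by rewrite size_take ltn_ord (leq_trans (ltn_ord j)).
by move/addrI.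
Qed.

End Concatenation.

(** * Iterated integrals and the group of classes *)

Section IteratedIntegrals.
Variable R : realType.
Local Notation C := R[i].
Local Notation mu := (@lebesgue_measure R).
Local Notation p2 := (2 * pi : R).
Implicit Types (a b c : X R) (w : seq nat) (s t : R).

Lemma X_bound a : exists2 l : R, 0 < l &
  forall i, {ae mu, forall t, cabs (coeff a i t) <= l ^+ i.+1}.
Proof.
have [l l0 H] := in_X_growth (svalP a); exists l => // i.
by refine (ae_imp _ (H i)) => t; rewrite cabs_le.
Qed.

Lemma X_meas a i (A : set R) : cmeas A (coeff a i).
Proof.
split; apply: measurable_funTS.
  exact: (in_X_Re (svalP a)).
exact: (in_X_Im (svalP a)).
Qed.

Lemma iter_intE a i w s : iter_int a (i :: w) s =
  Cintegral `[s, p2]%classic (fun t => coeff a i t * iter_int a w t).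
Proof. by []. Qed.

Lemma iter_int_end a i w : iter_int a (i :: w) p2 = 0.
Proof.
by rewrite iter_intE /Cintegral set_itv1 !Rintegral_set1.
Qed.

(** The recursive definition of iterated integrals as a differential equation. *)
Lemma prim_iter_int a i w :
  is_primitive 0 p2 (iter_int a (i :: w)) (fun t => - (coeff a i t * iter_int a w t)).
Proof.
suff lip u : lipschitz_itv 0 p2 (iter_int a u).
  have [l l0 H] := X_bound a; have [M M0 HM] := lipschitz_bounded (lip w).
  apply: (@prim_integral _ _ (l ^+ i.+1 * M)).
    apply: cmeasM; first exact: X_meas.
    exact: lipschitz_cmeas (p2_ge0 R) (lip w).
  apply: ae_imp (H i) => t h; rewrite /= in_itv/= => Dt.
  by rewrite cabsM; apply: ler_pM; rewrite ?cabs_ge0 ?HM.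
elim: u => [|j u lip]; first exact: (@prim_cst R 0 p2 1).1.
have [l l0 H] := X_bound a; have [M M0 HM] := lipschitz_bounded lip.
suff [] : is_primitive 0 p2 (iter_int a (j :: u)) (fun t => - (coeff a j t * iter_int a u t)) by [].
apply: (@prim_integral _ _ (l ^+ j.+1 * M)).
  apply: cmeasM; first exact: X_meas.
  exact: lipschitz_cmeas (p2_ge0 R) lip.
apply: ae_imp (H j) => t h; rewrite /= in_itv/= => Dt.
by rewrite cabsM; apply: ler_pM; rewrite ?cabs_ge0 ?HM.
Qed.

Lemma basic_nil a : basic_int [::] a = 1. Proof. by []. Qed.

Lemma circ_id t : 0 < t <= p2 -> circ t = t.
Proof.
move=> /andP[t0 tp]; rewrite /circ.
have -> : Num.ceil (t / p2) = 1.
  apply/eqP; rewrite eq_le -(ceil1 R); apply/andP; split.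
    by rewrite le_ceil// ler_pdivrMr ?p2_gt0// mul1r.
  by rewrite ceil1 -gtz0_ge1 ceil_gt0 divr_gt0// p2_gt0.
by rewrite subrr mul0r subr0.
Qed.

Lemma star_left a b i t : 0 < t <= pi ->
  coeff (starX a b) i t = 2 * coeff a i (2 * t + 0).
Proof.
move=> /andP[t0 tp]; have p0 := pi_gt0 R.
rewrite /coeff /= /star circ_id; last by apply/andP; split; lra.
by rewrite tp addr0.
Qed.

Lemma star_right a b i t : pi < t <= p2 ->
  coeff (starX a b) i t = 2 * coeff b i (2 * t - p2).
Proof.
move=> /andP[t0 tp]; have p0 := pi_gt0 R.
rewrite /coeff /= /star circ_id; last by apply/andP; split; lra.
by rewrite leNgt t0.
Qed.

(** On the second half of the circle only [b] is seen, at double speed. *)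
Lemma iter_int_star_right a b w s : pi <= s <= p2 ->
  iter_int (starX a b) w s = iter_int b w (2 * s - p2).
Proof.
have p0 := pi_gt0 R.
elim: w s => [|i w IH] s hs //.
have H1 := prim_restrict (ltW p0) (lexx p2) (prim_iter_int (starX a b) i w).
have e1 : 0 <= 2 * pi - p2 by rewrite subrr.
have e2 : 2 * p2 - p2 <= p2 by lra.
have H2 := prim_double (prim_restrict e1 e2 (prim_iter_int b i w)).
apply: (prim_unique H1 H2 _ _ hs).
  apply: ae_true => x /andP[x1 x2]; rewrite star_right ?x1 ?(ltW x2)//.
  rewrite IH; last by rewrite !ltW.
  by rewrite -mulrA mulrN.
by rewrite (_ : 2 * p2 - p2 = p2) ?iter_int_end//; ring.
Qed.

Lemma prim_word_conv (x y : R) (F f : seq nat -> R -> C) g w :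
  (forall u, is_primitive x y (F u) (f u)) ->
  is_primitive x y (fun t => word_conv (fun u => F u t) g w) (fun t => word_conv (fun u => f u t) g w).
Proof.
elim: w F f => [|i w IH] F f H /=.
  apply: prim_ext (primZ (g [::]) (H [::])) => [t _|]; first by rewrite mulrC.
  by apply: ae_true => t _; rewrite mulrC.
have h1 : is_primitive x y (fun t => F [::] t * g (i :: w)) (fun t => f [::] t * g (i :: w)).
  apply: prim_ext (primZ (g (i :: w)) (H [::])) => [t _|]; first by rewrite mulrC.
  by apply: ae_true => t _; rewrite mulrC.
exact (primD h1 (IH _ _ (fun u => H (i :: u)))).
Qed.

(** Both sides have the same derivative on the first half of the circle, by
    induction on [w]; at [pi] the integrals of [a] over a non-empty word
    vanish and only the term without letters of [a] is left. *)
Lemma iter_int_star_left a b w s : 0 <= s <= pi ->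
  iter_int (starX a b) w s =
  word_conv (fun u => iter_int a u (2 * s + 0)) (fun v => basic_int v b) w.
Proof.
have p0 := pi_gt0 R.
elim: w s => [|i w IH] s hs; first by rewrite /= mul1r.
have pp : pi <= p2 by lra.
have H1 := prim_restrict (lexx 0) pp (prim_iter_int (starX a b) i w).
have e1 : 0 <= 2 * 0 + 0 :> R by rewrite mulr0 addr0.
have e2 : p2 + 0 <= p2 by rewrite addr0.
have H2 := primD (prim_cst 0 pi (1 * basic_int (i :: w) b))
  (prim_word_conv (fun v => basic_int v b) w
    (fun u => prim_double (prim_restrict e1 e2 (prim_iter_int a i u)))).
apply: (prim_unique H1 H2 _ _ hs).
  apply: ae_true => x /andP[x1 x2]; rewrite star_left ?x1 ?(ltW x2)//.
  rewrite IH; last by rewrite !ltW.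
  rewrite add0r -mulNr -word_convZl; apply: eq_word_conv => // u.
  by rewrite mulrN mulNr mulrA.
rewrite iter_int_star_right; last by apply/andP; split; lra.
have -> : 2 * pi - p2 = 0 by rewrite subrr.
transitivity (word_conv (fun u => iter_int a u (2 * pi + 0)) (fun v => basic_int v b) (i :: w)) => //.
by rewrite word_conv1l// addr0; case=> // j u _; exact: iter_int_end.
Qed.

(** Chen's formula: points [s_1 <= ... <= s_k] of the circle are divided into
    those in the first half and those in the second half. *)
Lemma basic_int_star a b w : basic_int w (starX a b) =
  word_conv (fun u => basic_int u a) (fun v => basic_int v b) w.
Proof.
rewrite /basic_int iter_int_star_left ?lexx ?ltW ?pi_gt0//.
by rewrite mulr0 addr0.
Qed.

(** The path turns back at [pi], so its coefficients are antisymmetric and its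
    iterated integrals symmetric under [s |-> 2 pi - s]. The integral from [0]
    therefore equals the one from [2 pi]. *)
Lemma basic_int_star_rev a w : w != [::] -> basic_int w (starX a (revX a)) = 0.
Proof.
have p0 := pi_gt0 R; set c := starX _ _.
have anti i t : 0 < t < pi -> coeff c i (p2 - t) = - coeff c i t.
  move=> /andP[t0 tp]; rewrite star_right; last by apply/andP; split; lra.
  rewrite star_left; last by rewrite t0 ltW.
  rewrite {1}/coeff /= /rev mulrN; congr (- (2 * sval a i _)); ring.
have sym u t : 0 <= t <= pi -> iter_int c u t = iter_int c u (p2 - t).
  elim: u t => [|i u IH] t ht //.
  have pp : pi <= p2 by lra.
  have H1 := prim_restrict (lexx 0) pp (prim_iter_int c i u).
  have e1 : 0 <= p2 - pi by lra.
  have e2 : p2 - 0 <= p2 by rewrite subr0.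
  have H2 := prim_reflect (prim_restrict e1 e2 (prim_iter_int c i u)).
    (* Both functions agree at pi, the fixed point of the symmetry. *)
  apply: (prim_unique H1 H2 _ _ ht).
    apply: ae_true => x hx; have /andP[x1 x2] := hx.
    rewrite anti// -IH; last by rewrite !ltW.
    by rewrite mulNr opprK.
  by congr (iter_int c _ _); ring.
case: w => // i w _; rewrite /basic_int sym; last by rewrite lexx ltW.
by rewrite subr0 iter_int_end.
Qed.

(** By Chen's formula, [a ~ b] says that the integrals of [a] and those of [b]
    have the same convolution with the integrals of the reverse of [b], and
    convolution is injective. *)
Lemma simX_basic_int a b : simX a b <-> forall w, basic_int w a = basic_int w b.
Proof.
pose B' v := basic_int v (revX b).
have bB w : word_conv (fun u => basic_int u b) B' w = (w == [::])%:R.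
  rewrite -basic_int_star; case: w => [|i w] /=; first exact: basic_nil.
  exact: basic_int_star_rev.
split=> [ab|ab w w0].
  apply: (@word_conv_cancel _ _ _ B') => // w; rewrite bB -basic_int_star.
  by case: w => [|i w] /=; [exact: basic_nil|exact: ab].
rewrite basic_int_star; transitivity (word_conv (fun u => basic_int u b) B' w).
  exact: eq_word_conv.
by rewrite bB (negbTE w0).
Qed.

Lemma class_of_basic_int a b : class_of a = class_of b <-> forall w, basic_int w a = basic_int w b.
Proof.
split=> [h|h].
  apply/simX_basic_int; have : coset a = coset b by exact: (congr1 sval h).
  have bb : simX b b by apply/simX_basic_int.
  by move: bb; rewrite -[simX b b]/(coset b b) => + e; rewrite -e.
apply: eq_exist; apply/seteqP; split => x /simX_basic_int ax; apply/simX_basic_int => w.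
  by rewrite -h.
by rewrite h.
Qed.

Lemma hat_class_of w a : hat_int w (class_of a) = basic_int w a.
Proof. by rewrite /hat_int; apply: (proj1 (class_of_basic_int _ _)); exact: repK. Qed.

(** The iterated integrals embed the group of classes into the functions of
    words with convolution as product; the group laws below are read off
    there. *)
Lemma hat_ext (g h : GX R) : (forall w, hat_int w g = hat_int w h) -> g = h.
Proof. by move=> gh; rewrite -(repK g) -(repK h); apply/class_of_basic_int. Qed.

Lemma hat_mul w (g h : GX R) :
  hat_int w (g * h)%g = word_conv (fun u => hat_int u g) (fun v => hat_int v h) w.
Proof. by rewrite [(g * h)%g]/(mulG g h) hat_class_of basic_int_star. Qed.

Lemma hat_one w : hat_int w (1%g : GX R) = (w == [::])%:R.
Proof.
rewrite [1%g]/(oneG R) hat_class_of; case: w => [|i w] //=.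
rewrite /basic_int iter_intE /Cintegral.
have z t : coeff (zeroX R) i t * iter_int (zeroX R) w t = 0 by rewrite mul0r.
under [X in X +i* _]eq_Rintegral do rewrite z.
under [X in _ +i* X]eq_Rintegral do rewrite z.
by rewrite /= !Rintegral_cst// !mul0r.
Qed.

Lemma GX_mulA (g h k : GX R) : (g * (h * k) = g * h * k)%g.
Proof.
apply: hat_ext => w; rewrite !hat_mul.
under [RHS]eq_word_conv do [rewrite hat_mul|].
by rewrite word_convA; apply: eq_word_conv => // u; rewrite hat_mul.
Qed.

Lemma GX_mulg1 (g : GX R) : (g * 1 = g)%g.
Proof.
apply: hat_ext => w; rewrite hat_mul word_conv1r ?hat_one// => u.
by rewrite hat_one => /negbTE ->.
Qed.

Lemma GX_mul1g (g : GX R) : (1 * g = g)%g.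
Proof.
apply: hat_ext => w; rewrite hat_mul word_conv1l ?hat_one// => u.
by rewrite hat_one => /negbTE ->.
Qed.

Lemma GX_mulgV (g : GX R) : (g * g^-1 = 1)%g.
Proof.
apply: hat_ext => w; rewrite hat_mul hat_one.
transitivity (word_conv (fun u => basic_int u (rep g)) (fun v => basic_int v (revX (rep g))) w).
  by apply: eq_word_conv => // u; rewrite [(g^-1)%g]/(invG g) hat_class_of.
rewrite -basic_int_star; case: w => [|i w] //.
exact: basic_int_star_rev.
Qed.

Lemma GX_mulVg (g : GX R) : (g^-1 * g = 1)%g.
Proof.
rewrite -[(g^-1 * g)%g]GX_mulg1 -(GX_mulgV (g^-1)%g) GX_mulA -(GX_mulA _ g).
by rewrite GX_mulgV GX_mulg1.
Qed.

(** The letter [i] stands for the coefficient of index [i + 1], of degree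
    [i + 1]. *)
Definition word_deg w := sumn (map S w).

Lemma in_X_dil (t : R) a : in_X (fun i s => (t ^+ i.+1)%:C * coeff a i s).
Proof.
split.
- by move=> i; have [] := cmeasM (cmeas_cst setT (t ^+ i.+1)%:C) (X_meas a i setT).
- by move=> i; have [] := cmeasM (cmeas_cst setT (t ^+ i.+1)%:C) (X_meas a i setT).
- by move=> i s; rewrite /coeff (in_X_periodic (svalP a)).
- have [l l0 H] := X_bound a; exists (`|t| * l + 1); first by rewrite ltr_wpDl// mulr_ge0// ltW.
  move=> i; apply: ae_imp (H i) => s h; rewrite cabs_le cabsM cabs_real normrX.
  apply: le_trans (_ : (`|t| * l) ^+ i.+1 <= _); first by rewrite exprMn ler_wpM2l// exprn_ge0.
  have tl : 0 <= `|t| * l by rewrite mulr_ge0// ltW.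
  by apply: lerXn2r; rewrite ?nnegrE ?addr_ge0// lerDl.
Qed.

(** The field of degree [i] is multiplied by [t ^ i]; on the return map this is
    conjugation by the homothety of ratio [t]. *)
Definition dilX t a : X R := exist _ _ (in_X_dil t a).

Lemma basic_int_dil t a w : basic_int w (dilX t a) = (t ^+ word_deg w)%:C * basic_int w a.
Proof.
suff H s : 0 <= s <= p2 -> iter_int (dilX t a) w s = (t ^+ word_deg w)%:C * iter_int a w s.
  by apply: H; rewrite lexx p2_ge0.
elim: w s => [|i w IH] s hs; first by rewrite expr0 mul1r.
have H1 := prim_iter_int (dilX t a) i w.
have H2 := primZ (t ^+ word_deg (i :: w))%:C (prim_iter_int a i w).
apply: (prim_unique H1 H2 _ _ hs); last by rewrite !iter_int_end mulr0.
apply: ae_true => x /andP[x1 x2]; rewrite IH ?ltW//.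
rewrite {1}/coeff /= /word_deg /= exprD rmorphM mulrN; congr (- _); ring.
Qed.

Definition dilG (t : R) (g : GX R) : GX R := class_of (dilX t (rep g)).

Lemma hat_dilG t w g : hat_int w (dilG t g) = (t ^+ word_deg w)%:C * hat_int w g.
Proof. by rewrite /dilG hat_class_of basic_int_dil. Qed.

End IteratedIntegrals.

(** * Words of given degree *)

Section Sums.
Variable V : nmodType.

Lemma triangle_exchange n (F : nat -> nat -> V) :
  \sum_(i < n.+1) \sum_(j < (n - i).+1) F i j =
  \sum_(j < n.+1) \sum_(i < (n - j).+1) F i j.
Proof.
have cut (G : nat -> V) k : (k <= n)%N ->
    \sum_(j < (n - k).+1) G j = \sum_(j < n.+1 | (k + j <= n)%N) G j.
  move=> kn; rewrite (big_ord_widen n.+1) ?ltnS ?leq_subr//.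
  by apply: eq_bigl => j; rewrite ltnS; lia.
under eq_bigr => i _ do rewrite (cut (F i)) -1?ltnS//.
under [RHS]eq_bigr => j _ do rewrite (cut (fun i => F i j)) -1?ltnS//.
rewrite (exchange_big_dep predT)//=.
by apply: eq_bigr => j _; apply: eq_bigl => i; rewrite addnC.
Qed.

Lemma sum_ord_rev n (F : nat -> V) : \sum_(i < n.+1) F i = \sum_(i < n.+1) F (n - i)%N.
Proof. by rewrite (reindex_inj rev_ord_inj); apply: eq_bigr => i _. Qed.

End Sums.

Section Words.

(** The words of degree [n], with first argument a bound for the depth of the
    recursion; any [k >= n] gives the same list. *)
Fixpoint words_rec (k n : nat) : seq (seq nat) :=
  if n is n'.+1 then
    if k is k'.+1 then
      flatten [seq [seq i :: w | w <- words_rec k' (n' - i)] | i <- iota 0 n'.+1]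
    else [::]
  else [:: [::]].

Definition words n := words_rec n n.

Lemma words_recE k n : (n <= k)%N -> words_rec k n = words n.
Proof.
rewrite /words; elim/ltn_ind: n k => -[|n] IH [|k]//; rewrite ltnS => nk.
have E k' : words_rec k'.+1 n.+1 =
  flatten [seq [seq i :: w | w <- words_rec k' (n - i)] | i <- iota 0 n.+1] by [].
rewrite !E; congr flatten; apply/eq_in_map => i _.
by rewrite !IH ?ltnS ?leq_subr// (leq_trans (leq_subr _ _)).
Qed.

Lemma big_words (V : nmodType) n (F : seq nat -> V) :
  \sum_(w <- words n.+1) F w = \sum_(i < n.+1) \sum_(w <- words (n - i)) F ((i : nat) :: w).
Proof.
have -> : words n.+1 =
  flatten [seq [seq i :: w | w <- words_rec n (n - i)] | i <- iota 0 n.+1] by [].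
rewrite big_flatten big_map.
rewrite -[iota _ _]/(index_iota 0 n.+1) big_mkord.
by apply: eq_bigr => i _; rewrite big_map words_recE ?leq_subr.
Qed.

Lemma words0 (V : nmodType) (F : seq nat -> V) : \sum_(w <- words 0) F w = F [::].
Proof. by rewrite big_seq1. Qed.

Lemma words_deg n w : w \in words n -> word_deg w = n.
Proof.
elim/ltn_ind: n w => -[|n] IH w; first by rewrite inE => /eqP ->.
have -> : words n.+1 =
  flatten [seq [seq i :: w | w <- words_rec n (n - i)] | i <- iota 0 n.+1] by [].
move=> /allpairsPdep[i [u []]]; rewrite mem_iota => hi.
rewrite words_recE ?leq_subr// => /IH hu ->.
by rewrite /word_deg /= -/(word_deg u) hu ?ltnS ?leq_subr//; lia.
Qed.

(** The weight with which the differential operators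
    [z ^ (i + 2) d/dz], applied for the letters [i] of [w] from the last to
    the first, multiply [z ^ m]: each of them contributes the current
    exponent. *)
Fixpoint word_coef (m : nat) (w : seq nat) : nat :=
  if w is _ :: w' then word_coef m w' * (word_deg w' + m) else 1.

End Words.

(** * Coefficients of the flow *)

Section FlowCoefficients.
Variable R : realType.
Local Notation C := R[i].
Local Notation mu := (@lebesgue_measure R).
Local Notation p2 := (2 * pi : R).
Implicit Types (a b : X R) (phi psi : seq nat -> C) (s t : R) (m n : nat).

(** For [phi] the iterated integrals over [[s, 2 pi]], the coefficient of
    [z ^ (m + n)] in the [m]-th power of the flow from [s] to [2 pi]. *)
Definition flow_coef m n phi : C := \sum_(w <- words n) (word_coef m w)%:R * phi w.

Lemma eq_flow_coef m n phi psi : phi =1 psi -> flow_coef m n phi = flow_coef m n psi.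
Proof. by move=> h; apply: eq_bigr => w _; rewrite h. Qed.

Lemma flow_coef0 m phi : flow_coef m 0 phi = phi [::].
Proof. by rewrite /flow_coef words0 mul1r. Qed.

Lemma flow_coefS m n phi : flow_coef m n.+1 phi =
  \sum_(i < n.+1) (n - i + m)%:R * flow_coef m (n - i) (fun w => phi ((i : nat) :: w)).
Proof.
rewrite /flow_coef big_words; apply: eq_bigr => i _; rewrite mulr_sumr.
rewrite [LHS]big_seq_cond [RHS]big_seq_cond; apply: eq_bigr => w.
rewrite andbT => /words_deg <- /=; rewrite natrM mulrA; congr (_ * _).
by rewrite mulrC.
Qed.

Lemma flow_coefD m n phi psi :
  flow_coef m n (fun w => phi w + psi w) = flow_coef m n phi + flow_coef m n psi.
Proof. by rewrite -big_split; apply: eq_bigr => w _; rewrite mulrDr. Qed.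

Lemma flow_coefZ m n (c : C) phi :
  flow_coef m n (fun w => c * phi w) = c * flow_coef m n phi.
Proof. by rewrite mulr_sumr; apply: eq_bigr => w _; rewrite mulrCA. Qed.

(** The formal version of the composition of flows: [psi] carries [z ^ m] to
    a series of terms [z ^ (j + m)], to each of which [phi] is then applied. *)
Lemma flow_coef_conv m n phi psi : flow_coef m n (word_conv phi psi) =
  \sum_(j < n.+1) flow_coef m j psi * flow_coef (j + m) (n - j) phi.
Proof.
elim/ltn_ind: n phi => -[|n] IH phi.
  by rewrite big_ord_recl big_ord0 !flow_coef0 addr0 /= mulrC.
rewrite big_ord_recr /= subnn flow_coef0 mulrC.
rewrite [LHS](_ : _ = phi [::] * flow_coef m n.+1 psi +
   \sum_(i < n.+1) (n - i + m)%:R * flow_coef m (n - i) (word_conv (fun u => phi ((i : nat) :: u)) psi)).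
  rewrite addrC; congr (_ + _).
  under [LHS]eq_bigr => i _ do rewrite IH ?ltnS ?leq_subr// mulr_sumr.
  rewrite (triangle_exchange n (fun i j => (n - i + m)%:R * (flow_coef m j psi *
      flow_coef (j + m) (n - i - j) (fun u => phi ((i : nat) :: u))))).
  apply: eq_bigr => j _; have jn : (j <= n)%N by rewrite -ltnS.
  rewrite subSn// flow_coefS mulr_sumr; apply: eq_bigr => i _.
  have hi : (i <= n - j)%N by rewrite -ltnS.
  rewrite mulrCA; congr (_ * (_%:R * _)); first by lia.
  by congr (flow_coef _ _ _); lia.
rewrite flow_coefS [in RHS]flow_coefS mulr_sumr -big_split; apply: eq_bigr => i _ /=.
rewrite [phi [::] * _]mulrCA -mulrDr; congr (_ * _).
by rewrite flow_coefD flow_coefZ.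
Qed.

Definition flow_at a m n s : C := flow_coef m n (fun w => iter_int a w s).

Definition dflow_at a m n t : C := if n is k.+1 then
  - \sum_(i < k.+1) (k - i + m)%:R * (coeff a i t * flow_at a m (k - i) t) else 0.

Lemma flow_at0 a m s : flow_at a m 0 s = 1.
Proof. by rewrite /flow_at flow_coef0. Qed.

(** The transport equation of the flow. *)
Lemma prim_flow_at a m n : is_primitive 0 p2 (flow_at a m n) (dflow_at a m n).
Proof.
case: n => [|n].
  by apply: prim_ext (prim_cst 0 p2 1) => [x _|]; [rewrite flow_at0|exact: ae_true].
have H : is_primitive 0 p2 (fun t => \sum_(i < n.+1) (n - i + m)%:R *
    \sum_(w <- words (n - i)) (word_coef m w)%:R * iter_int a ((i : nat) :: w) t)
  (fun t => \sum_(i < n.+1) (n - i + m)%:R *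
    \sum_(w <- words (n - i)) (word_coef m w)%:R * - (coeff a i t * iter_int a w t)).
  apply: prim_sum_ord => i; apply: primZ; apply: prim_sum => w _; apply: primZ.
  exact: prim_iter_int.
apply: prim_ext H => [x _|]; first by rewrite /flow_at flow_coefS.
apply: ae_true => x _; rewrite /= -sumrN; apply: eq_bigr => i _.
rewrite -mulrN; congr (_ * _); rewrite -mulNr /flow_at -flow_coefZ.
by apply: eq_bigr => w _; rewrite mulNr.
Qed.

Lemma flow_at_end a m n : flow_at a m n p2 = (n == 0%N)%:R.
Proof.
case: n => [|n]; first exact: flow_at0.
rewrite /flow_at flow_coefS big1// => i _; rewrite /flow_coef big1 ?mulr0// => w _.
by rewrite iter_int_end mulr0.
Qed.

(** The flow of [z ^ (m + m')] is the product of the flows of [z ^ m] and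
    [z ^ m'], because the transport operators are derivations: both sides
    satisfy the same triangular system of differential equations. *)
Lemma flow_at_mul a m m' n s : 0 <= s <= p2 ->
  flow_at a (m + m') n s = \sum_(j < n.+1) flow_at a m j s * flow_at a m' (n - j) s.
Proof.
elim/ltn_ind: n s => -[|n] IH s hs; first by rewrite big_ord1 !flow_at0 mul1r.
have H1 := prim_flow_at a (m + m') n.+1.
have H2 : is_primitive 0 p2 (fun t => \sum_(j < n.+2) flow_at a m j t * flow_at a m' (n.+1 - j) t)
   (fun t => \sum_(j < n.+2) (dflow_at a m j t * flow_at a m' (n.+1 - j) t +
                               flow_at a m j t * dflow_at a m' (n.+1 - j) t)).
  by apply: prim_sum_ord => j; apply: primM; exact: prim_flow_at.
apply: (prim_unique H1 H2 _ _ hs); last first.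
  rewrite !flow_at_end big1// => j _; rewrite !flow_at_end.
  case: j => -[|j] hj /=; last by rewrite mul0r.
  by rewrite mulr0.
apply: ae_true => x /andP[/ltW x0 /ltW xp].
have half k k' : \sum_(j < n.+2) flow_at a k j x * dflow_at a k' (n.+1 - j) x =
   - \sum_(i < n.+1) coeff a i x * \sum_(j < (n - i).+1)
      flow_at a k j x * ((n - i - j + k')%:R * flow_at a k' (n - i - j) x).
  rewrite big_ord_recr /= subnn mulr0 addr0.
  under [X in - X]eq_bigr => i _ do rewrite mulr_sumr.
  rewrite (triangle_exchange n (fun i j => coeff a i x * (flow_at a k j x *
     ((n - i - j + k')%:R * flow_at a k' (n - i - j) x)))) -sumrN.
  apply: eq_bigr => j _; have jn : (j <= n)%N by rewrite -ltnS.
  rewrite subSn//= mulrN mulr_sumr; congr (- _); apply: eq_bigr => i _.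
  by rewrite subnAC; ring.
rewrite big_split /= half.
rewrite [X in _ = X + _](_ : _ = \sum_(j < n.+2) flow_at a m' j x * dflow_at a m (n.+1 - j) x);
  last first.
  rewrite (sum_ord_rev n.+1 (fun j => flow_at a m' j x * dflow_at a m (n.+1 - j) x)).
  apply: eq_bigr => j _.
  by rewrite mulrC subKn// -ltnS.
rewrite half -opprD -big_split; congr (- _); apply: eq_bigr => i _ /=.
rewrite IH ?ltnS ?leq_subr ?x0// -mulrDr mulrCA; congr (_ * _).
rewrite (sum_ord_rev (n - i) (fun j => flow_at a m' j x *
  ((n - i - j + m)%:R * flow_at a m (n - i - j) x))) -big_split mulr_sumr; apply: eq_bigr => j _ /=.
have jn : (j <= n - i)%N by rewrite -ltnS.
rewrite subKn// -[X in X%:R * (_ * _)](_ : j + m + (n - i - j + m') = _)%N; last by lia.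
by rewrite natrD; ring.
Qed.

Lemma has_deriv_exp (F : R -> C) x L n : has_deriv F x L ->
  has_deriv (fun t => F t ^+ n.+1) x (n.+1%:R * F x ^+ n * L).
Proof.
move=> hF; elim: n => [|n IH]; first by rewrite expr0 !mul1r.
have := has_derivM IH hF.
rewrite (_ : _ + _ = n.+2%:R * F x ^+ n.+1 * L); last first.
  by rewrite [n.+2%:R]mulrSr !exprS; ring.
by under eq_fun do rewrite -exprSr.
Qed.

Lemma has_deriv_pow_sub (c d x : R) k :
  has_deriv (fun t => (- (c * (d - t) ^+ k.+1))%:C) x (c * (k.+1%:R * (d - x) ^+ k))%:C.
Proof.
pose G t : C := d%:C + (-1) * t%:C.
have hG : has_deriv G x (0 + -1).
  by apply: has_derivD; [exact: has_deriv_cst|exact: has_deriv_linear].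
have GE t : G t = (d - t)%:C by rewrite /G rmorphB mulN1r.
have := has_derivM (has_deriv_cst (- c%:C) x) (has_deriv_exp (n := k) hG).
have e y : - c%:C * G y ^+ k.+1 = (- (c * (d - y) ^+ k.+1))%:C.
  by rewrite GE; move: (d - y) => T; rewrite rmorphN rmorphM rmorphXn mulNr.
under eq_fun do rewrite e.
have -> // : 0 * G x ^+ k.+1 + - c%:C * (k.+1%:R * G x ^+ k * (0 + -1)) =
   (c * (k.+1%:R * (d - x) ^+ k))%:C.
rewrite mul0r !add0r GE; move: (d - x) => T.
by rewrite mulrN1 mulrNN rmorphM rmorphM rmorphXn rmorph_nat.
Qed.

(** By induction with the transport equation. The factor [n - i + m] produced
    by [d/dz] is absorbed by the exponent [n + m] of the majorant when it is
    integrated, so that no factorial appears. *)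
Lemma flow_at_bound a (l : R) m n s : 0 <= l ->
  (forall i, {ae mu, forall t, cabs (coeff a i t) <= l ^+ i.+1}) -> 0 <= s <= p2 ->
  cabs (flow_at a m n s) <= (2 * l) ^+ n * (1 + p2 - s) ^+ (n + m).
Proof.
move=> l0 al; elim/ltn_ind: n s => -[|n] IH s /andP[s0 sp].
  by rewrite flow_at0 cabs1 mul1r exprn_ege1//; lra.
pose c := (2 * l) ^+ n.+1.
have c0 : 0 <= c by rewrite exprn_ge0// mulr_ge0.
pose phi t := - (c * (1 + p2 - t) ^+ (n + m).+1).
pose psi t := c * ((n + m).+1%:R * (1 + p2 - t) ^+ (n + m)).
have h1 : cabs (flow_at a m n.+1 p2 - flow_at a m n.+1 s) <= phi p2 - phi s.
  apply: (@prim_compare _ _ _ _ _ phi psi sp (prim_restrict s0 (lexx _) (prim_flow_at a m n.+1))).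
  - move=> x y sx xy yp; rewrite /phi lerN2 ler_wpM2l// lerXn2r ?nnegrE; lra.
  - by move=> x _; exact: has_deriv_pow_sub.
  - have := ae_all al; apply: ae_imp => t ht /andP[st tp].
    have T1 : 1 <= 1 + p2 - t by lra.
    have T0 : 0 <= 1 + p2 - t by lra.
    rewrite /= cabsN; apply: le_trans (cabs_sum _ _ _) _.
    (* Only the powers of 2 depend on i; their sum is less than 2 ^ (n + 1). *)
    apply: (@le_trans _ _ (\sum_(i < n.+1) ((n + m)%:R * l ^+ n.+1 *
              (1 + p2 - t) ^+ (n + m)) * 2 ^+ (n - i))).
      apply: ler_sum => i _; have hi : (i <= n)%N by rewrite -ltnS.
      rewrite !cabsM cabs_nat.
      have b1 : cabs (flow_at a m (n - i) t) <= (2 * l) ^+ (n - i) * (1 + p2 - t) ^+ (n + m).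
        apply: le_trans (IH _ _ _ _) _; rewrite ?ltnS ?leq_subr//.
          by rewrite (ltW tp) (le_trans s0 (ltW st)).
        apply: ler_wpM2l; first by rewrite exprn_ge0// mulr_ge0.
        by rewrite ler_weXn2l// leq_add2r leq_subr.
      have b2 := ler_pM (cabs_ge0 _) (cabs_ge0 _) (ht i) b1.
      have b3 : (n - i + m)%:R <= (n + m)%:R :> R by rewrite ler_nat leq_add2r leq_subr.
      apply: le_trans (ler_pM _ _ b3 b2) _; rewrite ?mulr_ge0 ?cabs_ge0//.
      rewrite le_eqVlt; apply/orP; left; apply/eqP.
      rewrite exprMn (_ : l ^+ n.+1 = l ^+ i.+1 * l ^+ (n - i)); last first.
        by rewrite -exprD addSn subnKC.
      ring.
    rewrite -mulr_sumr /psi.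
    have -> : \sum_(i < n.+1) 2 ^+ (n - i) = 2 ^+ n.+1 - 1 :> R.
      rewrite -sum_ord_rev; elim: (n) => [|k IHk]; first by rewrite big_ord1 expr0 expr1; ring.
      by rewrite big_ord_recr IHk /= [in RHS]exprS; ring.
    rewrite /c exprMn.
    set q := l ^+ n.+1; set T := (1 + p2 - t) ^+ _; set w := (2 : R) ^+ n.+1.
    have q0 : 0 <= q by rewrite exprn_ge0.
    have T0' : 0 <= T by rewrite exprn_ge0.
    have w0 : 0 <= w by rewrite exprn_ge0.
    have -> : (n + m).+1%:R = (n + m)%:R + 1 :> R by rewrite mulrSr.
    have N0 : 0 <= (n + m)%:R :> R by [].
    have -> : w * q * (((n + m)%:R + 1) * T) =
      (n + m)%:R * q * T * (w - 1) + ((n + m)%:R * q * T + w * q * T) by ring.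
    by rewrite lerDl addr_ge0// !mulr_ge0.
rewrite flow_at_end sub0r cabsN in h1; apply: le_trans h1 _.
rewrite /phi opprK addSn gerDr oppr_le0.
by apply: mulr_ge0 => //; apply: exprn_ge0; lra.
Qed.

End FlowCoefficients.

(** * The first return series as a homomorphism *)

Section ReturnSeries.
Variable R : realType.
Local Notation C := R[i].
Local Notation mu := (@lebesgue_measure R).
Local Notation p2 := (2 * pi : R).
Implicit Types (a b : X R) (phi psi : seq nat -> C) (s t : R) (m n : nat) (g h : GX R).

(** The expansion of the flow starts with [r], so [flow_coef 1 k] is the
    coefficient of [r ^ (k + 1)]. *)
Definition return_coef phi n : C := if n is k.+1 then flow_coef 1 k phi else 0.

Lemma return_coef_growth a : exists2 M : R, 1 <= M &
  forall n, `|return_coef (fun w => basic_int w a) n| <= (M ^+ n)%:C.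
Proof.
have [l l0 al] := X_bound a; have p0 := p2_gt0 R.
exists ((2 * l) * (1 + p2) + (1 + p2)).
  have : 0 <= 2 * l * (1 + p2) by rewrite !mulr_ge0//; lra.
  lra.
case=> [|n]; first by rewrite normr0 expr0 ler0c.
rewrite cabs_le.
apply: le_trans (flow_at_bound 1 n (ltW l0) al (s := 0) _) _; first by rewrite lexx ltW.
rewrite subr0 addn1 exprSr mulrA -exprMn exprSr; apply: ler_pM.
- by rewrite exprn_ge0// !mulr_ge0//; lra.
- lra.
- apply: lerXn2r; rewrite ?nnegrE.
  + by rewrite !mulr_ge0//; lra.
  + by rewrite addr_ge0// ?mulr_ge0//; lra.
  + by rewrite lerDl; lra.
- by rewrite lerDr !mulr_ge0//; lra.
Qed.

Lemma in_Gc_return a : in_Gc (return_coef (fun w => basic_int w a)).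
Proof.
split => //; first by rewrite /return_coef flow_coef0.
by have [M M1] := return_coef_growth a; exact: growth_cvg.
Qed.

Definition Phat g : Gc R := exist _ _ (in_Gc_return (rep g)).

Lemma series_coef_Phat g : series_coef (Phat g) = return_coef (fun w => hat_int w g).
Proof. by []. Qed.

Lemma Gc_ext (f f' : Gc R) : series_coef f =1 series_coef f' -> f = f'.
Proof.
case: f f' => f hf [f' hf'] /= ff; apply: eq_exist; exact/funext.
Qed.

Lemma flow_coef_m0 n phi : phi [::] = 1 -> flow_coef 0 n phi = (n == 0%N)%:R.
Proof.
move=> phi1; rewrite /flow_coef; case: n => [|n]; first by rewrite words0 mul1r.
have cw0 w : w != [::] -> word_coef 0 w = 0%N.
  elim: w => [//|i [//|j w] IH] _.
  by rewrite -[LHS]/(word_coef 0 (j :: w) * (word_deg (j :: w) + 0))%N IH.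
rewrite big_seq big1// => w /words_deg wn; rewrite cw0 ?mul0r//.
by case: w wn.
Qed.

(** Powers of the return series are the flows of the powers of [z]; this is
    what composition of series needs. *)
Lemma coef_trunc_exp a N i k : (k <= N)%N ->
  ((trunc N (return_coef (fun w => basic_int w a))) ^+ i)`_k =
  if (i <= k)%N then flow_coef i (k - i) (fun w => basic_int w a) else 0.
Proof.
elim: i k => [|i IH] k kN.
  by rewrite expr0 coef1 subn0 leq0n flow_coef_m0.
rewrite exprS coefM big_ord_recl coef_poly ltnS leq0n mul0r add0r.
case: k kN => [|k] kN; first by rewrite big_ord0.
rewrite ltnS.
under eq_bigr => j _.
  rewrite coef_poly lift0 ltnS (leq_trans (ltn_ord j)) // subSS IH; last first.
    by rewrite (leq_trans (leq_subr _ _))// ltnW.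
  over.
rewrite /=; have [ik|ki] := leqP i k; last first.
  rewrite big1// => j _; rewrite leqNgt (leq_ltn_trans (leq_subr _ _) ki) mulr0//.
have h0 : 0 <= (0 : R) <= p2 by rewrite lexx p2_ge0.
have := flow_at_mul a 1 i (k - i) h0; rewrite /flow_at add1n => ->.
rewrite (bigID (fun j : 'I_k.+1 => (j < (k - i).+1)%N))/= [X in _ + X]big1 ?addr0; last first.
  by move=> j; rewrite -leqNgt => hj; rewrite ifF ?mulr0//; apply/negbTE; have := ltn_ord j; lia.
rewrite (big_ord_widen k.+1 (fun j => flow_coef 1 j (fun w => iter_int a w 0) *
  flow_coef i (k - i - j) (fun w => iter_int a w 0))) ?ltnS ?leq_subr//.
apply: eq_bigr => j hj; rewrite ifT; last by have := ltn_ord j; lia.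
by rewrite subnAC.
Qed.

Lemma Phat_morph : {morph Phat : g h / (g * h)%g}.
Proof.
move=> g h; apply: Gc_ext => n.
rewrite [RHS]/(formal_comp (return_coef (fun w => basic_int w (rep h)))
                 (return_coef (fun w => basic_int w (rep g))) n) series_coef_Phat.
rewrite /formal_comp /trunc [in X in comp_poly _ X]poly_def -/(trunc _ _) linear_sum coef_sum /=.
under [RHS]eq_bigr => i _ do
  rewrite comp_polyZ comp_Xn_poly coefZ coef_trunc_exp// -1?ltnS// ltn_ord.
rewrite big_ord_recl mul0r add0r; case: n => [|n]; first by rewrite big_ord0.
rewrite /= (@eq_flow_coef _ _ _ _ (word_conv (fun u => hat_int u g) (fun v => hat_int v h))).
  by rewrite flow_coef_conv; apply: eq_bigr => j _; rewrite /bump /= add1n subSS addn1.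
by move=> w; rewrite hat_mul.
Qed.

End ReturnSeries.

(** * Bounds for power series *)

Section SeriesBounds.
Variable R : realType.
Local Notation C := R[i].

Lemma geo_sum_le (q : R) n : 0 <= q <= 1/2 -> \sum_(i < n) q ^+ i <= 2.
Proof.
move=> /andP[q0 q1]; suff : \sum_(i < n) q ^+ i <= 2 - 2 * q ^+ n.
  by move=> h; apply: le_trans h _; rewrite gerBl mulr_ge0// exprn_ge0.
elim: n => [|n IH]; first by rewrite big_ord0 expr0; lra.
rewrite big_ord_recr/= exprS; have := exprn_ge0 n q0; nra.
Qed.

Lemma series_geo_cvg (c : nat -> C) (q K : R) : 0 <= q <= 1/2 ->
  (forall i, cabs (c i) <= K * q ^+ i) -> cvgn (series (c : nat -> C^o)).
Proof.
move=> /andP[q0 q1] h; apply: (@cvg_dominated _ _ (geometric K q)).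
  by move=> n; rewrite cabs_le.
by apply: is_cvg_geometric_series; rewrite ger0_norm//; lra.
Qed.

(** Comparison with a geometric series of ratio at most [1 / 2], whose sum is at
    most [2]. *)
Lemma series_tail_bound (c : nat -> C) (q K : R) (L : C) M : 0 <= q <= 1/2 ->
  (forall i, cabs (c i) <= K * q ^+ i) ->
  series (c : nat -> C^o) @ \oo --> (L : C^o) ->
  cabs (L - \sum_(i < M) c i) <= 2 * K * q ^+ M.
Proof.
move=> hq h cL; have /andP[q0 q1] := hq.
have K0 : 0 <= K by have := le_trans (cabs_ge0 _) (h 0%N); rewrite expr0 mulr1.
have cL' : (fun n => series (c : nat -> C^o) n - \sum_(i < M) c i : C^o) @ \oo -->
    (L - \sum_(i < M) c i : C^o) by exact: (cvgB cL (cvg_cst _)).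
refine (lim_cabs_le _ cL' _); exists M => // n /= Mn.
rewrite /series /= -(big_mkord xpredT c) (big_cat_nat (n := M))//= addrAC subrr add0r.
apply: le_trans (cabs_sum _ _ _) _.
rewrite -{1}[M]add0n big_addn big_mkord.
apply: (@le_trans _ _ (\sum_(i < n - M) K * q ^+ M * q ^+ i)).
  by apply: ler_sum => i _; rewrite -mulrA -exprD addnC.
rewrite -mulr_sumr mulrC -mulrA ler_wpM2r ?mulr_ge0 ?exprn_ge0//.
exact: geo_sum_le.
Qed.

Lemma series_bound (c : nat -> C) (q K : R) (L : C) : 0 <= q <= 1/2 ->
  (forall i, cabs (c i) <= K * q ^+ i) ->
  series (c : nat -> C^o) @ \oo --> (L : C^o) -> cabs L <= 2 * K.
Proof.
move=> hq h cL; have := series_tail_bound 0 hq h cL.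
by rewrite big_ord0 subr0 expr0 mulr1.
Qed.

Lemma cabs_sub_exp (z y : C) (rho : R) n : cabs z <= rho -> cabs y <= rho ->
  cabs (z ^+ n.+1 - y ^+ n.+1) <= n.+1%:R * rho ^+ n * cabs (z - y).
Proof.
move=> zr yr; have r0 : 0 <= rho by exact: le_trans (cabs_ge0 _) zr.
elim: n => [|n IH]; first by rewrite !expr1 expr0 !mul1r.
have -> : z ^+ n.+2 - y ^+ n.+2 = (z ^+ n.+1 - y ^+ n.+1) * z + y ^+ n.+1 * (z - y).
  by rewrite [z ^+ n.+2]exprSr [y ^+ n.+2]exprSr; ring.
apply: le_trans (cabsD _ _) _; rewrite !cabsM cabsX.
have h1 : cabs (z ^+ n.+1 - y ^+ n.+1) * cabs z <=
    n.+1%:R * rho ^+ n * cabs (z - y) * rho by apply: ler_pM; rewrite ?cabs_ge0.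
have h2 : cabs y ^+ n.+1 * cabs (z - y) <= rho ^+ n.+1 * cabs (z - y).
  by rewrite ler_wpM2r ?cabs_ge0// lerXn2r// nnegrE cabs_ge0.
apply: le_trans (lerD h1 h2) _; rewrite [n.+2%:R]mulrSr exprS; lra.
Qed.

End SeriesBounds.

(** * Picard iteration *)

Section Picard.
Variable R : realType.
Local Notation C := R[i].
Local Notation mu := (@lebesgue_measure R).
Local Notation p2 := (2 * pi : R).
Local Notation D := (`[0, 2 * pi : R]%classic).

Variables (F : R -> C -> C) (rho K L : R) (r : C).
Hypothesis rho0 : 0 < rho.
Hypothesis r_small : cabs r <= rho / 2.
Hypothesis L0 : 0 <= L.
Hypothesis FK : forall t z, cabs z <= rho -> cabs (F t z) <= K.
Hypothesis FL : forall t z y, cabs z <= rho -> cabs y <= rho ->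
  cabs (F t z - F t y) <= L * cabs (z - y).
Hypothesis F_meas : forall v, cmeas D v -> (forall t, D t -> cabs (v t) <= rho) ->
  cmeas D (fun t => F t (v t)).
Hypothesis K_small : p2 * K <= rho / 2.
Hypothesis L_small : p2 * L <= 1 / 2.

Let K0 : 0 <= K.
Proof. by apply: le_trans (cabs_ge0 (F 0 0)) (FK _ _); rewrite cabs0 ltW. Qed.

Let geo0 (c : R) n : 0 <= c -> 0 <= c * rho * (1 / 2) ^+ n.
Proof.
move=> c0; apply: mulr_ge0; first by rewrite mulr_ge0// ltW.
by rewrite exprn_ge0// divr_ge0.
Qed.

Definition picard_step (v : R -> C) (x : R) : C :=
  r + (Cintegral `[0, p2] (fun t => F t (v t)) - Cintegral `[x, p2] (fun t => F t (v t))).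

(** The functions on which the iteration acts: those for which the integral of
    the field makes sense and is controlled. *)
Definition admissible v := cmeas D v /\ forall t, D t -> cabs (v t) <= rho.

Lemma prim_picard v : admissible v -> is_primitive 0 p2 (picard_step v) (fun t => F t (v t)).
Proof.
move=> [mv bv].
have bF : {ae mu, forall t, D t -> cabs (F t (v t)) <= K}.
  by apply: ae_true => t Dt; apply: FK; exact: bv.
have H := prim_integral (F_meas mv bv) bF.
apply: prim_ext (primD (prim_cst 0 p2 (r + Cintegral `[0, p2] (fun t => F t (v t)))) (primN H)).
  by move=> x _; rewrite /picard_step addrA.
by apply: ae_true => x _; rewrite opprK add0r.
Qed.

Lemma picard_step0 v : picard_step v 0 = r.
Proof. by rewrite /picard_step subrr addr0. Qed.

Lemma admissible_step v : admissible v -> admissible (picard_step v).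
Proof.
move=> gv; have H := prim_picard gv; split.
  exact: lipschitz_cmeas (p2_ge0 R) H.1.
move=> x; rewrite /= in_itv/= => /andP[x0 xp].
have h : cabs (picard_step v x - picard_step v 0) <= K * (x - 0).
  apply: (prim_bound x0 (prim_restrict (lexx 0) xp H) K0).
  apply: ae_true => t /andP[t0 tx]; apply: FK; apply: gv.2.
  by rewrite /= in_itv/= ltW//= (le_trans (ltW tx)).
rewrite picard_step0 subr0 in h.
rewrite -[picard_step v x](subrK r); apply: le_trans (cabsD _ _) _.
have : K * x <= K * p2 by rewrite ler_wpM2l.
move: r_small K_small; rewrite [p2 * K]mulrC; lra.
Qed.

Lemma picard_contract v w e : admissible v -> admissible w -> 0 <= e ->
  (forall t, D t -> cabs (v t - w t) <= e) ->
  forall x, D x -> cabs (picard_step v x - picard_step w x) <= e / 2.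
Proof.
move=> gv gw e0 vw x; rewrite /= in_itv/= => /andP[x0 xp].
have H := primB (prim_picard gv) (prim_picard gw).
have Le0 : 0 <= L * e by rewrite mulr_ge0.
have : cabs ((picard_step v x - picard_step w x) - (picard_step v 0 - picard_step w 0))
    <= L * e * (x - 0).
  apply: (prim_bound x0 (prim_restrict (lexx 0) xp H) Le0).
  apply: ae_true => t /andP[t0 tx].
  have Dt : D t by rewrite /= in_itv/= ltW//= (le_trans (ltW tx)).
  apply: le_trans (FL _ (gv.2 _ Dt) (gw.2 _ Dt)) _.
  by rewrite ler_wpM2l// vw.
rewrite !picard_step0 subrr !subr0 => h; apply: le_trans h _.
have h : L * e * x <= L * e * p2 by rewrite ler_wpM2l.
apply: le_trans h _; have -> : L * e * p2 = e * (p2 * L) by ring.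
by apply: le_trans (ler_wpM2l e0 L_small) _; rewrite div1r.
Qed.

Fixpoint picard_seq (n : nat) : R -> C :=
  if n is n'.+1 then picard_step (picard_seq n') else fun=> r.

Lemma admissible_seq n : admissible (picard_seq n).
Proof.
elim: n => [|n IH]; last exact: admissible_step.
split; first exact: cmeas_cst.
by move=> t _; move: r_small rho0; rewrite /=; lra.
Qed.

Lemma picard_seq_dist n x : D x ->
  cabs (picard_seq n.+1 x - picard_seq n x) <= 2 * rho * (1 / 2) ^+ n.
Proof.
elim: n x => [|n IH] x Dx.
  rewrite expr0 mulr1; apply: le_trans (cabsB _ _) _.
  have := (admissible_seq 1).2 _ Dx; have := (admissible_seq 0).2 _ Dx; lra.
have e0 : 0 <= 2 * rho * (1 / 2) ^+ n by exact: geo0.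
have := picard_contract (admissible_seq n.+1) (admissible_seq n) e0 IH Dx.
by have -> : 2 * rho * (1 / 2) ^+ n / 2 = 2 * rho * (1 / 2) ^+ n.+1 by rewrite exprSr div1r mulrA.
Qed.

Let picard_increment x (n : nat) : C^o := picard_seq n.+1 x - picard_seq n x.

Definition picard_lim (x : R) : C := r + (limn (series (picard_increment x)) : C^o).

Lemma picard_seqE n x : picard_seq n x = r + series (picard_increment x) n.
Proof.
rewrite /series /=; elim: n => [|n IH]; first by rewrite big_geq// addr0.
by rewrite big_nat_recr//= addrA -IH /picard_increment addrC subrK.
Qed.

Lemma picard_cvg x : D x -> (picard_seq n x : C^o) @[n --> \oo] --> (picard_lim x : C^o).
Proof.
move=> Dx; under eq_cvg do rewrite picard_seqE.
apply: cvgD; first exact: cvg_cst.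
apply: (@series_geo_cvg _ _ (1/2) (2 * rho)); first by apply/andP; split; lra.
by move=> n; exact: picard_seq_dist.
Qed.

Lemma picard_dist n x : D x -> cabs (picard_lim x - picard_seq n x) <= 4 * rho * (1 / 2) ^+ n.
Proof.
move=> Dx; rewrite picard_seqE /picard_lim opprD addrACA subrr add0r.
have hq : 0 <= (1 / 2 : R) <= 1 / 2 by apply/andP; split; lra.
have h i : cabs (picard_increment x i) <= 2 * rho * (1 / 2) ^+ i by exact: picard_seq_dist.
have := @series_tail_bound _ _ _ _ _ n hq h (series_geo_cvg hq h).
rewrite /series /= big_mkord => h2; apply: le_trans h2 _; lra.
Qed.

Lemma admissible_lim : admissible picard_lim.
Proof.
split; first by apply: (@cmeas_lim _ _ picard_seq) => [n|t Dt];
  [exact: (admissible_seq n).1|exact: picard_cvg].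
move=> t Dt; apply: (lim_cabs_le _ (picard_cvg Dt)).
by apply: nearW => n; exact: (admissible_seq n).2.
Qed.

Lemma picard_fix x : D x -> picard_step picard_lim x = picard_lim x.
Proof.
move=> Dx; apply/eqP; rewrite -subr_eq0; apply/eqP; apply: cabs0_eq0.
have H n : cabs (picard_step picard_lim x - picard_lim x) <= 4 * rho * (1 / 2) ^+ n.
  apply: le_trans (cabs_distD (picard_seq n.+1 x) _ _) _.
  have e0 : 0 <= 4 * rho * (1 / 2) ^+ n by exact: geo0.
  have h1 := picard_contract admissible_lim (admissible_seq n) e0 (picard_dist n) Dx.
  have h2 := picard_dist n.+1 Dx; rewrite cabs_distC exprSr in h2.
  apply: le_trans (lerD h1 h2) _; rewrite mulrA; lra.
apply/ler_addgt0Pr => e e0; rewrite add0r.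
have hl : (4 * rho * (1 / 2) ^+ n) @[n --> \oo] --> (4 * rho * 0 : R).
  by apply: cvgM; [exact: cvg_cst|apply: cvg_expr; rewrite ger0_norm//; lra].
move/cvgrPdist_le : hl => /(_ _ e0)[N _ /(_ N (leqnn N))] /=.
rewrite mulr0 sub0r normrN ger0_norm; first exact: le_trans.
exact: geo0.
Qed.

(** The smallness hypotheses let one step halve the distance of two admissible
    functions on the whole interval, so that it need not be subdivided. *)
Lemma picard_solution : exists v : R -> C, [/\ v 0 = r,
  is_primitive 0 p2 v (fun t => F t (v t)) & forall t, 0 <= t <= p2 -> cabs (v t) <= rho].
Proof.
exists picard_lim; split.
- by rewrite -picard_fix ?picard_step0//= in_itv/= lexx p2_ge0.
- apply: prim_ext (prim_picard admissible_lim); last exact: ae_true.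
  by move=> x hx; rewrite picard_fix//= in_itv.
- by move=> t ht; apply: admissible_lim.2; rewrite /= in_itv.
Qed.

End Picard.

(** * The first return map is the first return series *)

Section PowerField.
Variable R : realType.
Local Notation C := R[i].

(** The value at [z] of the field with coefficients [c]; the coefficient
    [c i] is that of [z ^ (i + 2)]. *)
Definition field_sum (c : nat -> C) (z : C) : C :=
  (limn (series (fun i => c i * z ^+ i.+2 : C^o)) : C^o).

Variables (l rho : R) (c : nat -> C).
Hypothesis l0 : 0 < l.
Hypothesis rho0 : 0 < rho.
Hypothesis lrho : l * rho <= 1 / 8.
Hypothesis cl : forall i, cabs (c i) <= l ^+ i.+1.

Let hq : 0 <= l * rho <= 1 / 2.
Proof.
apply/andP; split; first by rewrite mulr_ge0// ltW.
by apply: le_trans lrho _; lra.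
Qed.

Lemma field_sum_term z i : cabs z <= rho -> cabs (c i * z ^+ i.+2) <= l * rho ^+ 2 * (l * rho) ^+ i.
Proof.
move=> zr; rewrite cabsM cabsX.
have h : cabs z ^+ i.+2 <= rho ^+ i.+2.
  by rewrite lerXn2r// nnegrE ?cabs_ge0// ltW.
apply: le_trans (ler_pM (cabs_ge0 _) _ (cl i) h) _; first by rewrite exprn_ge0// cabs_ge0.
rewrite le_eqVlt; apply/orP; left; apply/eqP.
by rewrite exprMn !exprS; ring.
Qed.

Lemma field_sum_cvg z : cabs z <= rho ->
  series (fun i => c i * z ^+ i.+2 : C^o) @ \oo --> (field_sum c z : C^o).
Proof. by move=> zr; apply: (series_geo_cvg hq) => i; exact: field_sum_term. Qed.

Lemma field_sum_tail z M : cabs z <= rho ->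
  cabs (field_sum c z - \sum_(i < M) c i * z ^+ i.+2) <= 2 * (l * rho ^+ 2) * (l * rho) ^+ M.
Proof.
by move=> zr; apply: (series_tail_bound M hq _ (field_sum_cvg zr)) => i; exact: field_sum_term.
Qed.

Lemma field_sum_bound z : cabs z <= rho -> cabs (field_sum c z) <= 2 * (l * rho ^+ 2).
Proof.
move=> zr; have := field_sum_tail 0 zr.
by rewrite big_ord0 subr0 expr0 mulr1.
Qed.

Lemma field_sum_lip z y : cabs z <= rho -> cabs y <= rho ->
  cabs (field_sum c z - field_sum c y) <= 4 * (l * rho) * cabs (z - y).
Proof.
move=> zr yr.
have hq2 : 0 <= 2 * (l * rho) <= 1 / 2.
  by case/andP: hq => h _; move: lrho; rewrite mulr_ge0//=; lra.
have cv := cvgB (field_sum_cvg zr) (field_sum_cvg yr).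
have e : series (fun i => c i * z ^+ i.+2 : C^o) - series (fun i => c i * y ^+ i.+2 : C^o) =
  series (fun i => c i * z ^+ i.+2 - c i * y ^+ i.+2 : C^o).
  by apply/funext => n; rewrite /series /= sumrB.
have cv' : series (fun i => c i * z ^+ i.+2 - c i * y ^+ i.+2 : C^o) @ \oo -->
   (field_sum c z - field_sum c y : C^o) by rewrite -e; exact: cv.
have tb i : cabs (c i * z ^+ i.+2 - c i * y ^+ i.+2) <=
    2 * (l * rho) * cabs (z - y) * (2 * (l * rho)) ^+ i.
  rewrite -mulrBr cabsM.
  have h := cabs_sub_exp i.+1 zr yr.
  apply: le_trans (ler_pM (cabs_ge0 _) (cabs_ge0 _) (cl i) h) _.
  have h2 : i.+2%:R <= 2 ^+ i.+1 :> R by rewrite -natrX ler_nat ltn_expl.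
  rewrite [leRHS](_ : _ = l ^+ i.+1 * (2 ^+ i.+1 * rho ^+ i.+1 * cabs (z - y))); last first.
    by rewrite !exprMn !exprS; ring.
  rewrite ler_pM2l ?exprn_gt0// ler_wpM2r ?cabs_ge0// ler_wpM2r//.
  by rewrite exprn_ge0// ltW.
apply: le_trans (series_bound hq2 tb cv') _.
by rewrite !mulrA -natrM.
Qed.

End PowerField.

Section FirstReturn.
Variable R : realType.
Local Notation C := R[i].
Local Notation mu := (@lebesgue_measure R).
Local Notation p2 := (2 * pi : R).
Local Notation D := (`[0, 2 * pi : R]%classic).
Implicit Types (a : X R).

Definition vector_field a t z : C := field_sum (fun i => coeff a i t) z.

Lemma solution_prim a r v : is_solution a r v -> [/\ v 0 = r,
  is_primitive 0 p2 v (fun t => vector_field a t (v t)) &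
  {ae mu, forall x, 0 < x < p2 -> series (fun i => coeff a i x * v x ^+ i.+2 : C^o) @ \oo
    --> (vector_field a x (v x) : C^o)}].
Proof.
move=> [v0 [k Hk] hv].
have hlim x (L : C^o) : series (fun i => coeff a i x * v x ^+ i.+2 : C^o) @ \oo --> L ->
    vector_field a x (v x) = L by move=> h; exact: (cvg_lim (@norm_hausdorff _ C^o) h).
split => //.
  split; first by exists k => x y hx hy; rewrite -cabs_le; apply: Hk; rewrite in_itv.
  apply: ae_imp hv => x hx x0p; have [L h1 h2] := hx (ltac:(by rewrite in_itv)).
  by rewrite (hlim _ _ h1).
apply: ae_imp hv => x hx x0p; have [L h1 h2] := hx (ltac:(by rewrite in_itv)).
by rewrite (hlim _ _ h1).
Qed.

Section Small.
Variables (a : X R) (l : R).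
Hypothesis l0 : 0 < l.
Hypothesis al : forall i, {ae mu, forall t, cabs (coeff a i t) <= l ^+ i.+1}.

(* The radius of a disc that solutions starting in the disc of half the radius
   do not leave. The factor 1 + 2 pi makes the field contract on an interval of
   length 2 pi, and makes the powers (2 l (1 + 2 pi) rho) ^ n in the bound of
   the flow equal to 8 ^ - n. *)
Let rho := (16 * l * (1 + p2))^-1.

Let p2_ge4 : 4 <= p2.
Proof. by have := pi_ge2 R; lra. Qed.

Let rho0 : 0 < rho.
Proof. by rewrite invr_gt0 !mulr_gt0//; have := p2_gt0 R; lra. Qed.

Let lrho16 : 16 * (l * rho) * (1 + p2) = 1.
Proof.
have h : 16 * l * (1 + p2) != 0.
  by rewrite gt_eqF// !mulr_gt0//; have := p2_gt0 R; lra.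
have -> : 16 * (l * rho) * (1 + p2) = 16 * l * (1 + p2) * rho by ring.
by rewrite divff.
Qed.

Let lrho0 : 0 < l * rho. Proof. by rewrite mulr_gt0. Qed.

Let lrho80 : l * rho <= 1 / 80.
Proof. by move: lrho16 lrho0 p2_ge4; nra. Qed.

Let lrhop : l * rho * p2 <= 1 / 16.
Proof. by move: lrho16 lrho0 p2_ge4; nra. Qed.

Let lrho8 : l * rho <= 1 / 8. Proof. by move: lrho80; lra. Qed.

(** As long as a solution stays in the disc of radius [rho] its derivative is
    at most [2 l rho ^ 2]; until time [2 pi] it moves by at most [rho / 8] and
    cannot reach the boundary when it starts in the disc of half the radius. In
    particular uniqueness concerns arbitrary solutions, not only small ones. *)
Lemma solution_small r v : is_solution a r v -> cabs r <= rho / 2 ->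
  forall x, 0 <= x <= p2 -> cabs (v x) < rho.
Proof.
move=> /solution_prim[v0 hv _] rr.
have [[k Hk] _] := hv.
apply: real_induction.
- by rewrite v0; move: rr rho0; lra.
- move=> x /andP[x0 xp] Px.
  have vx : cabs (v x) < rho by apply: Px; rewrite x0 lexx.
  have k0 : 0 < `|k| + 1 by rewrite ltr_wpDl.
  exists ((rho - cabs (v x)) / (`|k| + 1)); first by rewrite divr_gt0// subr_gt0.
  move=> y /andP[xy yd] yp.
  rewrite -[v y](subrK (v x)); apply: le_lt_trans (cabsD _ _) _.
  rewrite -ltrBrDr; apply: le_lt_trans (Hk _ _ _ _) _.
  + by rewrite yp (le_trans x0 (ltW xy)).
  + by rewrite x0 ltW.
  rewrite -ltrBlDl ltr_pdivlMr// in yd; rewrite gtr0_norm ?subr_gt0//.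
  apply: le_lt_trans yd; rewrite mulrC ler_pM2l ?subr_gt0//.
  by rewrite (le_trans (ler_norm _))// lerDl.
- move=> x /andP[x0 xp] Px.
  have h0 : 0 <= 2 * (l * rho ^+ 2) by rewrite !mulr_ge0// ?exprn_ge0// ltW.
  have : cabs (v x - v 0) <= 2 * (l * rho ^+ 2) * (x - 0).
    apply: (prim_bound (ltW x0) (prim_restrict (lexx 0) xp hv) h0).
    apply: ae_imp (ae_all al) => t ht /andP[t0 tx].
    apply: (field_sum_bound l0 rho0 lrho8 ht); apply: ltW; apply: Px.
    by rewrite ltW.
  rewrite v0 subr0 => h.
  rewrite -[v x](subrK r); apply: le_lt_trans (cabsD _ _) _.
  have h1 : 2 * (l * rho ^+ 2) * x <= 2 * (l * rho ^+ 2) * p2 by rewrite ler_wpM2l.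
  have h2 : 2 * (l * rho ^+ 2) * p2 = 2 * rho * (l * rho * p2) by ring.
  have h3 : 2 * rho * (l * rho * p2) <= 2 * rho * (1 / 16).
    by rewrite ler_wpM2l// mulr_ge0// ltW.
  by move: rho0; lra.
Qed.

(** The derivative along a solution of the flow truncated to degree [N]. With
    [E] the flow coefficients, [c] the coefficients of the field, [v] the
    solution and [f] its derivative, the transport equation cancels everything
    but the terms of degree larger than [N]. *)
Lemma flow_derivative (A : comNzRingType) (E c : nat -> A) (v f : A) N :
  \sum_(n < N.+1) ((if (n : nat) is k.+1 then - \sum_(i < k.+1) (k - i + 1)%:R * (c i * E (k - i)%N)
     else 0 : A) * v ^+ n.+1 + E n * (n.+1%:R * v ^+ n * f)) =
  \sum_(k < N.+1) k.+1%:R * E k * v ^+ k * (f - \sum_(i < N - k) c i * v ^+ i.+2).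
Proof.
elim: N => [|N IH].
  by rewrite !big_ord1 big_ord0 subr0 mul0r add0r; ring.
rewrite big_ord_recr IH /= [RHS]big_ord_recr /= subnn big_ord0 subr0.
have -> : \sum_(k < N.+1) k.+1%:R * E k * v ^+ k * (f - \sum_(i < N.+1 - k) c i * v ^+ i.+2) =
  \sum_(k < N.+1) k.+1%:R * E k * v ^+ k * (f - \sum_(i < N - k) c i * v ^+ i.+2) -
  \sum_(k < N.+1) k.+1%:R * E k * c (N - k)%N * v ^+ N.+2.
  rewrite -sumrB; apply: eq_bigr => k _; have kN : (k <= N)%N by rewrite -ltnS.
  rewrite subSn// big_ord_recr /= (_ : N.+2 = k + (N - k).+2)%N; last by lia.
  by rewrite exprD; ring.
rewrite -addrA; congr (_ + _).
congr (_ + _); last by ring.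
rewrite mulNr; congr (- _); rewrite mulr_suml (sum_ord_rev N (fun k =>
  k.+1%:R * E k * c (N - k)%N * v ^+ N.+2)); apply: eq_bigr => i _.
have iN : (i <= N)%N by rewrite -ltnS.
by rewrite subKn// addn1; ring.
Qed.

Let B := 2 * l * (1 + p2).

Let Brho : B * rho = 1 / 8.
Proof. by rewrite /B; move: lrho16; lra. Qed.

(** The truncated flow [g], evaluated along the solution, goes from a partial
    sum of the return series at [0] to [v (2 pi)] at [2 pi]; its derivative is
    of order [2 ^ - N] by [flow_derivative]. *)
Lemma return_series r v : is_solution a r v -> cabs r <= rho / 2 ->
  pseries_at (return_coef (fun w => basic_int w a)) r @ \oo --> (v p2 : C^o).
Proof.
move=> sv rr; have vs := solution_small sv rr.
have [v0 hv _] := solution_prim sv.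
have K : forall N, cabs (v p2 - \sum_(n < N.+1) flow_at a 1 n 0 * r ^+ n.+1) <=
    ((1 + p2) * (2 * (l * rho ^+ 2)) * p2) * (1 / 2) ^+ N.
  move=> N; pose g t := \sum_(n < N.+1) flow_at a 1 n t * v t ^+ n.+1.
  have -> : v p2 = g p2.
    rewrite /g big_ord_recl flow_at0 mul1r expr1 big1 ?addr0// => i _.
    by rewrite flow_at_end mul0r.
  have -> : \sum_(n < N.+1) flow_at a 1 n 0 * r ^+ n.+1 = g 0.
    by apply: eq_bigr => n _; rewrite v0.
  have hg : is_primitive 0 p2 g (fun t => \sum_(n < N.+1)
     (dflow_at a 1 n t * v t ^+ n.+1 + flow_at a 1 n t * (n.+1%:R * v t ^+ n * vector_field a t (v t)))).
    by apply: prim_sum_ord => n; apply: primM; [exact: prim_flow_at|exact: primX].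
  set M := (1 + p2) * (2 * (l * rho ^+ 2)) * (1 / 2) ^+ N.
  have M0 : 0 <= M.
    rewrite !mulr_ge0 ?exprn_ge0 ?divr_ge0 ?(ltW rho0) ?(ltW l0)//.
    by move: p2_ge4; lra.
  rewrite [leRHS](_ : _ = M * (p2 - 0)); last by rewrite /M; ring.
  apply: (prim_bound (p2_ge0 R) hg M0).
  apply: ae_imp (ae_all al) => t ht /andP[t0 tp].
  have tD : 0 <= t <= p2 by rewrite !ltW.
  have vt : cabs (v t) <= rho by rewrite ltW// vs.
  rewrite (flow_derivative (fun n => flow_at a 1 n t) (fun i => coeff a i t)).
  apply: le_trans (cabs_sum _ _ _) _.
  apply: (@le_trans _ _ (\sum_(k < N.+1) (N.+1)%:R * ((1 + p2) * (2 * (l * rho ^+ 2)) * (1 / 8) ^+ N))).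
    apply: ler_sum => k _; have kN : (k <= N)%N by rewrite -ltnS.
    rewrite !cabsM cabs_nat cabsX.
    have b1 : cabs (flow_at a 1 k t) <= B ^+ k * (1 + p2).
      apply: le_trans (flow_at_bound 1 k (ltW l0) al tD) _.
      have -> : B ^+ k * (1 + p2) = (2 * l) ^+ k * (1 + p2) ^+ (k + 1).
        by rewrite /B [in LHS]exprMn addn1 exprSr mulrA.
      apply: ler_wpM2l; first by rewrite exprn_ge0// mulr_ge0// ltW.
      apply: lerXn2r; rewrite ?nnegrE; lra.
    have b2 : cabs (v t) ^+ k <= rho ^+ k by rewrite lerXn2r// nnegrE ?cabs_ge0// ltW.
    have b3 := field_sum_tail l0 rho0 lrho8 ht (N - k) vt.
    have b4 : (l * rho) ^+ (N - k) <= (1 / 8) ^+ (N - k).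
      apply: lerXn2r => //; rewrite nnegrE; first exact: ltW lrho0.
      by rewrite divr_ge0.
    have b5 : (1 / 8 : R) ^+ N = (B ^+ k * rho ^+ k) * (1 / 8) ^+ (N - k).
      by rewrite -exprMn Brho -exprD subnKC.
    have b6 : k.+1%:R <= N.+1%:R :> R by rewrite ler_nat.
    have b7 : cabs (vector_field a t (v t) - \sum_(i < N - k) coeff a i t * v t ^+ i.+2) <=
       2 * (l * rho ^+ 2) * (1 / 8) ^+ (N - k).
      apply: le_trans b3 _; apply: ler_wpM2l => //.
      by rewrite !mulr_ge0 ?exprn_ge0 ?(ltW rho0) ?(ltW l0).
    rewrite b5 -!mulrA; apply: ler_pM => //; first by rewrite !mulr_ge0 ?exprn_ge0 ?cabs_ge0.
    rewrite !mulrA [X in _ <= X](_ : _ = B ^+ k * (1 + p2) * rho ^+ k *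
       (2 * (l * rho ^+ 2) * (1 / 8) ^+ (N - k))); last by ring.
    apply: ler_pM => //; rewrite ?mulr_ge0 ?exprn_ge0 ?cabs_ge0//.
    by apply: ler_pM => //; rewrite ?exprn_ge0 ?cabs_ge0.
  rewrite sumr_const card_ord -[leLHS]mulr_natl /M.
  set Q := (1 + p2) * (2 * (l * rho ^+ 2)).
  have Q0 : 0 <= Q.
    rewrite !mulr_ge0 ?exprn_ge0 ?(ltW rho0) ?(ltW l0)//.
    by move: p2_ge4; lra.
  have -> : N.+1%:R * (N.+1%:R * (Q * (1 / 8) ^+ N)) = Q * (N.+1%:R * N.+1%:R * (1 / 8) ^+ N) by ring.
  rewrite ler_wpM2l//.
  (* One factor N + 1 is the number of terms, the other comes from d/dz. *)
  have n2 : N.+1%:R <= 2 ^+ N :> R by rewrite -natrX ler_nat ltn_expl.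
  have -> : (1 / 2 : R) ^+ N = (2 ^+ N * 2 ^+ N) * (1 / 8) ^+ N.
    by rewrite -!exprMn; congr (_ ^+ _); field.
  rewrite ler_wpM2r ?exprn_ge0 ?divr_ge0//.
  by apply: ler_pM.
apply/cvg_cabsP => e e0.
set Q := (1 + p2) * _ * _ in K.
have hl : (Q * (1 / 2) ^+ n) @[n --> \oo] --> (Q * 0 : R).
  by apply: cvgM; [exact: cvg_cst|apply: cvg_expr; rewrite ger0_norm//; lra].
move/cvgrPdist_le : hl => /(_ _ e0)[N _ HN].
exists N.+2 => // -[|[|n]]//= Nn.
rewrite cabs_distC /pseries_at /series /= big_mkord big_ord_recl mul0r add0r.
apply: le_trans (K n) _; have := HN n Nn; rewrite /= mulr0 sub0r normrN.
by apply: le_trans; exact: ler_norm.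
Qed.

(** The coefficients are set to [0] on the null set where one of the
    countably many growth bounds fails, so that the field is defined and
    Lipschitz at all times. *)
Lemma solution_exists r : cabs r <= rho / 2 -> exists v, is_solution a r v.
Proof.
move=> rr; have [B0 [mB B00 HB]] := ae_all al.
pose ct t i : C := (\1_(~` B0) t)%:C * coeff a i t.
have ctl t i : cabs (ct t i) <= l ^+ i.+1.
  rewrite /ct indicE; case: (boolP (t \in ~` B0)) => [|_].
    rewrite inE mul1r => nB; apply: contrapT => h; apply: nB.
    by apply: HB => /= /(_ i).
  by rewrite mul0r cabs0 exprn_ge0// ltW.
pose F t z := field_sum (ct t) z.
have [v [v0 hv vr]] : exists v : R -> C, [/\ v 0 = r,
  is_primitive 0 p2 v (fun t => F t (v t)) & forall t, 0 <= t <= p2 -> cabs (v t) <= rho].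
  apply: (@picard_solution _ F rho (2 * (l * rho ^+ 2)) (4 * (l * rho)) r) => //.
  - by rewrite mulr_ge0// ltW.
  - by move=> t z; exact: (field_sum_bound l0 rho0 lrho8 (ctl t)).
  - by move=> t z y; exact: (field_sum_lip l0 rho0 lrho8 (ctl t)).
  - move=> v mv bv.
    apply: (@cmeas_lim _ _ (fun n t => \sum_(0 <= i < n) ct t i * v t ^+ i.+2)).
      move=> n; apply: cmeas_sum => i; apply: cmeasM; last exact: cmeasX.
      apply: cmeasM; last exact: X_meas.
      split => /=; last exact: measurable_cst.
      by apply: measurable_indic; exact: measurableC.
    by move=> t Dt; exact: (field_sum_cvg l0 rho0 lrho8 (ctl t) (bv _ Dt)).
  - have -> : p2 * (2 * (l * rho ^+ 2)) = 2 * rho * (l * rho * p2) by ring.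
    have : 2 * rho * (l * rho * p2) <= 2 * rho * (1 / 16).
      by rewrite ler_wpM2l// mulr_ge0// ltW.
    by move: rho0; lra.
  - by move: lrhop; lra.
exists v; split => //.
  have [[k Hk] _] := hv; exists k => x y; rewrite !in_itv/= => hx hy.
  by rewrite cabs_le; exact: Hk.
have [_ dv] := hv.
have nB : {ae mu, forall t, ~ B0 t}.
  by exists B0; split => // t /= /contrapT.
apply: ae_imp (ae_and dv nB) => x [hd nBx]; rewrite in_itv/= => hx.
exists (F x (v x)); last exact: hd.
have hxx : 0 <= x <= p2 by case/andP: hx => h1 h2; rewrite !ltW.
have := field_sum_cvg l0 rho0 lrho8 (ctl x) (vr _ hxx).
by under eq_fun do rewrite {1}/ct indicE mem_set// mul1r.
Qed.

End Small.

(** The limit of the return series at [r] is the final value of every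
    solution, which gives uniqueness of that value as well. *)
Theorem first_return_Phat a : is_first_return_map a (Phat (class_of a)).
Proof.
have [l l0 al] := X_bound a; set rho := (16 * l * (1 + p2))^-1.
have rho0 : 0 < rho by rewrite invr_gt0 !mulr_gt0//; have := p2_gt0 R; lra.
apply/nbhs_normP; exists (rho / 2)%:C => /=; first by rewrite ltcR divr_gt0.
move=> r /=; rewrite sub0r normrN => /ltW; rewrite cabs_le => rr.
have [v sv] := solution_exists l0 al rr.
have e : series_coef (Phat (class_of a)) = return_coef (fun w => basic_int w a).
  rewrite series_coef_Phat; congr return_coef; apply/funext => w.
  exact: hat_class_of.
exists (v p2); last by have := return_series l0 al sv rr; rewrite -e.
split; first by exists v.
move=> v' sv'; exact: (cvg_unique (@norm_hausdorff _ C^o)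
  (return_series l0 al sv' rr) (return_series l0 al sv rr)).
Qed.

End FirstReturn.

(** * Surjectivity *)

Section Surjectivity.
Variable R : realType.
Local Notation C := R[i].
Local Notation mu := (@lebesgue_measure R).
Local Notation p2 := (2 * pi : R).

Lemma circ_itv (t : R) : 0 < circ t <= p2.
Proof.
have p0 := p2_gt0 R; rewrite /circ; set x := t / p2.
have e : t = x * p2 by rewrite /x divfK// gt_eqF.
have h1 : (Num.ceil x - 1)%:~R < x by exact: ceilB1_lt.
have h2 : x <= (Num.ceil x)%:~R by exact: ceil_ge.
rewrite {1 2}e -mulrBl; apply/andP; split; first by rewrite mulr_gt0// subr_gt0.
rewrite -[leRHS]mul1r ler_pM2r//.
by rewrite rmorphB/= lerBlDr addrC subrK.
Qed.

(** The transport equation for the flow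
    [F_s(z) = z + tau (f(z) - z)], [tau = 1 - s / (2 pi)], solved for the
    coefficients of the field: the difference quotient
    [(f(z) - z) / (2 pi)] is divided by [d/dz F_s]. The argument [k] bounds
    the depth of the recursion; any [k > n] gives the same value. *)
Fixpoint lift_coef (c : nat -> C) (tau : R) (k n : nat) : C :=
  if k is k'.+1 then c n.+2 * (p2^-1)%:C -
    \sum_(i < n) (n - i + 1)%:R * (lift_coef c tau k' i * (tau%:C * c (n - i).+1))
  else 0.

Lemma lift_coefS c tau k n : lift_coef c tau k.+1 n = c n.+2 * (p2^-1)%:C -
    \sum_(i < n) (n - i + 1)%:R * (lift_coef c tau k i * (tau%:C * c (n - i).+1)).
Proof. by []. Qed.
Arguments lift_coef : simpl never.

Lemma lift_coefE c tau k n : (n < k)%N -> lift_coef c tau k n = lift_coef c tau n.+1 n.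
Proof.
elim/ltn_ind: n k => n IH [//|k]; rewrite ltnS => nk; rewrite !lift_coefS; congr (_ - _).
apply: eq_bigr => i _; congr (_ * (_ * _)).
by rewrite IH// ?(leq_trans (ltn_ord i))// [RHS]IH.
Qed.

(** The coefficient of [z ^ (n + 2)] in the transport equation. *)
Lemma lift_coef_rec c tau n : c 1%N = 1 ->
  \sum_(i < n.+1) (n - i + 1)%:R * (lift_coef c tau i.+1 i *
     (if (n - i)%N is k.+1 then tau%:C * c k.+2 else 1)) = c n.+2 * (p2^-1)%:C.
Proof.
move=> c1; rewrite big_ord_recr /= subnn mulr1 mul1r lift_coefS.
rewrite addrC -[RHS](subrK (\sum_(i < n) (n - i + 1)%:R *
  (lift_coef c tau n i * (tau%:C * c (n - i).+1)))).
congr (_ + _); apply: eq_bigr => i _; have := ltn_ord i.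
rewrite -subn_gt0 => hi; rewrite -(@lift_coefE c tau n i)//.
by case: (n - i)%N hi.
Qed.

(** With [b = 2 M], the term of index [i] of the recursion is at most
    [b ^ (2 n + 2) * 2 ^ (i + 1)], and the powers of [2] add up to less than
    [2 ^ (n + 1)]. *)
Lemma lift_coef_bound c (M tau : R) k n : 1 <= M -> (forall j, cabs (c j) <= M ^+ j) ->
  0 <= tau <= 1 -> cabs (lift_coef c tau k n) <= (2 * (2 * M) ^+ 2) ^+ n.+1.
Proof.
move=> M1 cM /andP[tau0 tau1].
pose b := 2 * M; have b1 : 1 <= b by rewrite /b; lra.
have b0 : 0 <= b by lra.
have A0 : 0 <= 2 * b ^+ 2 by rewrite mulr_ge0// exprn_ge0.
elim: k n => [|k IH] n; first by rewrite cabs0 exprn_ge0.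
rewrite lift_coefS.
have h1 : cabs (c n.+2 * (p2^-1)%:C) <= b ^+ (2 * n.+1).
  rewrite cabsM cabs_real ger0_norm ?invr_ge0 ?p2_ge0//.
  have p1 : p2^-1 <= 1 by rewrite invf_le1 ?p2_gt0//; have := pi_ge2 R; lra.
  apply: le_trans (ler_pM (cabs_ge0 _) _ (cM _) p1) _; first by rewrite invr_ge0 p2_ge0.
  rewrite mulr1; apply: (@le_trans _ _ (b ^+ n.+2)).
    by apply: lerXn2r; rewrite ?nnegrE/b; lra.
  by apply: ler_weXn2l => //; clear; lia.
have h2 (i : 'I_n) : cabs ((n - i + 1)%:R * (lift_coef c tau k i * (tau%:C * c (n - i).+1)))
   <= b ^+ (2 * n.+1) * 2 ^+ i.+1.
  have ni := ltn_ord i.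
  rewrite !cabsM cabs_nat cabs_real ger0_norm//.
  have g1 : tau * cabs (c (n - i).+1) <= M ^+ (n - i).+1.
    rewrite -[leRHS]mul1r; apply: ler_pM => //; exact: cabs_ge0.
  have g2 : (n - i + 1)%:R <= 2 ^+ (n - i).+1 :> R.
    by rewrite addn1 -natrX ler_nat ltnW// ltn_expl.
  have g3 : cabs (lift_coef c tau k i) * (tau * cabs (c (n - i).+1)) <=
      (2 * b ^+ 2) ^+ i.+1 * M ^+ (n - i).+1.
    by apply: ler_pM => //; rewrite ?mulr_ge0 ?cabs_ge0.
  apply: le_trans (ler_pM _ _ g2 g3) _ => //; first by rewrite !mulr_ge0 ?cabs_ge0.
  have -> : 2 ^+ (n - i).+1 * ((2 * b ^+ 2) ^+ i.+1 * M ^+ (n - i).+1) =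
     b ^+ (i.+1 + i.+1 + (n - i).+1) * 2 ^+ i.+1.
    have e1 : (2 * b ^+ 2) ^+ i.+1 = 2 ^+ i.+1 * (b ^+ i.+1 * b ^+ i.+1).
      by rewrite exprMn [b ^+ 2]expr2 exprMn.
    have e2 : b ^+ (n - i).+1 = 2 ^+ (n - i).+1 * M ^+ (n - i).+1 by rewrite -exprMn.
    by rewrite e1 !exprD e2; ring.
  apply: ler_wpM2r; first by rewrite exprn_ge0.
  by apply: ler_weXn2l => //; move: ni; clear; lia.
apply: le_trans (cabsB _ _) _.
have h3 : cabs (\sum_(i < n) (n - i + 1)%:R * (lift_coef c tau k i * (tau%:C * c (n - i).+1)))
    <= \sum_(i < n) b ^+ (2 * n.+1) * 2 ^+ i.+1.
  by apply: le_trans (cabs_sum _ _ _) _; apply: ler_sum => i _; exact: h2.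
apply: le_trans (lerD h1 h3) _; rewrite -/b -mulr_sumr.
have -> : \sum_(i < n) (2 : R) ^+ i.+1 = 2 ^+ n.+1 - 2.
  elim: (n) => [|m IHm]; first by rewrite big_ord0 expr1 subrr.
  by rewrite big_ord_recr IHm /= [in RHS]exprS; ring.
have -> : (2 * b ^+ 2) ^+ n.+1 = 2 ^+ n.+1 * b ^+ (2 * n.+1) by rewrite [LHS]exprMn -exprM.
have := exprn_ge0 (2 * n.+1) b0; lra.
Qed.

Lemma cmeas_lift_coef c (A : set R) (tau : R -> R) k n : measurable_fun A tau ->
  cmeas A (fun t => lift_coef c (tau t) k n).
Proof.
move=> mt; elim: k n => [|k IH] n; first exact: cmeas_cst.
under eq_fun do rewrite lift_coefS.
apply: cmeasD; first exact: cmeas_cst.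
have H : cmeas A (fun t => -1 * \sum_(i < n) (n - i + 1)%:R *
    (lift_coef c (tau t) k i * ((tau t)%:C * c (n - i).+1))).
  apply: cmeasM; first exact: cmeas_cst.
  apply: cmeas_sum => i; apply: cmeasM; first exact: cmeas_cst.
  apply: cmeasM => //; apply: cmeasM; last exact: cmeas_cst.
  by split => //=; exact: measurable_cst.
by move: H; under eq_fun do rewrite mulN1r.
Qed.

Definition remaining_time (t : R) : R := 1 - circ t / p2.

Lemma in_X_lift (c : nat -> C) : in_Gc c -> in_X (fun i t => lift_coef c (remaining_time t) i.+1 i).
Proof.
move=> Gc_c.
have mtau : measurable_fun setT remaining_time.
  apply: measurable_funB => //; apply: measurable_funM => //; exact: measurable_circ.
split.
- by move=> i; have [] := cmeas_lift_coef c i.+1 i mtau.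
- by move=> i; have [] := cmeas_lift_coef c i.+1 i mtau.
- by move=> i t; rewrite /remaining_time circ_periodic.
- have [M M1 cM] := in_Gc_growth Gc_c.
  exists (2 * (2 * M) ^+ 2); first by rewrite mulr_gt0// exprn_gt0//; lra.
  move=> i; apply: ae_true => t; rewrite cabs_le.
  apply: lift_coef_bound => //; first by move=> j; rewrite -cabs_le.
  have p0 := p2_gt0 R; have /andP[h1 h2] := circ_itv t.
  have h3 : 0 <= circ t / p2 <= 1.
    apply/andP; split; first by apply: divr_ge0; exact: ltW.
    by rewrite ler_pdivrMr// mul1r.
  by rewrite /remaining_time; lra.
Qed.

Definition liftX (f : Gc R) : X R := exist _ _ (in_X_lift (svalP f)).

Lemma coeff_lift (f : Gc R) i t :
  coeff (liftX f) i t = lift_coef (series_coef f) (remaining_time t) i.+1 i.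
Proof. by []. Qed.

(** The prescribed flow satisfies the transport equation by construction, and
    its solution is unique. *)
Lemma flow_at_lift (f : Gc R) n s : 0 <= s <= p2 ->
  flow_at (liftX f) 1 n s =
  if n is k.+1 then (1 - s / p2)%:C * series_coef f k.+2 else 1.
Proof.
have p0 := p2_gt0 R.
have c1 : series_coef f 1 = 1 by exact: in_Gc1 (svalP f).
elim/ltn_ind: n s => -[|n] IH s hs; first exact: flow_at0.
set c := series_coef f in IH *.
have H1 := prim_flow_at (liftX f) 1 n.+1.
have H2 : is_primitive 0 p2 (fun t => (1 - t / p2)%:C * c n.+2) (fun=> - (c n.+2 * (p2^-1)%:C)).
  apply: prim_ext (primD (prim_cst 0 p2 (c n.+2)) (prim_linear 0 p2 (- (c n.+2 * (p2^-1)%:C)))).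
    by move=> x _; rewrite rmorphB rmorphM /=; ring.
  by apply: ae_true => x _; rewrite add0r.
apply: (prim_unique H1 H2 _ _ hs); last by rewrite flow_at_end divff ?gt_eqF// subrr mul0r.
apply: ae_true => x /andP[x0 xp] /=; congr (- _).
rewrite -(lift_coef_rec (1 - x / p2) n c1); apply: eq_bigr => i _.
by rewrite /coeff /= /remaining_time circ_id ?x0 ?ltW// IH ?ltnS ?leq_subr ?ltW.
Qed.

Theorem Phat_surjective (f : Gc R) : Phat (class_of (liftX f)) = f.
Proof.
apply: Gc_ext => n.
rewrite series_coef_Phat.
have -> : return_coef (fun w => hat_int w (class_of (liftX f))) n =
   return_coef (fun w => basic_int w (liftX f)) n.
  by congr return_coef; apply/funext => w; exact: hat_class_of.
case: n => [|n] /=; first exact (esym (in_Gc0 (svalP f))).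
have h0 : 0 <= (0 : R) <= p2 by rewrite lexx p2_ge0.
rewrite -[LHS]/(flow_at (liftX f) 1 n 0) flow_at_lift//.
case: n => [|n]; first exact (esym (in_Gc1 (svalP f))).
by rewrite mul0r subr0 mul1r.
Qed.

End Surjectivity.

(** * A non-trivial element of the kernel *)

Section NontrivialKernel.
Variable R : realType.
Local Notation C := R[i].
Local Notation p2 := (2 * pi : R).

Lemma in_X_riccati : in_X (fun i (_ : R) => (i == 0%N)%:R : C).
Proof.
split => //; exists 1 => // i; apply: ae_true => t; rewrite expr1n.
by case: eqP => _; rewrite ?normr1 ?normr0 lecR ?ler01.
Qed.

(** The equation [v' = v ^ 2]. *)
Definition riccatiX : X R := exist _ _ in_X_riccati.

Lemma iter_riccati0 s : 0 <= s <= p2 -> iter_int riccatiX [:: 0%N] s = p2%:C - s%:C.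
Proof.
move=> hs.
have H2 := primD (prim_cst 0 p2 (p2%:C : C)) (prim_linear 0 p2 (-1 : C)).
rewrite -mulN1r; apply: (prim_unique (prim_iter_int riccatiX 0 [::]) H2 _ _ hs).
  by apply: ae_true => x _; rewrite /coeff /= mulr1 add0r.
by rewrite iter_int_end mulN1r subrr.
Qed.

Lemma iter_riccati00 s : 0 <= s <= p2 ->
  iter_int riccatiX [:: 0%N; 0%N] s = 2^-1 * (p2%:C - s%:C) ^+ 2.
Proof.
move=> hs.
have H := primD (prim_cst 0 p2 (p2%:C : C)) (prim_linear 0 p2 (-1 : C)).
have H2 := primZ 2^-1 (primX 1 H).
rewrite -mulN1r; apply: (prim_unique (prim_iter_int riccatiX 0 [:: 0%N]) H2 _ _ hs).
  apply: ae_true => x /andP[x0 xp].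
  by rewrite iter_riccati0 ?ltW// /coeff /=; field.
by rewrite iter_int_end mulN1r subrr expr0n mulr0.
Qed.

Lemma basic_riccati1 w : 1%N \in w -> basic_int w riccatiX = 0.
Proof.
suff H s : 0 <= s <= p2 -> 1%N \in w -> iter_int riccatiX w s = 0.
  by apply: H; rewrite lexx p2_ge0.
elim: w s => // i w IH s hs; rewrite inE => iw.
apply: (prim_unique (prim_iter_int riccatiX i w) (prim_cst 0 p2 0) _ _ hs).
  apply: ae_true => x /andP[x0 xp]; case/orP: iw => [/eqP <-|iw].
    by rewrite /coeff /= mul0r oppr0.
  by rewrite IH ?ltW// mulr0 oppr0.
by rewrite iter_int_end.
Qed.

Local Notation beta := (liftX (Phat (class_of riccatiX))).

Lemma series_riccati : series_coef (Phat (class_of riccatiX)) 2 = p2%:C /\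
  series_coef (Phat (class_of riccatiX)) 3 = p2%:C ^+ 2.
Proof.
have h0 : 0 <= (0 : R) <= p2 by rewrite lexx p2_ge0.
have I1 : basic_int [:: 1%N] riccatiX = 0 by exact: basic_riccati1.
have I0 : basic_int [:: 0%N] riccatiX = p2%:C by rewrite /basic_int iter_riccati0// subr0.
have I00 : basic_int [:: 0%N; 0%N] riccatiX = 2^-1 * p2%:C ^+ 2.
  by rewrite /basic_int iter_riccati00// subr0.
rewrite series_coef_Phat /= !(flow_coefS, flow_coef0, big_ord_recl, big_ord0) /=.
rewrite !hat_class_of I1 I0 I00 -[(0 - 0 + 1)%N]/1%N -[(1 - 0 + 1)%N]/2%N.
rewrite mulr0 !addr0 !mul1r; split => //.
by rewrite mulrA divff ?mul1r// pnatr_eq0.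
Qed.

(** The two elements have the same return map [r / (1 - 2 pi r)] and the same
    coefficient [1] of [v ^ 2], but the lift has the coefficient [2 t - 2 pi]
    of [v ^ 3] where the Riccati equation has none. The iterated integral of
    the word [[:: 0; 1]] detects it: it is [(2 pi) ^ 3 / 6] for the lift. *)
Lemma lift_riccati_neq : class_of beta <> class_of riccatiX.
Proof.
move=> /class_of_basic_int/(_ [:: 0; 1]%N); rewrite (@basic_riccati1 [:: 0; 1]%N)//.
have p0 := p2_gt0 R; have [c2 c3] := series_riccati.
set P := (p2%:C : C) in c2 c3.
have P0 : P != 0 by rewrite fmorph_eq0 gt_eqF.
have PV : (p2^-1)%:C = P^-1 by rewrite fmorphV.
have b0 t : coeff beta 0 t = 1.
  by rewrite coeff_lift lift_coefS c2 big_ord0 subr0 PV divff.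
have b1 t : 0 < t <= p2 -> coeff beta 1 t = 2 * t%:C - P.
  move=> ht; rewrite coeff_lift lift_coefS big_ord1 lift_coefS c3 c2 big_ord0 subr0 PV divff//.
  rewrite /remaining_time circ_id// rmorphB rmorphM rmorph1 /= PV -/P -[X in X%:R * (1 * _)]/2%N.
  by rewrite mul1r mulrBl divfK// mul1r expr2 mulfK//; ring.
have G := primD (prim_cst 0 p2 P) (prim_linear 0 p2 (-1 : C)).
have I1 s : 0 <= s <= p2 -> iter_int beta [:: 1%N] s = 1 * s%:C * (P + -1 * s%:C).
  move=> hs; apply: (prim_unique (prim_iter_int beta 1 [::]) (primM (prim_linear 0 p2 1) G) _ _ hs).
    by apply: ae_true => x /andP[x0 xp]; rewrite b1 ?x0 ?ltW//=; ring.
  by rewrite iter_int_end mulN1r subrr mulr0.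
have L2 := primZ (- (P / 2)) (primX 1 (prim_linear 0 p2 (1 : C))).
have L3 := primZ (1 / 3) (primX 2 (prim_linear 0 p2 (1 : C))).
have H := primD (prim_cst 0 p2 (P ^+ 3 / 6)) (primD L2 L3).
have h0 : 0 <= (0 : R) <= p2 by rewrite lexx ltW.
have E : basic_int [:: 0; 1]%N beta = P ^+ 3 / 6.
  rewrite /basic_int (prim_unique (prim_iter_int beta 0 [:: 1%N]) H _ _ h0).
  - by rewrite rmorph0 !mulr0 !expr0n /= !mulr0 !addr0.
  - by apply: ae_true => x /andP[x0 xp]; rewrite b0 I1 ?ltW//; field.
  - by rewrite iter_int_end -/P; field.
rewrite E => /eqP.
by rewrite mulf_eq0 expf_eq0 /= (negbTE P0) invr_eq0 pnatr_eq0.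
Qed.

End NontrivialKernel.

(** * The kernel as a subgroup and as the center set *)

Section Kernel.
Variable R : realType.
Local Notation C := R[i].

Lemma Phat1 : Phat (1%g : GX R) = 1%g.
Proof.
apply: Gc_ext => n; rewrite -[RHS]/(X_coef R n) /X_coef series_coef_Phat.
case: n => [|[|n]] //=; first by rewrite flow_coef0 hat_one.
rewrite /flow_coef big_seq big1// => w /words_deg wn.
by rewrite hat_one; case: w wn => //= i w _; rewrite mulr0.
Qed.

Lemma trunc_Xcoef n : trunc n.+1 (X_coef R) = 'X.
Proof.
apply/polyP => i; rewrite coef_poly coefX /X_coef.
by case: ltnP => // h; case: eqP h => // ->.
Qed.

Lemma Gc_mulf1 (f : Gc R) : (f * 1 = f)%g.
Proof.
apply: Gc_ext => n; rewrite -[LHS]/(formal_comp (X_coef R) (series_coef f) n).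
case: n => [|n]; last by rewrite /formal_comp trunc_Xcoef comp_polyX coef_poly ltnSn.
by rewrite (in_Gc0 (in_Gc_comp (in_Gc_X R) (svalP f))); exact (esym (in_Gc0 (svalP f))).
Qed.

Lemma kernel_subgroup : is_subgroup (hom_kernel (@Phat R)).
Proof.
split => [|g h|g] /=; first exact: Phat1.
  by rewrite /hom_kernel /= Phat_morph => -> ->; rewrite Gc_mulf1.
rewrite /hom_kernel /= => g1.
have := Phat_morph (g^-1)%g g; rewrite GX_mulVg Phat1 g1.
by rewrite Gc_mulf1.
Qed.

Lemma kernel_normal : is_normal (hom_kernel (@Phat R)).
Proof.
move=> g h; rewrite /hom_kernel /= => h1.
by rewrite !Phat_morph h1 Gc_mulf1 -Phat_morph GX_mulgV Phat1.
Qed.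

(** Two classes with the same return map differ by an element of the kernel. *)
Lemma kernel_nontrivial : exists g : GX R, hom_kernel (@Phat R) g /\ g <> 1%g.
Proof.
pose alpha := riccatiX R; pose beta := liftX (Phat (class_of alpha)).
exists (class_of beta * (class_of alpha)^-1)%g; split.
  rewrite /hom_kernel /= Phat_morph Phat_surjective -Phat_morph GX_mulgV.
  exact: Phat1.
move=> h; apply: (@lift_riccati_neq R).
by rewrite -[LHS]GX_mulg1 -(GX_mulVg (class_of alpha)) GX_mulA h GX_mul1g.
Qed.

(** Identity theorem: if [n] is the first index with a non-zero coefficient,
    the bound for the tail forces [|d n|] to be of order [r]. *)
Lemma pseries_eq0 (d : nat -> C) (M : R) : 1 <= M -> (forall n, cabs (d n) <= M ^+ n) ->
  (\forall r \near (0 : C^o), pseries_at d r @ \oo --> (0 : C^o)) -> forall n, d n = 0.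
Proof.
move=> M1 dM /nbhs_normP[[e e'] /=]; rewrite ltcE/= => /andP[/eqP -> e0] H.
have M0 : 0 < M by lra.
elim/ltn_ind => n IH; apply: cabs0_eq0; apply/ler_addgt0Pr => eps eps0; rewrite add0r.
(* Inside the disc of validity, of convergence, and small against eps. *)
pose r := Num.min (e / 2) (Num.min (1 / (2 * M)) (eps / (2 * M ^+ n.+1))).
have Mn0 : 0 < M ^+ n.+1 by rewrite exprn_gt0.
have r0 : 0 < r by rewrite !lt_min !divr_gt0 ?mulr_gt0.
have re : r < e by rewrite gt_min; apply/orP; left; lra.
have rM : M * r <= 1 / 2.
  have : r <= 1 / (2 * M) by rewrite !ge_min lexx orbT.
  rewrite -(ler_pM2l M0) => /le_trans; apply.
  by rewrite le_eqVlt; apply/orP; left; apply/eqP; field; rewrite gt_eqF.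
have reps : 2 * (M ^+ n.+1 * r) <= eps.
  have : r <= eps / (2 * M ^+ n.+1) by rewrite !ge_min lexx !orbT.
  rewrite ler_pdivlMr ?mulr_gt0//; apply: le_trans.
  by rewrite le_eqVlt; apply/orP; left; apply/eqP; ring.
have hq : 0 <= M * r <= 1 / 2 by rewrite rM mulr_ge0// ltW.
have hr : pseries_at d r%:C @ \oo --> (0 : C^o).
  by apply: H; rewrite /= sub0r normrN -/(e%:C) cabsE ltcR cabs_real gtr0_norm.
have tb i : cabs (d i * r%:C ^+ i) <= 1 * (M * r) ^+ i.
  rewrite mul1r cabsM cabsX cabs_real gtr0_norm// exprMn ler_wpM2r//.
  by rewrite exprn_ge0// ltW.
have := series_tail_bound n.+1 hq tb hr.
rewrite sub0r cabsN big_ord_recr /= big1 ?add0r; last by move=> i _; rewrite (IH _ (ltn_ord i)) mul0r.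
rewrite cabsM cabsX cabs_real gtr0_norm// mulr1 exprMn [r ^+ n.+1]exprSr.
have rn0 : 0 < r ^+ n by rewrite exprn_gt0.
rewrite !mulrA mulrAC ler_pM2r// => h.
by apply: le_trans h _; move: reps; rewrite mulrA.
Qed.

Lemma pseries_X r : pseries_at (X_coef R) r @ \oo --> (r : C^o).
Proof.
apply/cvg_cabsP => e e0; exists 2 => // -[|[|n]]//= _.
rewrite /pseries_at /series /= big_mkord big_ord_recl mul0r add0r big_ord_recl.
rewrite big1 ?addr0 => [|i _]; last by rewrite /X_coef /= mul0r.
by rewrite /X_coef /= mul1r expr1 subrr cabs0 ltW.
Qed.

(** From right to left the equality of the germs has to be turned into an
    equality of power series, by the identity theorem. *)
Lemma kernelE : hom_kernel (@Phat R) = class_of @` center_set R.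
Proof.
apply/seteqP; split => [g /= g1|_ [a ca <-]].
  exists (rep g); last exact: repK.
  have := first_return_Phat (rep g); rewrite repK [Phat g]g1 /center_set /=.
  apply: filterS => r [z fz sz].
  have sz' : pseries_at (X_coef R) r @ \oo --> (z : C^o) by exact: sz.
  have e : r = z by exact (cvg_unique (@norm_hausdorff _ C^o) (@pseries_X r) sz').
  by move: fz; rewrite -e.
rewrite /hom_kernel /=.
have [M M1 cM] := in_Gc_growth (svalP (Phat (class_of a))).
set c := sval _ in cM.
have cX : \forall r \near (0 : C^o), pseries_at c r @ \oo --> (r : C^o).
  apply: filterS2 ca (first_return_Phat a) => r [[v sv] h1] [z [_ h2] cz].
  have e : r = z by rewrite -(h1 v sv) (h2 v sv).
  by move: cz; rewrite -e.
apply: Gc_ext => n; rewrite -[RHS]/(X_coef R n).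
apply/eqP; rewrite -subr_eq0; apply/eqP.
apply: (@pseries_eq0 (fun n => c n - X_coef R n) (M + 1)).
- by lra.
- move=> k; apply: le_trans (cabsB _ _) _.
  have h1 : cabs (c k) <= M ^+ k by rewrite -cabs_le.
  have h2 : cabs (X_coef R k) <= (k == 1%N)%:R.
    by rewrite /X_coef; case: eqP; rewrite ?cabs1 ?cabs0.
  apply: le_trans (lerD h1 h2) _.
  case: k {h1 h2} => [|[|k]]; rewrite ?expr0 ?expr1 ?addr0//.
  by rewrite lerXn2r ?nnegrE; lra.
- apply: filterS cX => r cr.
  have e : pseries_at (fun n => c n - X_coef R n) r =
      pseries_at c r - pseries_at (X_coef R) r.
    apply/funext => k; rewrite /pseries_at /series /= -[RHS]sumrB.
    by apply: eq_bigr => i _; rewrite mulrBl.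
  have h := cvgB cr (@pseries_X r).
  by rewrite e -(subrr r); exact: h.
Qed.

End Kernel.

(** * Contractions of a set within itself *)

Section Contractions.
Variables (R : realType) (T : topologicalType).
Local Notation I := (`[0 : R, 1 : R]%classic).

Lemma continuous_paste (S : topologicalType) (phi : S -> R) (f g : S -> T) (a : R) :
  continuous phi -> continuous f -> continuous g ->
  (forall x, phi x = a -> f x = g x) ->
  continuous (fun x => if phi x <= a then f x else g x).
Proof.
move=> cphi cf cg fg; set h := fun x => _.
pose A := phi @^-1` [set y | y <= a]; pose B := phi @^-1` [set y | a <= y].
have cA : closed A by apply: (closed_comp _ (@closed_le R a)) => x _; exact: cphi.
have cB : closed B by apply: (closed_comp _ (@closed_ge R a)) => x _; exact: cphi.
have AB : A `|` B = setT.
  by apply/seteqP; split => // x _; rewrite /A /B /=; have [h1|/ltW h1] := leP (phi x) a; [left|right].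
apply/continuous_subspace_setT; rewrite -AB; apply: withinU_continuous => //.
  apply: (@subspace_eq_continuous _ _ _ (f : subspace A -> T)).
    by move=> x /set_mem xa; rewrite /h /from_subspace ifT.
  exact: continuous_subspaceT.
apply: (@subspace_eq_continuous _ _ _ (g : subspace B -> T)).
  move=> x /set_mem ax; rewrite /h /from_subspace; case: ifPn => // xa.
  by rewrite fg//; apply/eqP; rewrite eq_le xa; exact: ax.
exact: continuous_subspaceT.
Qed.

Definition clamp (x : R) : R := Num.max 0 (Num.min 1 x).

Lemma clamp_itv x : 0 <= clamp x <= 1.
Proof. by rewrite /clamp le_max lexx/= ge_max ler01 ge_min lexx. Qed.

Lemma clamp_id x : 0 <= x <= 1 -> clamp x = x.
Proof. by move=> /andP[x0 x1]; rewrite /clamp (min_idPr x1) (max_idPr x0). Qed.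

Lemma clamp_le0 x : x <= 0 -> clamp x = 0.
Proof.
move=> x0; rewrite /clamp (min_idPr _) ?(max_idPl _)//.
by apply: le_trans x0 _.
Qed.

Lemma clamp_ge1 x : 1 <= x -> clamp x = 1.
Proof. by move=> x0; rewrite /clamp (min_idPl x0) (max_idPr ler01). Qed.

Lemma clamp_continuous : continuous clamp.
Proof.
move=> x; apply: continuous_max; first exact: cvg_cst.
by apply: continuous_min; [exact: cvg_cst|exact: cvg_id].
Qed.

Lemma continuous_clamped (c : R -> T) : {within I, continuous c} -> continuous (c \o clamp).
Proof.
move=> hc x U; have Ix : I (clamp x) by rewrite /= in_itv/= clamp_itv.
move=> /(hc (clamp x)) h0.
have h : within I (nbhs (clamp x)) (c @^-1` U) by rewrite (nbhs_subspace_in Ix); exact: h0.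
have h2 : nbhs x (clamp @^-1` [set y | I y -> U (c y)]) by exact: (@clamp_continuous x _ h).
by apply: filterS h2 => y /=; apply; rewrite in_itv/= clamp_itv.
Qed.

Variables (A : set T) (p : T) (H : R * T -> T).
Hypothesis Ap : A p.
Hypothesis cH : continuous H.
Hypothesis HA : forall t x, I t -> A x -> A (H (t, x)).
Hypothesis H0 : forall x, A x -> H (0, x) = x.
Hypothesis H1 : forall x, A x -> H (1, x) = p.

Let half2 : 2 * (1 / 2) = 1 :> R. Proof. by field. Qed.
Let half4 : 4 * (1 / 2) = 2 :> R. Proof. by field. Qed.
Let two1 : 2 - 1 = 1 :> R. Proof. by ring. Qed.

Lemma contraction_contractible : contractible R A.
Proof.
exists p => //; exists H; split=> //.
exact: continuous_subspaceT.
Qed.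

Lemma continuous_contraction (S : topologicalType) (t : S -> R) (x : S -> T) :
  continuous t -> continuous x -> continuous (fun s => H (t s, x s)).
Proof.
move=> ct cx s; apply: (@continuous_comp _ _ _ (fun s => (t s, x s)) H); last exact: cH.
exact: (cvg_pair (ct s) (cx s)).
Qed.

Lemma contraction_arcwise_connected : arcwise_connected R A.
Proof.
move=> x y Ax Ay.
pose c (t : R) := if t <= 1 / 2 then H (2 * t, x) else H (2 - 2 * t, y).
exists c; split.
- split.
    apply: continuous_subspaceT; apply: continuous_paste.
    + by move=> t; exact: cvg_id.
    + apply: continuous_contraction => t; last exact: cvg_cst.
      by apply: cvgM; [exact: cvg_cst|exact: cvg_id].
    + apply: continuous_contraction => t; last exact: cvg_cst.
      by apply: cvgB; [exact: cvg_cst|apply: cvgM; [exact: cvg_cst|exact: cvg_id]].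
    + by move=> t ->; rewrite half2 two1 !H1.
  move=> t; rewrite /= in_itv/= => /andP[t0 t1]; rewrite /c.
  by case: leP => h; apply: HA => //; rewrite /= in_itv/=; apply/andP; split; lra.
- by rewrite /c mulr0 H0// divr_ge0.
- rewrite /c ifF; last by apply/negbTE; rewrite -ltNge; lra.
  by rewrite mulr1 subrr H0.
Qed.

(** The contraction of a loop [c] moves its base point, along
    [u |-> H (u, c 0)]. In the first half of the homotopy [c] is contracted
    while this path is travelled forth before and back after it, with
    parameter [u = 2 t]; at [t = 1/2] the loop goes to [p] and returns along
    the same path, and in the second half this path is retracted. *)
Lemma contraction_simply_connected : simply_connected R A.
Proof.
split; first exact: contraction_arcwise_connected.
move=> c [cc cA] c01; pose c' := c \o clamp.
have cc' : continuous c' by exact: continuous_clamped.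
have c'A s : A (c' s) by apply: cA; rewrite /= in_itv/= clamp_itv.
have c'0 s : s <= 0 -> c' s = c 0 by move=> s0; rewrite /c' /= clamp_le0.
have c'1 s : 1 <= s -> c' s = c 0 by move=> s0; rewrite /c' /= clamp_ge1.
have A0 : A (c 0) by apply: cA; rewrite /= in_itv/= lexx ler01.
(* Position on the path of the base point, once this path takes the first and
   the last third of the time. *)
pose m (s : R) := clamp (Num.min (3 * s) (3 - 3 * s)).
have cm : continuous m.
  move=> s; apply: (@continuous_comp _ _ _ (fun s : R => Num.min (3 * s) (3 - 3 * s)) clamp);
    last exact: clamp_continuous.
  apply: continuous_min; first by apply: cvgM; [exact: cvg_cst|exact: cvg_id].
  by apply: cvgB; [exact: cvg_cst|apply: cvgM; [exact: cvg_cst|exact: cvg_id]].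
have m0 : m 0 = 0 by rewrite /m clamp_le0// mulr0 ge_min lexx.
have m1 : m 1 = 0 by rewrite /m clamp_le0// mulr1 subrr ge_min lexx orbT.
have mI s : 0 <= m s <= 1 by exact: clamp_itv.
(* The clamp in c' makes the argument constant on the parts of the time that
   are reserved for the path of the base point. *)
pose K1 (z : R * R) := H (2 * z.2 * m z.1, c' (z.1 * (1 + 4 * z.2) - 2 * z.2)).
pose K2 (z : R * R) := H ((2 - 2 * z.2) * m z.1, c 0).
have cfst : continuous (fst : R * R -> R) by move=> z; exact: cvg_fst.
have csnd : continuous (snd : R * R -> R) by move=> z; exact: cvg_snd.
have cm1 : continuous (fun z : R * R => m z.1).
  by move=> z; apply: (@continuous_comp _ _ _ fst m); [exact: cfst|exact: cm].
have csc (k : R) : continuous (fun z : R * R => k * z.2).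
  by move=> z; apply: cvgM; [exact: cvg_cst|exact: csnd].
have cK1 : continuous K1.
  apply: continuous_contraction.
    by move=> z; apply: cvgM; [exact: csc|exact: cm1].
  move=> z; apply: (@continuous_comp _ _ _ (fun z : R * R => z.1 * (1 + 4 * z.2) - 2 * z.2) c');
    last exact: cc'.
  apply: cvgB; last exact: csc.
  apply: cvgM; first exact: cfst.
  by apply: cvgD; [exact: cvg_cst|exact: csc].
have cK2 : continuous K2.
  apply: continuous_contraction => z; last exact: cvg_cst.
  apply: cvgM; last exact: cm1.
  by apply: cvgB; [exact: cvg_cst|exact: csc].
exists (fun z => if z.2 <= 1 / 2 then K1 z else K2 z); split.
- apply: continuous_subspaceT; apply: continuous_paste => // -[s t] /= ->.
  rewrite /K1 /K2 /= half2 half4 two1 mul1r.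
  have [s1|s1] := leP s (1 / 3); first by rewrite c'0//; lra.
  have [s2|s2] := leP (2 / 3) s; first by rewrite c'1//; lra.
  have -> : m s = 1 by rewrite /m clamp_ge1// le_min; apply/andP; split; lra.
  by rewrite !H1.
- move=> s t; rewrite /= !in_itv/= => hs /andP[t0 t1].
  have /andP[ms0 ms1] := mI s.
  case: leP => h; apply: HA => //=; rewrite in_itv/=.
    by apply/andP; split; [apply: mulr_ge0|apply: mulr_ile1]; lra.
  by apply/andP; split; [apply: mulr_ge0|apply: mulr_ile1]; lra.
- move=> s; rewrite /= in_itv/= => hs; split.
    rewrite ifT ?divr_ge0// /K1 /= !mulr0 mul0r addr0 mulr1 subr0 H0//.
    by rewrite /c' /= clamp_id.
  rewrite ifF; last by apply/negbTE; rewrite -ltNge; lra.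
  by rewrite /K2 /= mulr1 subrr mul0r H0.
- move=> t; rewrite /= in_itv/= => /andP[t0 t1]; split.
    case: ifPn => _; last by rewrite /K2 /= m0 mulr0 H0.
    by rewrite /K1 /= m0 mulr0 H0// c'0// mul0r sub0r oppr_le0 mulr_ge0.
  case: ifPn => _; last by rewrite /K2 /= m1 mulr0 H0.
  by rewrite /K1 /= m1 mulr0 H0// c'1//; lra.
Qed.

End Contractions.

(** * Topology of the kernel *)

Section Topology.
Variable R : realType.
Local Notation C := R[i].
Local Notation I := (`[0 : R, 1 : R]%classic).
Implicit Types (g h x : GX R) (w : seq nat).

Lemma initial_cvgP (S : choiceType) (T : topologicalType) (f : S -> T)
    (F : set_system S) (s : S) : Filter F ->
  F --> (s : initial_topology f) <-> f @ F --> f s.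
Proof.
move=> FF; split => [h|h A].
  by move=> A /(@initial_continuous _ _ f s) /h.
rewrite /= nbhsE => -[_ [[B oB <-] Bs] BA].
apply: filterS BA _; apply: h; exact: open_nbhs_nbhs.
Qed.

Lemma GX_cvgP (F : set_system (GX R)) g : Filter F ->
  F --> g <-> forall w, (hat_int w : GX R -> C^o) @ F --> (hat_int w g : C^o).
Proof.
move=> FF; split => [h w|h].
  by apply/initial_cvgP; exact: (proj1 (cvg_sup _ _ _) h w).
by apply/cvg_sup => w; apply/initial_cvgP; exact: h.
Qed.

Lemma Gc_cvgP (F : set_system (Gc R)) (f : Gc R) : Filter F ->
  F --> f <-> forall k, d_ k.+1 @ F --> d_ k.+1 f.
Proof.
move=> FF; split => [h k|h].
  by apply/initial_cvgP; exact: (proj1 (cvg_sup _ _ _) h k).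
by apply/cvg_sup => k; apply/initial_cvgP; exact: h.
Qed.

Lemma hat_continuous w : continuous (hat_int w : GX R -> C^o).
Proof. by move=> g; have [h _] := @GX_cvgP (nbhs g) g _; apply: h. Qed.

Lemma GX_continuousP (S : topologicalType) (f : S -> GX R) :
  (forall w, continuous (fun s => hat_int w (f s) : C^o)) -> continuous f.
Proof. by move=> h s; apply/GX_cvgP => w; exact: h. Qed.

Lemma scaled_continuous (S : topologicalType) (k : C) (f : S -> C^o) :
  continuous f -> continuous (fun s => k * f s : C^o).
Proof. by move=> cf s; exact: (cvgM (cvg_cst (k : C^o)) (cf s)). Qed.

Lemma flow_coef_continuous m n :
  continuous (fun g : GX R => flow_coef m n (fun w => hat_int w g) : C^o).
Proof.
rewrite /flow_coef; elim: (words n) => [|w ws IH].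
  have -> : (fun g : GX R => \sum_(w <- [::]) (word_coef m w)%:R * hat_int w g : C^o) = fun=> 0.
    by apply/funext => g; rewrite big_nil.
  exact: cst_continuous.
have -> : (fun g : GX R => \sum_(w <- w :: ws) (word_coef m w)%:R * hat_int w g : C^o) =
    (fun g => (word_coef m w)%:R * hat_int w g + \sum_(w <- ws) (word_coef m w)%:R * hat_int w g).
  by apply/funext => g; rewrite big_cons.
by move=> g; exact: (cvgD (scaled_continuous (@hat_continuous w) (x := g)) (IH g)).
Qed.

Lemma Phat_continuous : continuous (@Phat R).
Proof.
move=> g; apply: (proj2 (Gc_cvgP (Phat g) (fmap_filter (@Phat R) (nbhs_filter g)))) => k.
exact: (@flow_coef_continuous 1 k.+1).
Qed.

Local Notation K := (hom_kernel (@Phat R)).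

Lemma kernelP g : K g <-> forall n, flow_coef 1 n.+1 (fun w => hat_int w g) = 0.
Proof.
split => [h n|h].
  have : series_coef (Phat g) n.+2 = X_coef R n.+2 by rewrite [Phat g]h.
  by [].
apply: Gc_ext => -[|[|n]]; rewrite ?series_coef_Phat //=.
by rewrite flow_coef0.
Qed.

Lemma kernel_closed : closed K.
Proof.
have -> : K = \bigcap_n ((fun g : GX R => flow_coef 1 n.+1 (fun w => hat_int w g) : C^o)
    @^-1` [set 0]).
  apply/seteqP; split => [g /kernelP h n _|g h]; first exact: h.
  by apply/kernelP => n; exact: h.
apply: closed_bigI => n _; apply: closed_comp.
  by move=> g _; exact: flow_coef_continuous.
exact: accessible_closed_set1 (hausdorff_accessible (@norm_hausdorff _ C^o)) _.
Qed.

Lemma left_mul_continuous x : continuous (fun g : GX R => (x * g)%g).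
Proof.
apply: GX_continuousP => w.
have -> : (fun g => hat_int w (x * g)%g : C^o) =
    (fun g => word_conv (fun u => hat_int u x) (fun v => hat_int v g) w).
  by apply/funext => g; rewrite hat_mul.
move: (fun u => hat_int u x) => f; elim: w f => [|i w IH] f.
  exact: scaled_continuous (@hat_continuous [::]).
move=> g; exact: (cvgD (scaled_continuous (@hat_continuous (i :: w)) (x := g)) (IH _ g)).
Qed.

Lemma real_complex_continuous : continuous (fun t : R => t%:C : C^o).
Proof.
move=> t; apply/cvg_cabsP => e e0; exists e => // s /=.
move=> h; apply: le_trans (ltW h); rewrite distrC -cabs_real rmorphB.
exact: lexx.
Qed.

Lemma dil_continuous : continuous (fun z : R * GX R => dilG (1 - z.1) z.2).
Proof.
apply: GX_continuousP => w.
have -> : (fun z : R * GX R => hat_int w (dilG (1 - z.1) z.2) : C^o) =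
    (fun z => ((1 - z.1) ^+ word_deg w)%:C * hat_int w z.2).
  by apply/funext => z; rewrite hat_dilG.
have c2 : continuous (fun z : R * GX R => hat_int w z.2 : C^o).
  by move=> z; apply: (continuous_comp (@cvg_snd _ _ _ _ _)); exact: hat_continuous.
have c1 : continuous (fun z : R * GX R => (1 - z.1) ^+ word_deg w).
  elim: (word_deg w) => [|n IH]; first exact: cst_continuous.
  have -> : (fun z : R * GX R => (1 - z.1) ^+ n.+1) = (fun z => (1 - z.1) * (1 - z.1) ^+ n).
    by apply/funext => z; rewrite exprS.
  move=> z; apply: (cvgM _ (IH z)).
  by apply: cvgB; [exact: cvg_cst|exact: cvg_fst].
have c3 : continuous (fun z : R * GX R => ((1 - z.1) ^+ word_deg w)%:C : C^o).
  by move=> z; apply: (continuous_comp (@c1 z)); exact: real_complex_continuous.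
by move=> z; exact: (cvgM (c3 z) (c2 z)).
Qed.

Lemma dilG1 g : dilG 1 g = g.
Proof. by apply: hat_ext => w; rewrite hat_dilG expr1n mul1r. Qed.

Lemma dilG0 g : dilG 0 g = 1%g.
Proof.
apply: hat_ext => -[|i w]; rewrite hat_dilG hat_one; first by rewrite expr0 mul1r.
by rewrite expr0n /= mul0r.
Qed.

(** The coefficient of [r ^ (n + 1)] in the return map is homogeneous of degree
    [n] for dilations. *)
Lemma kernel_dil t g : K g -> K (dilG t g).
Proof.
move=> /kernelP h; apply/kernelP => n.
have := h n; rewrite /flow_coef => e.
transitivity ((t ^+ n.+1)%:C * \sum_(w <- words n.+1) (word_coef 1 w)%:R * hat_int w g).
  rewrite mulr_sumr; apply: eq_big_seq => w /words_deg wn.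
  by rewrite hat_dilG wn; ring.
by rewrite e mulr0.
Qed.

Definition hat_ball (ws : seq (seq nat)) (e : R) : set (GX R) :=
  [set g | forall w, w \in ws -> cabs (hat_int w g - hat_int w 1%g) < e].

Lemma hat_ball_open ws e : open (hat_ball ws e).
Proof.
rewrite openE => g gB; rewrite /interior.
suff H ws' : (forall w, w \in ws' -> cabs (hat_int w g - hat_int w 1%g) < e) ->
    nbhs g (hat_ball ws' e) by exact: H.
elim: ws' {gB} => [|w ws' IH] h.
  have -> : hat_ball [::] e = setT by apply/seteqP; split.
  exact: (@filterT _ _ (nbhs_filter g)).
have h1 : nbhs g (hat_ball ws' e) by apply: IH => u hu; apply: h; rewrite inE hu orbT.
have hw := h w (mem_head _ _).
have e0 : 0 < (e - cabs (hat_int w g - hat_int w 1%g)) / 2 by rewrite divr_gt0// subr_gt0.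
have h2 := proj1 (cvg_cabsP (nbhs_filter g) _ _) (@hat_continuous w g) _ e0.
refine (@filterS _ _ (nbhs_filter g) _ _ _ (@filterI _ _ (nbhs_filter g) _ _ h1 h2)).
move=> k [kB kw] u; rewrite inE => /orP[/eqP ->|]; last exact: kB.
apply: le_lt_trans (cabs_distD (hat_int w g) _ _) _; lra.
Qed.

(** The sets that contain such a ball form a filter that converges to [1], so
    every neighbourhood of [1] is among them. *)
Lemma hat_ball_basis (U : set (GX R)) : nbhs (1%g : GX R) U ->
  exists ws e, 0 < e /\ hat_ball ws e `<=` U.
Proof.
pose F : set_system (GX R) := [set V | exists ws e, 0 < e /\ hat_ball ws e `<=` V].
have FF : Filter F.
  split.
  - by exists [::], 1.
  - move=> P Q [ws [e [e0 hP]]] [ws' [e' [e'0 hQ]]].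
    exists (ws ++ ws'), (Num.min e e'); split; first by rewrite lt_min e0.
    move=> g gB; split; [apply: hP|apply: hQ] => w hw.
      by have := gB w; rewrite mem_cat hw lt_min => /(_ isT)/andP[].
    by have := gB w; rewrite mem_cat hw orbT lt_min => /(_ isT)/andP[].
  - by move=> P Q PQ [ws [e [e0 hP]]]; exists ws, e; split => // g /hP /PQ.
have : F --> (1%g : GX R).
  apply/GX_cvgP => w; apply/cvg_cabsP => e e0; exists [:: w], e; split => // g /(_ w).
  by rewrite mem_head => /(_ isT)/ltW.
by move=> h /h.
Qed.

Lemma hat_ball1 ws e : 0 < e -> hat_ball ws e 1%g.
Proof. by move=> e0 w _; rewrite subrr cabs0. Qed.

(** For [0 <= t <= 1] the dilation does not increase any iterated integral of a
    non-empty word. *)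
Lemma hat_ball_dil ws e t g : 0 <= t <= 1 -> hat_ball ws e g -> hat_ball ws e (dilG t g).
Proof.
move=> /andP[t0 t1] gB [|i w] hw; first by have := gB _ hw.
have e1 : hat_int (i :: w) (1%g : GX R) = 0 by rewrite hat_one.
apply: le_lt_trans (gB _ hw); rewrite hat_dilG e1 !subr0 cabsM cabs_real.
rewrite ler_piMl ?cabs_ge0// ger0_norm ?exprn_ge0//.
by rewrite exprn_ile1.
Qed.

(** The dilations conjugated by the left translation by [x]: at time [0] the
    identity, at time [1] the constant map to [x]. *)
Definition translated_dil x (z : R * GX R) : GX R := (x * dilG (1 - z.1) (x^-1 * z.2))%g.

Lemma translated_dil_continuous x : continuous (translated_dil x).
Proof.
move=> z; apply: (@continuous_comp _ _ _ (fun z : R * GX R => dilG (1 - z.1) (x^-1 * z.2)%g)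
  (fun g => (x * g)%g)); last exact: left_mul_continuous.
apply: (@continuous_comp _ _ _ (fun z : R * GX R => (z.1, (x^-1 * z.2)%g))
  (fun z : R * GX R => dilG (1 - z.1) z.2)); last exact: dil_continuous.
have cf : continuous (fst : R * GX R -> R) by move=> y; exact: cvg_fst.
have cs : continuous (fun z : R * GX R => (x^-1 * z.2)%g).
  move=> y; apply: (@continuous_comp _ _ _ snd (fun g => (x^-1 * g)%g)); first exact: cvg_snd.
  exact: left_mul_continuous.
exact: (cvg_pair (cf z) (cs z)).
Qed.

Lemma GX_mulKg x g : (x * (x^-1 * g) = g)%g.
Proof. by rewrite GX_mulA GX_mulgV GX_mul1g. Qed.

Lemma GX_mulVKg x g : (x^-1 * (x * g) = g)%g.
Proof. by rewrite GX_mulA GX_mulVg GX_mul1g. Qed.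

(** The neighbourhoods of [x] are the left translates of those of [1]. *)
Lemma kernel_local (P : set (GX R) -> Prop) :
  (forall x ws e, K x -> 0 < e -> P (K `&` [set g | hat_ball ws e (x^-1 * g)%g])) ->
  locally P K.
Proof.
move=> HP x U Kx oU Ux.
have h1 : nbhs (1%g : GX R) ((fun g => (x * g)%g) @^-1` U).
  have U1 : nbhs (x * 1)%g U by rewrite GX_mulg1; exact: open_nbhs_nbhs.
  exact: (@left_mul_continuous x 1%g _ U1).
have [ws [e [e0 hB]]] := hat_ball_basis h1.
exists [set g | hat_ball ws e (x^-1 * g)%g]; split.
- by have /continuousP h2 := @left_mul_continuous (x^-1)%g; exact: (h2 _ (hat_ball_open ws e)).
- by rewrite /= GX_mulVg; exact: hat_ball1.
- by move=> g [_ /hB /=]; rewrite GX_mulKg.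
- exact: HP.
Qed.

Section Neighbourhood.
Variables (x : GX R) (ws : seq (seq nat)) (e : R).
Hypothesis Kx : K x.
Hypothesis e0 : 0 < e.
Let A := K `&` [set g | hat_ball ws e (x^-1 * g)%g].

Let Ax : A x.
Proof. by split => //=; rewrite GX_mulVg; exact: hat_ball1. Qed.

Let HA t g : I t -> A g -> A (translated_dil x (t, g)).
Proof.
have [K1 KM KV] := kernel_subgroup R.
rewrite /= in_itv/= => /andP[t0 t1] [Kg gB]; split.
  exact: KM Kx (kernel_dil _ (KM _ _ (KV _ Kx) Kg)).
rewrite /= /translated_dil /= GX_mulVKg; apply: hat_ball_dil => //.
by apply/andP; split; lra.
Qed.

Let H0 g : A g -> translated_dil x (0, g) = g.
Proof. by move=> _; rewrite /translated_dil /= subr0 dilG1 GX_mulKg. Qed.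

Let H1 g : A g -> translated_dil x (1, g) = x.
Proof. by move=> _; rewrite /translated_dil /= subrr dilG0 GX_mulg1. Qed.

Lemma neighbourhood_simply_connected : simply_connected R A.
Proof.
exact: (contraction_simply_connected (@translated_dil_continuous x) HA H0 H1).
Qed.

Lemma neighbourhood_arcwise_connected : arcwise_connected R A.
Proof. exact: neighbourhood_simply_connected.1. Qed.

End Neighbourhood.

Lemma kernel_contractible : contractible R K /\ arcwise_connected R K.
Proof.
have [K1 _ _] := kernel_subgroup R.
have cH := dil_continuous.
have HK t g : I t -> K g -> K (dilG (1 - (t, g).1) (t, g).2) by move=> _; exact: kernel_dil.
have H0 g : K g -> dilG (1 - (0 : R, g).1) (0 : R, g).2 = g by rewrite subr0 dilG1.
have H1 g : K g -> dilG (1 - (1 : R, g).1) (1 : R, g).2 = 1%g by rewrite subrr dilG0.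
split; first exact: (contraction_contractible K1 cH HK H0 H1).
exact: (contraction_arcwise_connected cH HK H0 H1).
Qed.

End Topology.

Theorem theorem3p7 (R : realType) :
  exists Phat : GX R -> Gc R,
    [/\ forall a : X R, is_first_return_map a (Phat (class_of a)),
        [/\ continuous Phat,
            {morph Phat : g h / (g * h)%g}
          & forall f : Gc R, exists g : GX R, Phat g = f],
        hom_kernel Phat = class_of @` center_set R
      & [/\ (exists g : GX R, hom_kernel Phat g /\ g <> 1%g),
            (is_subgroup (hom_kernel Phat) /\ is_normal (hom_kernel Phat)),
            closed (hom_kernel Phat),
            (contractible R (hom_kernel Phat) /\
             arcwise_connected R (hom_kernel Phat))
          & (locally (simply_connected R) (hom_kernel Phat) /\
             locally (arcwise_connected R) (hom_kernel Phat))]].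
Proof.
exists (@Phat R); split.
- exact: first_return_Phat.
- split; [exact: Phat_continuous|exact: Phat_morph|].
  by move=> f; exists (class_of (liftX f)); exact: Phat_surjective.
- exact: kernelE.
split.
- exact: kernel_nontrivial.
- by split; [exact: kernel_subgroup|exact: kernel_normal].
- exact: kernel_closed.
- exact: kernel_contractible.
split; apply: kernel_local => x ws e Kx e0.
  exact: neighbourhood_simply_connected.
exact: neighbourhood_arcwise_connected.
Qed.
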